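(* Let $p$ be an odd prime and let $G = \big\langle \{a\} \cup \{ b^{(j)}_i \mid 1 \le j \le p,\ 1 \le i \le r_j\} \big\rangle$ be a generalised multi-edge spinal group, that is, a group in the class $\mathscr{C}$, acting on the regular $p$-adic rooted tree $T$, with families $\mathbf{b}^{(j)} = \{b^{(j)}_1,\ldots,b^{(j)}_{r_j}\}$, $j\in\{1,\ldots,p\}$, of directed generators. (1) If every non-empty family $\mathbf{b}^{(j)}$, $j \in \{1,\ldots,p\}$, features at least one non-constant defining vector, then $G$ is regular branch over $\gamma_3(G)$. Consequently, if $G$ is torsion, then $G$ is just infinite and branch. (2) If the group $G$ is torsion, then $G$ does not contain any proper dense subgroups, with respect to the profinite topology. The same holds for groups commensurable to $G$. (3) Suppose that the families $\mathbf{b}^{(1)}, \ldots, \mathbf{b}^{(p)}$ of directed generators of $G$ satisfy the additional conditions: (i) every non-empty family $\mathbf{b}^{(j)}$, $j\in\{1,\ldots,p\}$, features at least one non-symmetric defining vector; (ii) there are at least two directed automorphisms, from two distinct families, that have the same defining vector. Then $G$ does not have the congruence subgroup property.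
   Context: Let $p$ be an odd prime. $T$ is the regular $p$-adic rooted tree: its vertices $u_\omega$ are indexed by the finite words $\omega$ over $X=\{1,\ldots,p\}$, the root being the empty word, with an edge from $u_\omega$ to $u_{\omega x}$ for each $x\in X$; the $n$th level consists of the $u_\omega$ with $|\omega|=n$. For a vertex $u$, $T_u$ is the full subtree rooted at $u$, naturally identified with $T$ by deleting the prefix. For $G\le \mathrm{Aut}(T)$: $\mathrm{Stab}_G(u)$ is the stabiliser of $u$; $\mathrm{Stab}_G(n)$ is the pointwise stabiliser of the $n$th level; $\psi_1\colon \mathrm{Stab}_{\mathrm{Aut}(T)}(1)\to \mathrm{Aut}(T)\times\overset{p}{\ldots}\times\mathrm{Aut}(T)$ is the natural isomorphism given by restriction to the subtrees rooted at the first-level vertices $u_1,\ldots,u_p$. The class $\mathscr{C}$. Let $a$ be the rooted automorphism that permutes the first-level vertices (with their subtrees) according to the $p$-cycle $(1\;2\;\ldots\;p)$. A datum $\mathbf{E}=(\mathbf{E}^{(1)},\ldots,\mathbf{E}^{(p)})$ consists, for each $j\in\{1,\ldots,p\}$, of an integer $r_j\in\{0,\ldots,p-1\}$, with $r_j\neq 0$ for at least one $j$, and an $r_j$-tuple $\mathbf{E}^{(j)}=(\mathbf{e}^{(j)}_1,\ldots,\mathbf{e}^{(j)}_{r_j})$ of linearly independent vectors $\mathbf{e}^{(j)}_i=(e^{(j)}_{i,1},\ldots,e^{(j)}_{i,p-1})\in(\mathbb{Z}/p\mathbb{Z})^{p-1}$. The generalised multi-edge spinal group in standard form associated to $\mathbf{E}$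 is $G_{\mathbf{E}}=\langle a,\mathbf{b}^{(1)},\ldots,\mathbf{b}^{(p)}\rangle$, where the family $\mathbf{b}^{(j)}=\{b^{(j)}_1,\ldots,b^{(j)}_{r_j}\}$ consists of the directed automorphisms $b^{(j)}_i\in\mathrm{Stab}_{\mathrm{Aut}(T)}(1)$ defined recursively by $$\psi_1(b^{(j)}_i)=\big(a^{e^{(j)}_{i,j}},\ldots,a^{e^{(j)}_{i,p-1}},b^{(j)}_i,a^{e^{(j)}_{i,1}},\ldots,a^{e^{(j)}_{i,j-1}}\big),$$ with $b^{(j)}_i$ in coordinate $p-j+1$; $\mathbf{e}^{(j)}_i$ is the defining vector of $b^{(j)}_i$. The class $\mathscr{C}$ consists of all subgroups of $\mathrm{Aut}(T)$ that are conjugate in $\mathrm{Aut}(T)$ to some $G_{\mathbf{E}}$; its members are called generalised multi-edge spinal groups. For a member of $\mathscr{C}$ that is a conjugate of $G_{\mathbf{E}}$, the generators, the families $\mathbf{b}^{(j)}$ and the defining vectors are those transported from $G_{\mathbf{E}}$ by the conjugation (and are denoted by the same symbols). A vector $(e_1,\ldots,e_{p-1})$ is constant if $e_1=\ldots=e_{p-1}$, and non-symmetric if $e_i\neq e_{p-i}$ for some $i\in\{1,\ldots,p-1\}$. $\gamma_3(G)=[[G,G],G]$ is the third term of the lower central series. A group $G\le\mathrm{Aut}(T)$ is spherically transitive if it acts transitively on each level. $\mathrm{Rstab}_G(u)$ is the subgroup of elements of $G$ fixing all vertices outside $T_u$, and $\mathrm{Rstab}_G(n)=\prod_{|\omega|=n}\mathrm{Rstab}_G(u_\omega)$.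 A spherically transitive $G$ is branch if $\mathrm{Rstab}_G(n)$ has finite index in $G$ for all $n$. $G$ is fractal if for every vertex $u$ the restriction of $\mathrm{Stab}_G(u)$ to $T_u$ coincides with $G$ after the natural identification of $T_u$ with $T$. $G$ is regular branch over $K$ if $G$ is branch and fractal, $1\neq K\le\mathrm{Stab}_G(1)$, $|G:K|<\infty$ and $K\times\overset{p}{\ldots}\times K\subseteq\psi_1(K)$. An infinite group is just infinite if all its proper quotients are finite. $G$ has the congruence subgroup property if every finite-index subgroup of $G$ contains $\mathrm{Stab}_G(n)$ for some $n$. The profinite topology on a group has the cosets of finite-index subgroups as a base. Two groups are (abstractly) commensurable if they have isomorphic finite-index subgroups. A group is torsion if each of its elements has finite order.
   Formalization: In (1), for a conjugate G of G_E, fractality and K×…×K ⊆ ψ_1(K) are read with the identifications of T_u with T transported by the conjugation, since read literally they fail for some conjugates; for G = G_E in standard form the claim is literal. *)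

(* Defs.v *)
From HB Require Import structures.
From mathcomp Require Import all_boot all_order all_algebra.
From mathcomp Require Import all_classical.

Set Implicit Arguments.
Unset Strict Implicit.
Unset Printing Implicit Defensive.

Local Open Scope classical_set_scope.
Local Open Scope group_scope.

Section AbstractGroups.
Context {gT : groupType}.
Implicit Types (A G H K N U D : set gT).

Definition is_subgroup H : Prop :=
  [/\ H 1, forall x y, H x -> H y -> H (x * y) & forall x, H x -> H x^-1].

Definition generated A : set gT := smallest is_subgroup A.

Definition commutator_subgroup A B : set gT :=
  generated [set [~ x, y] | x in A & y in B].

Definition gamma3 G : set gT := commutator_subgroup (commutator_subgroup G G) G.

Definition conj_by (y : gT) A : set gT := [set x ^ y | x in A].

Definition right_coset H (x : gT) : set gT := [set h * x | h in H].

Definition finite_index H G : Prop :=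
  [/\ is_subgroup H, H `<=` G & finite_set (right_coset H @` G)].

Definition is_normal N G : Prop :=
  [/\ is_subgroup N, N `<=` G & forall x g, N x -> G g -> N (x ^ g)].

Definition torsion G : Prop :=
  forall x, G x -> exists2 n : nat, (0 < n)%N & x ^+ n = 1.

Definition just_infinite G : Prop :=
  infinite_set G /\
  forall N, is_normal N G -> N <> [set 1] -> finite_index N G.

Definition profinite_base G : set (set gT) :=
  [set C | exists H x, [/\ finite_index H G, G x & C = right_coset H x]].

Definition profinite_open G U : Prop :=
  exists2 B : set (set gT), B `<=` profinite_base G & U = \bigcup_(C in B) C.

Definition profinite_dense G D : Prop :=
  forall U, U !=set0 -> profinite_open G U -> U `&` D !=set0.

Definition no_proper_dense_subgroup G : Prop :=
  forall D, is_subgroup D -> D `<=` G -> profinite_dense G D -> D = G.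

End AbstractGroups.

Definition isomorphic (gT hT : groupType) (A : set gT) (B : set hT) : Prop :=
  exists f : gT -> hT,
    set_bij A B f /\ forall x y, A x -> A y -> f (x * y) = f x * f y.

Definition commensurable (gT hT : groupType) (G : set gT) (H : set hT) : Prop :=
  exists A B, [/\ finite_index A G, finite_index B H & isomorphic A B].

(* The alphabet {1, ..., p} is rendered as 'I_p, so letters are shifted by    *)
(* one; a vertex is identified with the word that indexes it.                 *)
Notation vertex p := (seq 'I_p).

Definition edge p (u v : vertex p) : bool := [exists x, v == rcons u x].

(* The root is fixed because it is the only vertex that is not the target of  *)
(* an edge; see taut_nil.                                                     *)
Record tree_aut (p : nat) := TreeAut {
  taut :> vertex p -> vertex p;
  taut_bij : bijective taut;
  taut_edge : {mono taut : u v / edge u v} }.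

Section TreeAutomorphisms.
Variable p : nat.
Implicit Types (f g h : tree_aut p) (u v w : vertex p).

Lemma edgeP u v : reflect (exists x, v = rcons u x) (edge u v).
Proof. by apply: (iffP existsP) => -[x /eqP]; exists x => //; apply/eqP. Qed.

Lemma tree_autP f g : (forall u, f u = g u) -> f = g.
Proof.
case: f g => [f bf ef] [g bg eg] /= fg.
have E : f = g by apply/funext.
by case: _ / E bg eg => bg eg; congr TreeAut; exact: Prop_irrelevance.
Qed.

Lemma taut_nil f : f [::] = [::].
Proof.
case/lastP E: (f [::]) => [//|w x].
have [k _ kK] := taut_bij f.
have := taut_edge f (k w) [::]; rewrite kK E.
have -> : edge w (rcons w x) by apply/edgeP; exists x.
by move/esym/edgeP => [y /(congr1 size)]; rewrite size_rcons.
Qed.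

Lemma taut_rcons f u x : exists y, f (rcons u x) = rcons (f u) y.
Proof. by apply/edgeP; rewrite taut_edge; apply/edgeP; exists x. Qed.

Lemma size_taut f u : size (f u) = size u.
Proof.
elim/last_ind: u => [|u x IHu]; first by rewrite taut_nil.
by have [y ->] := taut_rcons f u x; rewrite !size_rcons IHu.
Qed.

Lemma take_taut f u v : take (size u) (f (u ++ v)) = f u.
Proof.
elim/last_ind: v => [|v x IHv]; first by rewrite cats0 -(size_taut f) take_size.
rewrite -rcons_cat; have [y ->] := taut_rcons f (u ++ v) x.
by rewrite -cats1 takel_cat // size_taut size_cat leq_addr.
Qed.

Definition section_fun f u v : vertex p := drop (size u) (f (u ++ v)).

Lemma section_funE f u v : f (u ++ v) = f u ++ section_fun f u v.
Proof. by rewrite -[LHS](cat_take_drop (size u)) take_taut. Qed.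

Lemma edge_cat u v w : edge (u ++ v) (u ++ w) = edge v w.
Proof.
apply/edgeP/edgeP => -[x E]; exists x; last by rewrite E rcons_cat.
by move: E; rewrite rcons_cat => /eqP; rewrite eqseq_cat // eqxx => /eqP.
Qed.

Lemma edge_cons x y u v : edge (x :: u) (y :: v) = (y == x) && edge u v.
Proof.
apply/edgeP/andP => [[z /= [-> ->]]|[/eqP -> /edgeP [z ->]]]; last by exists z.
by split=> //; apply/edgeP; exists z.
Qed.

Lemma edge_nil_cons x v : edge [::] (x :: v) = (v == [::]).
Proof. by apply/edgeP/eqP => [[z [_ ->]]|->] //; exists x. Qed.

Lemma one_bij : bijective (fun u => u : vertex p).
Proof. by exists id. Qed.
Definition one_aut := TreeAut one_bij (fun u v => erefl (edge u v)).

Lemma mul_edge f g : {mono g \o f : u v / edge u v}.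
Proof. by move=> u v /=; rewrite !taut_edge. Qed.
(* Automorphisms act on the right, as for permutations in fingroup.perm.      *)
Definition mul_aut f g :=
  TreeAut (bij_comp (taut_bij g) (taut_bij f)) (mul_edge f g).

Lemma inv_subproof f : {k : vertex p -> vertex p | cancel f k & cancel k f}.
Proof. by apply: cid2; have [k ? ?] := taut_bij f; exists k. Qed.
Definition inv_fun f : vertex p -> vertex p := s2val (inv_subproof f).
Lemma inv_funK f : cancel f (inv_fun f).
Proof. exact: (s2valP (inv_subproof f)). Qed.
Lemma inv_funVK f : cancel (inv_fun f) f.
Proof. exact: (s2valP' (inv_subproof f)). Qed.
Lemma inv_bij f : bijective (inv_fun f).
Proof. exact: Bijective (inv_funVK f) (inv_funK f). Qed.
Lemma inv_edge f : {mono inv_fun f : u v / edge u v}.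
Proof. by move=> u v; rewrite -(taut_edge f) !inv_funVK. Qed.
Definition inv_aut f := TreeAut (inv_bij f) (@inv_edge f).

HB.instance Definition _ := gen_eqMixin (tree_aut p).
HB.instance Definition _ := gen_choiceMixin (tree_aut p).

Lemma mul_autA : associative mul_aut.
Proof. by move=> f g h; apply: tree_autP. Qed.
Lemma mul_1aut : left_id one_aut mul_aut.
Proof. by move=> f; apply: tree_autP. Qed.
Lemma mul_aut1 : right_id one_aut mul_aut.
Proof. by move=> f; apply: tree_autP. Qed.
Lemma mul_Vaut : left_inverse one_aut inv_aut mul_aut.
Proof. by move=> f; apply: tree_autP => u /=; rewrite inv_funVK. Qed.
Lemma mul_autV : right_inverse one_aut inv_aut mul_aut.
Proof. by move=> f; apply: tree_autP => u /=; rewrite inv_funK. Qed.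
HB.instance Definition _ :=
  isGroup.Build (tree_aut p) mul_autA mul_1aut mul_aut1 mul_Vaut mul_autV.

Lemma autM f g u : (f * g) u = g (f u). Proof. by []. Qed.
Lemma aut1 u : (1 : tree_aut p) u = u. Proof. by []. Qed.

Lemma section_bij f u : bijective (section_fun f u).
Proof.
exists (section_fun (inv_aut f) (f u)) => v.
  rewrite /(section_fun (inv_aut f)) -section_funE size_taut /= inv_funK.
  by rewrite drop_size_cat.
have E : f u ++ v = f (u ++ section_fun (inv_aut f) (f u) v).
  by rewrite -{2}(inv_funK f u) -(section_funE (inv_aut f)) /= inv_funVK.
by rewrite {1}/section_fun -E drop_size_cat // size_taut.
Qed.
Lemma section_edge f u : {mono section_fun f u : v w / edge v w}.
Proof. by move=> v w; rewrite -(edge_cat (f u)) -!section_funE taut_edge edge_cat. Qed.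

(* For f in the stabiliser of u, this is the restriction of f to T_u, after   *)
(* deletion of the prefix u; see section_stab.                                *)
Definition section f u : tree_aut p := TreeAut (section_bij f u) (@section_edge f u).

Lemma section_stab f u v : f u = u -> f (u ++ v) = u ++ section f u v.
Proof. by move=> fu; rewrite section_funE fu. Qed.

(* Meaningful on the stabiliser of the first level only.                      *)
Definition psi1 f : {ffun 'I_p -> tree_aut p} := [ffun x => section f [:: x]].

End TreeAutomorphisms.

Section GroupsOnTrees.
Context {p : nat}.
Implicit Types (G K : set (tree_aut p)) (u v : vertex p) (f : tree_aut p).

Definition stab_vertex G u : set (tree_aut p) := [set g | G g /\ g u = u].

Definition stab_level G (n : nat) : set (tree_aut p) :=
  [set g | G g /\ forall u, size u = n -> g u = u].

Definition rstab_vertex G u : set (tree_aut p) :=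
  [set g | G g /\ forall v, ~~ prefix u v -> g v = v].

Definition rstab_level G (n : nat) : set (tree_aut p) :=
  [set \prod_(t : n.-tuple 'I_p) h t | h in
    [set h : n.-tuple 'I_p -> tree_aut p |
      forall t : n.-tuple 'I_p, rstab_vertex G t (h t)]].

Definition spherically_transitive G : Prop :=
  forall u v, size u = size v -> exists2 g, G g & g u = v.

Definition branch G : Prop :=
  spherically_transitive G /\ forall n, finite_index (rstab_level G n) G.

Definition fractal G : Prop :=
  forall u, [set section g u | g in stab_vertex G u] = G.

Definition contains_power K : Prop :=
  [set h : {ffun 'I_p -> tree_aut p} | forall x, K (h x)] `<=` [set psi1 k | k in K].

Definition regular_branch G K : Prop :=
  [/\ branch G /\ fractal G, K <> [set 1], K `<=` stab_level G 1,
      finite_index K G & contains_power K].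

(* Being fractal and containing K x ... x K both refer to the identification  *)
(* of T_u with T by deletion of a prefix, and (unlike all other conditions    *)
(* above) they are not preserved by conjugation in Aut(T).  When G is given   *)
(* as a conjugate by f of a group in standard form, the identifications are   *)
(* transported by f as well: the vertex labelled w becomes f w.  Evaluating   *)
(* the two conditions after conjugation by f^-1 is the same thing.            *)
Definition regular_branch_along f G K : Prop :=
  [/\ branch G /\ fractal (conj_by f^-1 G), K <> [set 1], K `<=` stab_level G 1,
      finite_index K G & contains_power (conj_by f^-1 K)].

Lemma regular_branch_along1 G K :
  regular_branch_along 1 G K = regular_branch G K.
Proof.
have conj1 (A : set (tree_aut p)) : conj_by 1^-1 A = A.
  rewrite /conj_by invg1; apply/seteqP; split => [_ [x Ax <-]|x Ax].
    by rewrite conjg1.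
  by exists x; rewrite ?conjg1.
by rewrite /regular_branch_along !conj1.
Qed.

Definition congruence_subgroup_property G : Prop :=
  forall H, finite_index H G -> exists n, stab_level G n `<=` H.

End GroupsOnTrees.

Section Generators.
Variable p : nat.
Implicit Types (j x : 'I_p) (e : 'rV['F_p]_p.-1) (v w : vertex p).

Definition rooted_fun w : vertex p := if w is x :: v then ordS x :: v else [::].

Lemma rooted_bij : bijective rooted_fun.
Proof.
exists (fun w => if w is x :: v then ord_pred x :: v else [::]).
  by case=> //= x v; rewrite ordSK.
by case=> //= x v; rewrite ord_predK.
Qed.

Lemma rooted_edge : {mono rooted_fun : u v / edge u v}.
Proof.
move=> [|y u] [|x v] //=; first by rewrite !edge_nil_cons.
by rewrite !edge_cons (inj_eq (@ordS_inj p)).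
Qed.

Definition rooted_aut : tree_aut p := TreeAut rooted_bij rooted_edge.

(* In 1-based notation the tuple                                              *)
(*   (a^e_j, ..., a^e_(p-1), b, a^e_1, ..., a^e_(j-1))                        *)
(* is (a^e_1, ..., a^e_(p-1), b) rotated left by j - 1 places.  With j and x  *)
(* counted from 0 as elements of 'I_p, its coordinate x is thus the entry of  *)
(* the latter at position (x + j) %% p, with b at the last position p - 1     *)
(* (where insub fails).                                                       *)
Definition defining_pos j x : option 'I_p.-1 := insub ((x + j) %% p).

Fixpoint directed_fun j e w : vertex p :=
  if w is x :: v then
    x :: (if defining_pos j x is Some i
          then (rooted_aut ^+ (e ord0 i : nat)) v
          else directed_fun j e v)
  else [::].

Lemma directed_edge j e : {mono directed_fun j e : u v / edge u v}.
Proof.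
have nilE i v : ((rooted_aut ^+ i) v == [::]) = (v == [::]).
  by rewrite -!size_eq0 size_taut.
elim=> [|y u IHu] [|x v] //=.
  by rewrite !edge_nil_cons; case: defining_pos => [i|]; [rewrite nilE | case: v].
rewrite !edge_cons; case: eqP => //= ->.
by case: defining_pos => [i|]; rewrite ?taut_edge ?IHu.
Qed.

Lemma directed_bij j e : bijective (directed_fun j e).
Proof.
pose fix k w := if w is x :: v then
    x :: (if defining_pos j x is Some i
          then (rooted_aut ^+ (e ord0 i : nat))^-1 v
          else k v) else [::].
exists k; elim=> //= x v IHv.
  by case: defining_pos => [i|]; rewrite ?IHv ?inv_funK.
by case: defining_pos => [i|]; rewrite ?IHv ?inv_funVK.
Qed.

Definition directed_aut j e : tree_aut p :=
  TreeAut (directed_bij j e) (@directed_edge j e).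

Lemma directed_stab j e : stab_level setT 1 (directed_aut j e).
Proof.
split=> // -[|x [|? ?]] //= _.
by case: defining_pos => [i|] //; rewrite taut_nil.
Qed.

Lemma psi1_directed j e :
  psi1 (directed_aut j e) =
  [ffun x => if defining_pos j x is Some i
             then rooted_aut ^+ (e ord0 i : nat) else directed_aut j e].
Proof.
apply/ffunP => x; rewrite !ffunE; apply: tree_autP => v /=.
by rewrite /section_fun /= drop0; case: defining_pos.
Qed.

Definition constant_vector e : Prop := forall i k, e ord0 i = e ord0 k.

(* rev_ord is i |-> p - i on the index set {1, ..., p-1} shifted by one.      *)
Definition non_symmetric_vector e : Prop :=
  exists i, e ord0 i <> e ord0 (rev_ord i).

End Generators.

Record spinal_datum (p : nat) := SpinalDatum {
  family_size : 'I_p -> nat;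
  defining_mx : forall j : 'I_p, 'M['F_p]_(family_size j, p.-1);
  family_size_lt : forall j, (family_size j < p)%N;
  family_size_neq0 : exists j, family_size j <> 0%N;
  defining_free : forall j, row_free (defining_mx j) }.

Definition defining_vector p (E : spinal_datum p) (j : 'I_p)
    (i : 'I_(family_size E j)) : 'rV['F_p]_p.-1 :=
  row i (defining_mx E j).

Definition spinal_group p (E : spinal_datum p) : set (tree_aut p) :=
  generated (rooted_aut p |`
    [set b | exists j (i : 'I_(family_size E j)),
       b = directed_aut j (defining_vector i)]).

(* Main.v *)
(* Index the first level by Z/p and write D j e z for the conjugate, by a power of
   a, of the directed automorphism of family j with vector e whose recursive
   section sits at z; its section at x <> z is a^(e_(x-z)).

   The lower central series has finite index because G is generated by elements
   of order p.  A commutator of two D's sits at two coordinates; non-constancy of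
   the vectors allows one of them to be cleared modulo gamma_3, so gamma_3 contains
   its own copies at single coordinates, and every nontrivial normal subgroup has
   finite index.  If s, the sum of the entries of e, were nonzero, then a^s b would
   have infinite order; so torsion forces s = 0, which excludes constant vectors.

   Density is inherited by the sections of a subgroup.  Choosing sections that
   shorten words shows that a dense subgroup of a torsion G has G among its
   iterated sections, along every path.  Going back up the tree, a dense subgroup M
   of a finite-index subgroup all of whose sections have finite index has finite
   index itself, since density rules out diagonal subgroups; hence M is everything.

   If non-symmetric vectors are available, G' also contains its own copies at
   single coordinates.  For b, b' from distinct families with the same vector,
   tau = b b'^-1 is not in G', but its copies at single coordinates are congruent
   to tau modulo G'.  Iterating, tau G' meets every level stabiliser, so G' is a
   finite-index subgroup that contains none of them. *)
Require Import Defs.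
From HB Require Import structures.
From mathcomp Require Import all_boot all_order all_algebra.
From mathcomp Require Import all_classical ring.

Set Implicit Arguments.
Unset Strict Implicit.
Unset Printing Implicit Defensive.

Import GRing.Theory.
Local Open Scope classical_set_scope.
Local Open Scope ring_scope.
Local Open Scope group_scope.

(** * Subgroups of abstract groups *)

(** A component of a commutator at the coordinate v + i is cleared by a further commutator with an
    element of Stab_G(1) trivial at v + i; the sections such elements may have at v form a normal
    subgroup. If these subgroups die in a quotient of G, then b^(e_(i+r)) = a^(e_i e_r) holds there,
    and unless a dies too, x -> e_x is multiplicative up to a factor, hence constant, because x^p =
    x in F_p. The same identity drives two more arguments: a relation that moves around the p-cycle
    and multiplies exponents by q returns with q^p = q, and non-symmetry or non-constancy gives q !=
    1.

    Hypotheses on generators are used for the whole span of each family, where vectors can be added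
    and rescaled.

    Density is treated for every finite-index subgroup of G, since an isomorphism between
    finite-index subgroups transports only that form. No depth is fixed at which all paths of
    sections reach G: this is the inductive predicate [bar], and the way back up the tree is
    induction on it.

    All of this is done in standard form; conjugation by f enters only at the end. *)

Section Subgroups.
Context {gT : groupType}.
Implicit Types (A B G H K M N P S : set gT) (x y z g h : gT).

Lemma sg1 H : is_subgroup H -> H 1. Proof. by case. Qed.
Lemma sgM H x y : is_subgroup H -> H x -> H y -> H (x * y).
Proof. by case=> _ + _; apply. Qed.
Lemma sgV H x : is_subgroup H -> H x -> H x^-1.
Proof. by case=> _ _; apply. Qed.
Lemma sgVE H x : is_subgroup H -> H x^-1 = H x.
Proof.
by move=> sH; apply/propext; split=> /(sgV sH) //; rewrite invgK.
Qed.
Lemma sgF H x y : is_subgroup H -> H x -> H y -> H (x / y).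
Proof. by move=> sH Hx Hy; apply: sgM => //; apply: sgV. Qed.
Lemma sgX H x n : is_subgroup H -> H x -> H (x ^+ n).
Proof.
by move=> sH Hx; elim: n => [|n IHn]; [exact: sg1 | rewrite expgS; apply: sgM].
Qed.
Lemma sgJ H x y : is_subgroup H -> H x -> H y -> H (x ^ y).
Proof. by move=> sH Hx Hy; do 2?apply: sgM => //; apply: sgV. Qed.
Lemma sgR H x y : is_subgroup H -> H x -> H y -> H [~ x, y].
Proof. by move=> sH Hx Hy; apply: sgM => //; [apply: sgV | apply: sgJ]. Qed.
Lemma sgMl H x y : is_subgroup H -> H x -> H (x * y) = H y.
Proof.
move=> sH Hx; apply/propext; split=> Hy; last exact: sgM.
by rewrite -(mulKg x y); apply: sgM => //; apply: sgV.
Qed.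
Lemma sgMr H x y : is_subgroup H -> H y -> H (x * y) = H x.
Proof.
move=> sH Hy; apply/propext; split=> Hx; last exact: sgM.
by rewrite -(mulgK y x); apply: sgF.
Qed.
Lemma sg_prod H (I : Type) (r : seq I) (F : I -> gT) :
  is_subgroup H -> (forall i, H (F i)) -> H (\prod_(i <- r) F i).
Proof.
move=> sH HF; elim: r => [|i r IHr]; first by rewrite big_nil; exact: sg1.
by rewrite big_cons; apply: sgM.
Qed.

Lemma is_subgroupI A B : is_subgroup A -> is_subgroup B -> is_subgroup (A `&` B).
Proof.
move=> sA sB; split=> [|x y [? ?] [? ?]|x [? ?]]; split;
  by [exact: sg1 | exact: sgM | exact: sgV].
Qed.

Lemma is_subgroup_setT : is_subgroup [set: gT]. Proof. by []. Qed.

Lemma is_subgroup_set1 : is_subgroup [set (1 : gT)].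
Proof. by split=> [|x y -> ->|x ->] //=; rewrite ?mulg1 ?invg1. Qed.

Lemma gen_subgroup A : is_subgroup (generated A).
Proof.
split=> [H [sH _]|x y Ax Ay H [sH AH]|x Ax H [sH AH]]; first exact: sg1.
- by apply: sgM (Ax _ _) (Ay _ _).
- by apply: sgV (Ax _ _).
Qed.
Lemma sub_gen A : A `<=` generated A.
Proof. exact: sub_smallest. Qed.
Lemma gen_sub A H : is_subgroup H -> A `<=` H -> generated A `<=` H.
Proof. exact: smallest_sub. Qed.

Lemma comm_subgroup A B : is_subgroup (commutator_subgroup A B).
Proof. exact: gen_subgroup. Qed.
Lemma mem_comm A B x y : A x -> B y -> commutator_subgroup A B [~ x, y].
Proof. by move=> Ax By; apply: sub_gen; exists x => //; exists y. Qed.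
Lemma comm_sub A B H : is_subgroup H -> (forall x y, A x -> B y -> H [~ x, y]) ->
  commutator_subgroup A B `<=` H.
Proof. by move=> sH AB; apply: gen_sub => // _ [x Ax [y By <-]]; apply: AB. Qed.

Definition normalised N G := forall x g, N x -> G g -> N (x ^ g).

Lemma normal_sg N G : is_normal N G -> is_subgroup N. Proof. by case. Qed.
Lemma normal_sub N G : is_normal N G -> N `<=` G. Proof. by case. Qed.
Lemma normal_J N G : is_normal N G -> normalised N G. Proof. by case. Qed.
Lemma normal_R N G x g : is_normal N G -> N x -> G g -> N [~ x, g].
Proof.
by move=> [sN _ nN] Nx Gg; apply: sgM; [|apply: sgV|apply: nN].
Qed.

Lemma normal_refl G : is_subgroup G -> is_normal G G.
Proof. by move=> sG; split=> // x g; apply: sgJ. Qed.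

Lemma comm_sub_normal M N G :
  is_subgroup G -> is_normal M G -> is_normal N G ->
  is_normal (commutator_subgroup M N) G.
Proof.
move=> sG nM nN; split; first exact: comm_subgroup.
  by apply: comm_sub => // x y /(normal_sub nM) Gx /(normal_sub nN) Gy; apply: sgR.
move=> x g Cx Gg; suff: [set z | commutator_subgroup M N (z ^ g)] x by [].
apply: comm_sub Cx => [|{}x y Mx Ny]; last first.
  by rewrite /= conjRg; apply: mem_comm; [apply: normal_J nM _ _ _ _ | apply: normal_J nN _ _ _ _].
have sC := comm_subgroup M N.
split=> [|y z|y] /=; rewrite ?conj1g ?conjMg ?conjVg; first exact: sg1.
  exact: sgM.
exact: sgV.
Qed.

(** For normal M, the preimage in G of the centre of G/M. *)
Definition central_mod M G : set gT :=
  [set x | G x /\ forall g, G g -> M [~ x, g]].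

Lemma central_mod_normal M G : is_subgroup G -> is_normal M G ->
  is_normal (central_mod M G) G.
Proof.
move=> sG nM; have [sM MG jM] := nM; split; first split.
- by split=> [|g _]; rewrite ?comm1g; exact: sg1.
- move=> x y [Gx cx] [Gy cy]; split=> [|g Gg]; first exact: sgM.
  have ->: [~ x * y, g] = [~ x, g] ^ y * [~ y, g] by rewrite /commg /conjg !gnorm.
  by apply: sgM => //; [apply: jM; [apply: cx|] | apply: cy].
- move=> x [Gx cx]; split=> [|g Gg]; first exact: sgV.
  have ->: [~ x^-1, g] = ([~ x, g] ^ x^-1)^-1 by rewrite /commg /conjg !gnorm.
  by apply: sgV => //; apply: jM; [apply: cx | apply: sgV].
- by move=> x [].
- move=> x g [Gx cx] Gg; split=> [|h Gh]; first exact: sgJ.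
  have ->: [~ x ^ g, h] = [~ x, h ^ g^-1] ^ g by rewrite conjRg conjgKV.
  by apply: jM => //; apply: cx; apply: sgJ => //; apply: sgV.
Qed.

(** For fixed x the elements that commute with x modulo M form a subgroup, so generators suffice. *)
Lemma mem_central_mod M S x : is_normal M (generated S) -> generated S x ->
  (forall s, S s -> M [~ x, s]) -> central_mod M (generated S) x.
Proof.
move=> nM Gx cx; have [sM MG jM] := nM; have sG := gen_subgroup S.
split=> // g Gg; suff: [set z | generated S z /\ M [~ x, z]] g by case.
apply: gen_sub Gg => [|s Ss]; last by split; [apply: sub_gen | apply: cx].
split=> [|y z [Gy cy] [Gz cz]|y [Gy cy]] /=.
- by split; rewrite ?commg1; apply: sg1.
- split; first exact: (sgM sG).
  have ->: [~ x, y * z] = [~ x, z] * [~ x, y] ^ z by rewrite /commg /conjg !gnorm.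
  by apply: (sgM sM) => //; apply: jM.
- split; first exact: (sgV sG).
  have ->: [~ x, y^-1] = ([~ x, y] ^ y^-1)^-1 by rewrite /commg /conjg !gnorm.
  by apply: (sgV sM) => //; apply: jM => //; exact: (sgV sG).
Qed.

Lemma derived_sub_gen M S : is_normal M (generated S) ->
  (forall s t, S s -> S t -> M [~ s, t]) ->
  commutator_subgroup (generated S) (generated S) `<=` M.
Proof.
move=> nM ST; have sG := gen_subgroup S.
suff sub : generated S `<=` central_mod M (generated S).
  apply: comm_sub; first exact: normal_sg nM.
  by move=> x y /sub [_ cx]; apply: cx.
apply: gen_sub; first exact: normal_sg (central_mod_normal _ _).
move=> s Ss; apply: mem_central_mod => //; first exact: sub_gen.
by move=> t; apply: ST.
Qed.

Lemma conj_by_subgroup y H : is_subgroup H -> is_subgroup (conj_by y H).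
Proof.
move=> sH; split=> [|_ _ [u Hu <-] [v Hv <-]|_ [u Hu <-]].
- by exists 1; rewrite ?conj1g //; exact: sg1.
- by exists (u * v); rewrite ?conjMg //; exact: sgM.
- by exists u^-1; rewrite ?conjVg //; exact: sgV.
Qed.

Lemma conj_byE y H x : conj_by y H x = H (x ^ y^-1).
Proof.
apply/propext; split=> [[u Hu <-]|Hx]; first by rewrite conjgK.
by exists (x ^ y^-1); rewrite ?conjgKV.
Qed.

Lemma conj_by1 H : conj_by 1 H = H.
Proof. by apply/seteqP; split=> x; rewrite conj_byE invg1 conjg1. Qed.
Lemma conj_byM y z H : conj_by (y * z) H = conj_by z (conj_by y H).
Proof. by apply/seteqP; split=> x; rewrite !conj_byE invgM conjgM. Qed.
Lemma conj_byK y H : conj_by y^-1 (conj_by y H) = H.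
Proof. by rewrite -conj_byM mulgV conj_by1. Qed.
Lemma conj_byKV y H : conj_by y (conj_by y^-1 H) = H.
Proof. by rewrite -conj_byM mulVg conj_by1. Qed.
Lemma conj_byS y A B : A `<=` B -> conj_by y A `<=` conj_by y B.
Proof. by move=> AB x; rewrite !conj_byE; apply: AB. Qed.

Lemma conj_by_gen_sub y A : conj_by y (generated A) `<=` generated (conj_by y A).
Proof.
move=> _ [x Ax <-]; suff: [set z | generated (conj_by y A) (z ^ y)] x by [].
apply: gen_sub Ax => [|{}x Ax]; last by apply: sub_gen; exists x.
have sC := gen_subgroup (conj_by y A).
split=> [|u v|u] /=; rewrite ?conj1g ?conjMg ?conjVg; first exact: sg1.
  exact: sgM.
exact: sgV.
Qed.
Lemma conj_by_gen y A : conj_by y (generated A) = generated (conj_by y A).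
Proof.
apply/seteqP; split; first exact: conj_by_gen_sub.
rewrite -[X in X `<=` _](conj_byKV y); apply: conj_byS.
by rewrite -{2}(conj_byK y A); apply: conj_by_gen_sub.
Qed.

Lemma conj_by_comm y A B : conj_by y (commutator_subgroup A B) =
  commutator_subgroup (conj_by y A) (conj_by y B).
Proof.
rewrite /commutator_subgroup conj_by_gen; congr generated; apply/seteqP; split.
  move=> _ [_ [u Au [v Bv <-]] <-]; rewrite conjRg.
  by exists (u ^ y); [exists u | exists (v ^ y) => //; exists v].
move=> _ [_ [u Au <-] [_ [v Bv <-] <-]]; rewrite -conjRg.
by exists [~ u, v] => //; exists u => //; exists v.
Qed.
Lemma conj_by_gamma3 y A : conj_by y (gamma3 A) = gamma3 (conj_by y A).
Proof. by rewrite /gamma3 !conj_by_comm. Qed.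

Lemma gamma3_normal G : is_subgroup G -> is_normal (gamma3 G) G.
Proof.
move=> sG; have nG := normal_refl sG.
by apply: comm_sub_normal => //; apply: comm_sub_normal.
Qed.

End Subgroups.

(** * Finite-index subgroups, partial homomorphisms and density *)

Section FiniteIndex.
Context {gT : groupType}.
Implicit Types (A B G H K M N P S : set gT) (x y z g h : gT) (s : seq gT).

Lemma right_coset_eq H x y : is_subgroup H -> H (x / y) ->
  right_coset H x = right_coset H y.
Proof.
move=> sH Hxy; apply/seteqP; split=> [_ [h Hh <-]|_ [h Hh <-]].
  by exists (h * (x / y)); [exact: (sgM sH) | rewrite !gnorm].
by exists (h * (x / y)^-1); [exact: (sgF sH) | rewrite !gnorm].
Qed.

Lemma fi_cover H G : finite_index H G -> is_subgroup G ->
  exists2 s : seq gT, (forall x, x \in s -> G x) &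
             forall g, G g -> exists2 x, x \in s & H (g / x).
Proof.
move=> [sH HG /finite_seqP [cs csE]] sG.
pose rep C := xget 1 [set x | G x /\ right_coset H x = C].
have repP C : C \in cs -> G (rep C) /\ right_coset H (rep C) = C.
  move=> Cs; have: [set` cs] C by [].
  rewrite -csE => -[x Gx Cx]; rewrite /rep.
  by case: xgetP => [y _ //|/(_ x)]; case.
exists (map rep cs) => [x /mapP [C Cs ->]|g Gg]; first by case: (repP C).
have Cs : right_coset H g \in cs.
  by have: [set` cs] (right_coset H g) by rewrite -csE; exists g.
exists (rep (right_coset H g)); first exact: map_f.
have [_] := repP _ Cs; move: (rep _) => y eqC.
have: right_coset H g g by exists 1; rewrite ?mul1g //; exact: (sg1 sH).
by rewrite -eqC => -[h Hh <-]; rewrite mulgK.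
Qed.

Lemma cover_fi H G s : is_subgroup H -> H `<=` G ->
  (forall g, G g -> exists2 x, x \in s & H (g / x)) -> finite_index H G.
Proof.
move=> sH HG cov; split=> //.
apply: (@sub_finite_set _ _ [set` map (right_coset H) s]); last exact: finite_seq.
move=> _ [g /cov [x xs Hgx] <-]; apply/mapP; exists x => //.
exact: right_coset_eq.
Qed.

Lemma fi_sg H G : finite_index H G -> is_subgroup H. Proof. by case. Qed.
Lemma fi_sub H G : finite_index H G -> H `<=` G. Proof. by case. Qed.

Lemma fi_refl G : is_subgroup G -> finite_index G G.
Proof.
move=> sG; apply: (@cover_fi _ _ [:: 1]) => // g Gg.
by exists 1; rewrite ?mem_head // invg1 mulg1.
Qed.

Lemma fi_trans A B G : is_subgroup G ->
  finite_index A B -> finite_index B G -> finite_index A G.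
Proof.
move=> sG fA fB; have sB := fi_sg fB.
have [s sBs covA] := fi_cover fA sB; have [t _ covB] := fi_cover fB sG.
apply: (@cover_fi _ _ [seq x * y | x <- s, y <- t]).
- exact: fi_sg fA.
- exact: subset_trans (fi_sub fA) (fi_sub fB).
move=> g /covB [y yt /covA [x xs Ax]].
by exists (x * y); [exact: allpairs_f | rewrite invgM mulgA].
Qed.

Lemma fi_up A B G : is_subgroup G -> is_subgroup B ->
  finite_index A G -> A `<=` B -> B `<=` G -> finite_index B G.
Proof.
move=> sG sB fA AB BG; have [s _ cov] := fi_cover fA sG.
by apply: (@cover_fi _ _ s) => // g /cov [x xs /AB]; exists x.
Qed.

Lemma fi_conj y A G : finite_index A G -> is_subgroup G ->
  finite_index (conj_by y A) (conj_by y G).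
Proof.
move=> fA sG; have [s _ cov] := fi_cover fA sG.
apply: (@cover_fi _ _ [seq x ^ y | x <- s]).
- exact/conj_by_subgroup/(fi_sg fA).
- exact/conj_byS/(fi_sub fA).
move=> _ [g /cov [x xs Ax] <-]; exists (x ^ y); first exact: map_f.
by exists (g / x) => //; rewrite conjMg conjVg.
Qed.

Lemma fi_of_fin (T : finType) (phi : gT -> T) A G :
  is_subgroup A -> A `<=` G ->
  (forall g h, G g -> G h -> phi g = phi h -> A (g / h)) -> finite_index A G.
Proof.
move=> sA AG phiP; pose rep t := xget 1 [set g | G g /\ phi g = t].
apply: (@cover_fi _ _ [seq rep t | t <- enum T]) => // g Gg.
exists (rep (phi g)); first by apply: map_f; rewrite mem_enum.
by rewrite /rep; case: xgetP => [h _ [Gh /esym]|/(_ g)]; [exact: phiP | case].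
Qed.

End FiniteIndex.

Definition morph_on (gT hT : groupType) (D : set gT) (phi : gT -> hT) :=
  forall x y, D x -> D y -> phi (x * y) = phi x * phi y.

Section PartialMorphisms.
Context {gT hT : groupType} (D : set gT) (phi : gT -> hT).
Hypotheses (sD : is_subgroup D) (phiM : morph_on D phi).
Implicit Types (A B G : set gT) (P Q : set hT).

Lemma morph1 : phi 1 = 1.
Proof. by apply: (mulgI (phi 1)); rewrite -phiM ?mulg1 //; exact: (sg1 sD). Qed.

Lemma morphV x : D x -> phi x^-1 = (phi x)^-1.
Proof.
move=> Dx; apply: (mulgI (phi x)).
by rewrite mulgV -phiM ?mulgV ?morph1 //; exact: (sgV sD).
Qed.

Lemma morphF x y : D x -> D y -> phi (x / y) = phi x / phi y.
Proof. by move=> Dx Dy; rewrite phiM ?morphV //; exact: (sgV sD). Qed.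

Lemma preim_subgroup P : is_subgroup P -> is_subgroup [set x | D x /\ P (phi x)].
Proof.
move=> sP; split=> [|x y [Dx Px] [Dy Py]|x [Dx Px]] /=.
- by rewrite morph1; split; [exact: (sg1 sD) | exact: (sg1 sP)].
- by rewrite phiM //; split; [exact: (sgM sD) | exact: (sgM sP)].
- by rewrite morphV //; split; [exact: (sgV sD) | exact: (sgV sP)].
Qed.

Lemma image_subgroup A : is_subgroup A -> A `<=` D -> is_subgroup (phi @` A).
Proof.
move=> sA AD; split=> [|_ _ [x Ax <-] [y Ay <-]|_ [x Ax <-]].
- by exists 1; rewrite ?morph1 //; exact: (sg1 sA).
- by exists (x * y); rewrite ?phiM //; [exact: (sgM sA) | exact: AD | exact: AD].
- by exists x^-1; rewrite ?morphV //; [exact: (sgV sA) | exact: AD].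
Qed.

Lemma fi_preim P Q : finite_index P Q -> is_subgroup Q -> phi @` D `<=` Q ->
  finite_index [set x | D x /\ P (phi x)] D.
Proof.
move=> fP sQ DQ; have [s _ cov] := fi_cover fP sQ; have sP := fi_sg fP.
pose rep t := xget 1 [set x | D x /\ P (phi x / t)].
apply: (@cover_fi _ _ _ [seq rep t | t <- s]).
- exact: preim_subgroup.
- by move=> x [].
move=> g Dg; have [t ts Pt] : exists2 t, t \in s & P (phi g / t).
  by apply/cov/DQ; exists g.
exists (rep t); first exact: map_f.
rewrite /rep; case: xgetP => [x _ [Dx Px]|/(_ g)]; last by case.
split; first exact: (sgF sD).
rewrite morphF //; have ->: phi g / phi x = (phi g / t) / (phi x / t).
  by rewrite !gnorm.
exact: (sgF sP).
Qed.

Lemma fi_image A : finite_index A D -> finite_index (phi @` A) (phi @` D).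
Proof.
move=> fA; have [s sD' cov] := fi_cover fA sD; have AD := fi_sub fA.
apply: (@cover_fi _ _ _ (map phi s)).
- by apply: image_subgroup => //; exact: fi_sg fA.
- exact: image_subset.
move=> _ [g Dg <-]; have [x xs Ax] := cov g Dg.
by exists (phi x); [exact: map_f | exists (g / x); rewrite ?morphF //; apply: sD'].
Qed.

End PartialMorphisms.

Section FiniteIndexTheory.
Context {gT : groupType}.
Implicit Types (A B G H K M N P S : set gT) (x y z g h : gT) (s : seq gT).

Lemma fi_setI A H G : is_subgroup G -> finite_index A G -> is_subgroup H ->
  H `<=` G -> finite_index (A `&` H) H.
Proof.
move=> sG fA sH HG; rewrite setIC.
have idM : morph_on H id by [].
by apply: (fi_preim sH idM fA) => // _ [x Hx <-]; apply: HG.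
Qed.

Lemma fi_inter A B G : is_subgroup G -> finite_index A G -> finite_index B G ->
  finite_index (A `&` B) G.
Proof.
move=> sG fA fB; apply: (fi_trans sG _ fB); apply: (fi_setI sG) => //.
  exact: fi_sg fB.
exact: fi_sub fB.
Qed.

Lemma fi_bigcap (I : eqType) (r : seq I) (A : I -> set gT) G : is_subgroup G ->
  (forall i, i \in r -> finite_index (A i) G) ->
  finite_index [set g | G g /\ forall i, i \in r -> A i g] G.
Proof.
move=> sG; elim: r => [|i r IHr] fA.
  rewrite (_ : [set _ | _] = G); first exact: fi_refl.
  by apply/seteqP; split=> [x []|].
rewrite (_ : [set _ | _] = A i `&` [set g | G g /\ forall i, i \in r -> A i g]).
  apply: fi_inter => //; first by apply: fA; rewrite mem_head.
  by apply: IHr => k kr; apply: fA; rewrite inE kr orbT.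
apply/seteqP; split=> x /=.
  move=> [Gx Ax]; split; first by apply: Ax; rewrite mem_head.
  by split=> // k kr; apply: Ax; rewrite inE kr orbT.
move=> [Aix [Gx Ax]]; split=> // k; rewrite inE => /predU1P [->//|].
exact: Ax.
Qed.

Lemma fi_bigcapT (I : finType) (A : I -> set gT) G : is_subgroup G ->
  (forall i, finite_index (A i) G) ->
  finite_index [set g | G g /\ forall i, A i g] G.
Proof.
move=> sG fA; have := @fi_bigcap _ (enum I) A G sG (fun i _ => fA i).
congr (finite_index _ G); apply/seteqP; split=> x [Gx Ax]; split=> // i //.
by apply: Ax; rewrite mem_enum.
Qed.

Definition core H G : set gT := [set x | G x /\ forall g, G g -> H (x ^ g)].

Lemma core_normal H G : is_subgroup G -> is_subgroup H -> is_normal (core H G) G.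
Proof.
move=> sG sH; split; first split.
- by split=> [|g _]; rewrite ?conj1g; [exact: (sg1 sG) | exact: (sg1 sH)].
- move=> x y [Gx Hx] [Gy Hy]; split=> [|g Gg]; first exact: (sgM sG).
  by rewrite conjMg; apply: (sgM sH); [exact: Hx | exact: Hy].
- move=> x [Gx Hx]; split=> [|g Gg]; first exact: (sgV sG).
  by rewrite conjVg; apply: (sgV sH); exact: Hx.
- by move=> x [].
- move=> x g [Gx Hx] Gg; split=> [|h Gh]; first exact: (sgJ sG).
  by rewrite -conjgM; apply: Hx; exact: (sgM sG).
Qed.

Lemma core_sub H G : is_subgroup G -> core H G `<=` H.
Proof. by move=> sG x [_ /(_ _ (sg1 sG))]; rewrite conjg1. Qed.

(** A conjugate of H depends only on a coset of H, so the intersection over G reduces to finitely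
    many representatives. *)
Lemma core_fi H G : is_subgroup G -> finite_index H G -> finite_index (core H G) G.
Proof.
move=> sG fH; have sH := fi_sg fH; have [s sGs cov] := fi_cover fH sG.
apply: (@fi_up _ [set x | G x /\ forall t, t \in s -> G x /\ H (x ^ t^-1)]) => //.
- exact: normal_sg (core_normal sG sH).
- apply: (@fi_bigcap _ s (fun t => [set x | G x /\ H (x ^ t^-1)])) => // t /sGs Gt; apply: (fi_preim sG _ fH) => //.
    by move=> x y _ _; rewrite conjMg.
  by move=> _ [x Gx <-]; apply: (sgJ sG) => //; exact: (sgV sG).
- move=> x [Gx Hx]; split=> // g Gg.
  have [t ts Ht] := cov _ (sgV sG Gg).
  have [_ Hxt] := Hx _ ts.
  have ->: x ^ g = (x ^ t^-1) ^ (g^-1 / t)^-1 by rewrite -conjgM !gnorm.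
  by apply: (sgJ sH) => //; exact: (sgV sH).
- by move=> x [].
Qed.

(** Natural exponents are enough to describe the group generated by N and x: modulo N, [x ^- k] is
    [x ^+ (n * k - k)]. *)
Lemma cyclic_fi N x n : is_subgroup N -> (forall y, N y -> N (y ^ x)) ->
  (forall y, N y -> N (y ^ x^-1)) ->
  (0 < n)%N -> N (x ^+ n) ->
  let A := [set y * x ^+ k | y in N & k in [set: nat]] in
  is_subgroup A /\ finite_index N A.
Proof.
move=> sN nx nxV n0 Nxn A.
have nX k y : N y -> N (y ^ x ^- k).
  elim: k y => [|k IHk] y Ny; first by rewrite expg0 invg1 conjg1.
  by rewrite expgS invgM conjgM; apply/nxV/IHk.
have mulA y z : A y -> A z -> A (y * z).
  move=> [u Nu [k _ <-]] [v Nv [l _ <-]].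
  exists (u * v ^ x ^- k); first by apply: (sgM sN) => //; apply: nX.
  exists (k + l)%N => //; rewrite expgnDr /conjg.
  by rewrite !gnorm.
have A1 : A 1 by exists 1; [exact: (sg1 sN) | exists 0%N; rewrite ?mulg1].
have NA : N `<=` A by move=> y Ny; exists y => //; exists 0%N; rewrite ?mulg1.
have Ax : A x by exists 1; [exact: (sg1 sN) | exists 1%N; rewrite ?expg1 ?mul1g].
have AX k : A (x ^+ k).
  by elim: k => [|k IHk]; rewrite ?expg0 // expgS; apply: mulA.
have AXV k : A (x ^- k).
  have NX m : N ((x ^+ n) ^+ m) by exact: (sgX _ sN).
  have ->: x ^- k = ((x ^+ n) ^+ k)^-1 * x ^+ (n * k - k).
    rewrite expgnFr; last by rewrite leq_pmull.
    by rewrite -expgnA mulgA mulVg mul1g.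
  by apply: mulA => //; apply/NA/(sgV sN).
have sA : is_subgroup A.
  split=> // _ [u Nu [k _ <-]]; rewrite invgM; apply: mulA => //.
  exact/NA/(sgV sN).
split=> //; apply: (@cover_fi _ _ _ [seq x ^+ i | i <- iota 0 n]) => //.
move=> _ [u Nu [k _ <-]]; exists (x ^+ (k %% n)).
  by apply: map_f; rewrite mem_iota ltn_pmod.
rewrite {1}(divn_eq k n) expgnDr !gnorm; apply: (sgM sN) => //.
by rewrite mulnC expgnA; apply: (sgX _ sN).
Qed.

(** The elements of r are adjoined to N one at a time with [cyclic_fi]. Every intermediate group
    contains N, hence is normalised by A because A/N is abelian. *)
Lemma abelian_fi N A (r : seq gT) : is_subgroup A -> is_normal N A ->
  (forall x y, A x -> A y -> N [~ x, y]) ->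
  (forall x, x \in r -> A x /\ exists2 n, (0 < n)%N & N (x ^+ n)) ->
  A `<=` generated ([set` r] `|` N) -> finite_index N A.
Proof.
move=> sA nN abN rP Agen; have [sN NA jN] := nN.
have [B [sB fB rB]] : exists B, [/\ is_subgroup B, finite_index N B /\ B `<=` A &
    [set` r] `<=` B].
  elim: r {Agen} rP => [|x r IHr] rP.
    by exists N; split=> //; split=> //; apply: fi_refl.
  have [|B [sB [fB BA] rB]] := IHr.
    by move=> y yr; apply: rP; rewrite inE yr orbT.
  have [|Ax [n n0 Nxn]] := rP x; first exact: mem_head.
  have NB := fi_sub fB.
  have BJ z y : A z -> B y -> B (y ^ z).
    move=> Az By; have ->: y ^ z = y * [~ y, z] by rewrite /commg mulVKg.
    by apply: (sgM sB) => //; apply/NB/abN => //; apply: BA.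
  have [sC fC] := cyclic_fi sB (fun y => BJ x y Ax)
    (fun y => BJ x^-1 y (sgV sA Ax)) n0 (NB _ Nxn).
  set C := [set _ | _ in _ & _ in _] in sC fC.
  exists C; split=> //.
    split; first exact: fi_trans fB fC.
    by move=> _ [u Bu [k _ <-]]; apply: (sgM sA); [exact: BA | exact: (sgX _ sA)].
  move=> y /=; rewrite inE => /predU1P [->|/rB /(fi_sub fC) //].
  by exists 1; [exact: (sg1 sB) | exists 1%N; rewrite ?expg1 ?mul1g].
have [fNB BA] := fB; suff -> : A = B by [].
apply/seteqP; split=> // x /Agen; apply: gen_sub => // y [/rB|/(fi_sub fNB)] //.
Qed.

(** Profinite density, tested on the basic open cosets. *)
Definition dense_in M H := forall L h, finite_index L H -> H h -> exists2 m, M m & L (m / h).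

Lemma dense_in_conj y M H : is_subgroup H -> dense_in M H ->
  dense_in (conj_by y M) (conj_by y H).
Proof.
move=> sH dM L _ fL [h Hh <-].
have fL' : finite_index (conj_by y^-1 L) H.
  by rewrite -(conj_byK y H); apply: fi_conj => //; exact: conj_by_subgroup.
have [m Mm] := dM _ _ fL' Hh; rewrite conj_byE invgK conjMg conjVg => Lm.
by exists (m ^ y) => //; exists m.
Qed.

(** M itself is an admissible L, so every coset of M meets M. *)
Lemma dense_in_fi_eq M H : dense_in M H -> M `<=` H -> finite_index M H -> M = H.
Proof.
move=> dM MH fM; have sM := fi_sg fM; apply/seteqP; split=> // h Hh.
have [m Mm] := dM _ _ fM Hh.
by rewrite (sgMl _ sM Mm) (sgVE _ sM).
Qed.

Lemma fi_sub_in A B G : is_subgroup G -> finite_index A G -> is_subgroup B ->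
  A `<=` B -> B `<=` G -> finite_index A B.
Proof.
move=> sG fA sB AB BG; have := fi_setI sG fA sB BG.
by congr (finite_index _ B); apply/seteqP; split=> x; [case | move=> Ax; split=> //; exact: AB].
Qed.

Lemma profinite_dense_in M H : is_subgroup H -> profinite_dense H M -> dense_in M H.
Proof.
move=> sH dM L h fL Hh; have sL := fi_sg fL.
have [||_ [[l Ll <-] Mm]] := dM (right_coset L h).
- by exists h; exists 1; [exact: (sg1 sL) | rewrite mul1g].
- exists [set right_coset L h] => [_ ->|]; first by exists L, h.
  by rewrite bigcup_set1.
by exists (l * h); rewrite ?mulgK.
Qed.

End FiniteIndexTheory.

Section Commensurable.
Context {gT hT : groupType}.

(** The preimage in A of a dense D is dense in A, hence all of A. So D contains B, has finite index
    in H, and is everything because it is dense. *)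
Lemma no_proper_dense_of_isomorphic (A : set gT) (B H : set hT) : is_subgroup A ->
  is_subgroup H -> finite_index B H -> isomorphic A B ->
  (forall M, is_subgroup M -> M `<=` A -> dense_in M A -> M = A) ->
  no_proper_dense_subgroup H.
Proof.
move=> sA sH fB [phi [[phiAB phi_inj phi_surj] phiM]] denseA D sD DH.
move=> /(profinite_dense_in sH) dD; have sB := fi_sg fB; have BH := fi_sub fB.
have imA : phi @` A = B.
  by apply/seteqP; split=> [_ [a Aa <-]|b /phi_surj //]; exact: phiAB.
pose M := [set a | A a /\ D (phi a)].
have sM : is_subgroup M by exact: preim_subgroup.
have MA : M = A.
  apply: denseA => // [a []//|L a fL Aa].
  have fphiL : finite_index (phi @` L) B by rewrite -imA; exact: fi_image.
  have [d Dd [l Ll lE]] := dD _ _ (fi_trans sH fphiL fB) (BH _ (phiAB _ Aa)).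
  have Al := fi_sub fL Ll.
  exists (l * a); last by rewrite mulgK.
  split; first exact: (sgM sA).
  by rewrite phiM // lE mulgVK.
have BD : B `<=` D.
  by rewrite -imA => _ [a Aa <-]; have [] : M a by rewrite MA.
apply: (dense_in_fi_eq dD DH).
exact: fi_up sH sD fB BD DH.
Qed.

End Commensurable.

(** * Finite index of the lower central terms *)

Section CommutatorSubgroup.
Context {gT : groupType} (G : set gT) (sG : is_subgroup G).
Implicit Types (A N : set gT) (x y z g : gT).

Lemma comm_normal A : is_normal A G -> is_normal (commutator_subgroup A G) G.
Proof. by move=> nA; apply: comm_sub_normal => //; apply: normal_refl. Qed.

Lemma comm_subl A : is_normal A G -> commutator_subgroup A G `<=` A.
Proof.
by move=> nA; apply: comm_sub => [|x g Ax Gg]; [case: nA | exact: (normal_R nA)].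
Qed.

Lemma comm_expg A x g n : is_normal A G -> A x -> G g ->
  commutator_subgroup (commutator_subgroup A G) G ([~ x, g ^+ n]^-1 * [~ x, g] ^+ n).
Proof.
move=> nA Ax Gg; set A2 := commutator_subgroup _ _.
have sA2 : is_subgroup A2 by exact: comm_subgroup.
elim: n => [|n IHn].
  by rewrite !expg0 commg1 invg1 mulg1; exact: (sg1 sA2).
have A1n : commutator_subgroup A G [~ x, g ^+ n].
  by apply: mem_comm => //; exact: (sgX _ sG).
have A2n : A2 [~ [~ x, g ^+ n], g] by exact: mem_comm.
set u := [~ x, g] in IHn *; set v := [~ x, g ^+ n] in IHn A1n A2n.
have -> : [~ x, g ^+ n.+1] = u * v ^ g.
  by rewrite expgSr /u /v /commg /conjg !gnorm.
have -> : (u * v ^ g)^-1 * u ^+ n.+1 = [~ v, g]^-1 * (v^-1 * u ^+ n).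
  by rewrite expgS /commg /conjg !gnorm.
by apply: (sgM sA2) => //; exact: (sgV sA2).
Qed.

End CommutatorSubgroup.

Section LowerCentral.
Context {gT : groupType}.
Variables (p : nat) (S : seq gT).
Hypotheses (p_gt0 : (0 < p)%N) (Sp : forall s, s \in S -> s ^+ p = 1).
Let G := generated [set` S].
Implicit Types (A N : set gT) (x y z g : gT).

Let sG : is_subgroup G. Proof. exact: gen_subgroup. Qed.

Definition generated_mod_comm A (T : seq gT) : Prop :=
  (forall t, t \in T -> A t) /\ A `<=` generated ([set` T] `|` commutator_subgroup A G).

(** The new generators are the commutators [[~ t, s]]. Modulo the next term their p-th powers are
    [[~ t, s ^+ p]], which is trivial: the exponent p of the generators of G passes down the
    series. *)
Lemma generated_mod_comm_next A T : is_normal A G -> generated_mod_comm A T ->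
  exists2 T', generated_mod_comm (commutator_subgroup A G) T' &
    forall t, t \in T' ->
      commutator_subgroup (commutator_subgroup A G) G (t ^+ p).
Proof.
move=> nA [TA AT]; have nA1 := comm_normal sG nA; have nA2 := comm_normal sG nA1.
set A1 := commutator_subgroup A G in AT nA1 nA2 *.
set A2 := commutator_subgroup A1 G in nA2 *.
pose T' := [seq [~ t, s] | t <- T, s <- S].
have T'P t' : t' \in T' -> A1 t' /\ A2 (t' ^+ p).
  move=> /allpairsP [[t s] /= [Tt Ss ->]]; have Gs : G s by exact: sub_gen.
  split; first by apply: mem_comm => //; exact: TA.
  by have := comm_expg sG p nA (TA _ Tt) Gs; rewrite Sp // commg1 invg1 mul1g.
exists T'; last by move=> t /T'P [].
split; first by move=> t /T'P [].
(* To see that these commutators suffice, let B be generated by them and the next term: B is normal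
   and A is central modulo B. *)
set B := generated _; have sB : is_subgroup B by exact: gen_subgroup.
have A2B : A2 `<=` B by move=> x Ax; apply: sub_gen; right.
have BA1 : B `<=` A1.
  apply: gen_sub => [|x [/T'P []//|]]; first exact: normal_sg nA1.
  by move=> Ax; exact: (comm_subl nA1 Ax).
have nB : is_normal B G.
  split=> // [x /BA1/(normal_sub nA1) //|x g Bx Gg].
  have -> : x ^ g = x * [~ x, g] by rewrite /commg mulVKg.
  by apply: (sgM sB) => //; apply: A2B; apply: mem_comm => //; exact: (BA1 _ Bx).
have AC : A `<=` central_mod B G.
  move=> x /AT; apply: gen_sub; first exact: (normal_sg (central_mod_normal sG nB)).
  move=> {}x [Tx|A1x].
    apply: (mem_central_mod nB); first exact: (normal_sub nA (TA _ Tx)).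
    by move=> s Ss; apply: sub_gen; left; apply: allpairs_f.
  by split=> [|g Gg]; [exact: (normal_sub nA1) | apply: A2B; exact: mem_comm].
by apply: comm_sub => // x g /AC [_ +] Gg; apply.
Qed.

Lemma comm_fi A T : is_normal A G -> generated_mod_comm A T ->
  (forall t, t \in T -> commutator_subgroup A G (t ^+ p)) ->
  finite_index (commutator_subgroup A G) A.
Proof.
move=> nA [TA AT] Tp; have sA := normal_sg nA; have AG := normal_sub nA.
apply: (abelian_fi sA _ _ _ AT) => [|x y Ax /AG|t Tt].
- have [sA1 _ jA1] := comm_normal sG nA.
  by split=> //; [exact: comm_subl | move=> x g A1x /AG; exact: jA1].
- exact: mem_comm.
- by split; [exact: TA | exists p => //; exact: Tp].
Qed.

Let G1 := commutator_subgroup G G.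

(** The fourth term is recorded for the base case of [comm_K_fi]. *)
Lemma lower_central_fi : [/\ finite_index G1 G, finite_index (gamma3 G) G &
  finite_index (commutator_subgroup (gamma3 G) G) G].
Proof.
have nG := normal_refl sG; have nG1 := comm_normal sG nG.
have nG2 : is_normal (gamma3 G) G by exact: (comm_normal sG nG1).
have gen0 : generated_mod_comm G S.
  split; first exact: sub_gen.
  apply: gen_sub => [|x Sx]; first exact: gen_subgroup.
  by apply: sub_gen; left.
have [T1 gen1 T1p] := generated_mod_comm_next nG gen0.
have [T2 gen2 T2p] := generated_mod_comm_next nG1 gen1.
have f1 : finite_index G1 G.
  apply: comm_fi gen0 _ => // s Ss; rewrite Sp //.
  exact: (sg1 (normal_sg nG1)).
have f2 : finite_index (gamma3 G) G by apply: (fi_trans sG (comm_fi nG1 gen1 T1p)).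
split=> //; exact: (fi_trans sG (comm_fi nG2 gen2 T2p)).
Qed.

End LowerCentral.

(** * Sections and rigid copies *)

Section Sections.
Variables (p : nat) (p_prime : prime p).
Implicit Types (f g h : tree_aut p) (x y z k : 'F_p) (u v w : vertex p).

(** The bound of the ordinal type ['F_p] equals p only propositionally, hence the casts; arithmetic
    on the first level takes place in ['F_p]. *)
Definition vtx x : 'I_p := cast_ord (Fp_cast p_prime) x.
Definition crd (i : 'I_p) : 'F_p := cast_ord (esym (Fp_cast p_prime)) i.
Lemma vtxK : cancel vtx crd. Proof. by move=> x; apply: val_inj. Qed.
Lemma crdK : cancel crd vtx. Proof. by move=> x; apply: val_inj. Qed.

Lemma Fp_natE (n : nat) : (n%:R%R : 'F_p) = (n %% p)%N :> nat.
Proof. by rewrite val_Fp_nat. Qed.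

Lemma ordS_vtx x : ordS (vtx x) = vtx (x + 1)%R.
Proof.
have -> : (x + 1 = (x : nat).+1%:R)%R by rewrite -natr1 natr_Zp.
by apply: val_inj; rewrite /= Fp_natE.
Qed.

Lemma vertex_ind (P : vertex p -> Prop) :
  P [::] -> (forall x w, P w -> P (vtx x :: w)) -> forall w, P w.
Proof. by move=> P0 PS; elim=> // i w Pw; rewrite -(crdK i); apply: PS. Qed.

Definition sec g x : tree_aut p := section g [:: vtx x].
(** Every element of a spinal group acts on the first level by such a translation; see [G_shift]. *)
Definition shift k g : Prop := forall x, g [:: vtx x] = [:: vtx (x + k)%R].
Definition Stab1 : set (tree_aut p) := [set g | shift 0%R g].

Lemma aut_cons g x w : g (vtx x :: w) = g [:: vtx x] ++ sec g x w.
Proof. by rewrite -cat1s section_funE. Qed.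

Lemma shift_cons k g x w : shift k g -> g (vtx x :: w) = vtx (x + k)%R :: sec g x w.
Proof. by move=> gk; rewrite aut_cons gk. Qed.

Lemma sec_eq k g h x : shift k g ->
  (forall w, g (vtx x :: w) = vtx (x + k)%R :: h w) -> sec g x = h.
Proof.
by move=> gk gh; apply: tree_autP => w; have := gh w; rewrite (shift_cons _ _ gk) => -[].
Qed.

Lemma shift_ext k g h : shift k g -> shift k h -> (forall x, sec g x = sec h x) -> g = h.
Proof.
move=> gk hk gh; apply: tree_autP; apply: vertex_ind => [|x w _].
  by rewrite !taut_nil.
by rewrite (shift_cons _ _ gk) (shift_cons _ _ hk) gh.
Qed.

(** A bisimulation principle for recursively defined automorphisms: each vertex is at finite depth,
    so agreement on the first level together with closure under sections is enough. *)
Lemma tree_coind (R : tree_aut p -> tree_aut p -> Prop) :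
  (forall g h, R g h -> exists k, [/\ shift k g, shift k h &
     forall x, sec g x = sec h x \/ R (sec g x) (sec h x)]) ->
  forall g h, R g h -> g = h.
Proof.
move=> RP g h Rgh; apply: tree_autP => w.
elim/vertex_ind: w g h Rgh => [|x w IHw] g h /RP; first by rewrite !taut_nil.
move=> [k [gk hk /(_ x) gh]].
rewrite (shift_cons _ _ gk) (shift_cons _ _ hk).
by case: gh => [->|/IHw ->].
Qed.

Lemma shift1 : shift 0%R 1. Proof. by move=> x; rewrite addr0. Qed.
Lemma shiftM k l g h : shift k g -> shift l h -> shift (k + l)%R (g * h).
Proof. by move=> gk hl x; rewrite autM gk hl addrA. Qed.
Lemma shiftV k g : shift k g -> shift (- k)%R g^-1.
Proof.
move=> gk x; rewrite -{1}[x](subrK k) -gk -[g^-1 _](autM g g^-1) mulgV.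
exact: aut1.
Qed.

Lemma section_mul g h u : section (g * h) u = section g u * section h (g u).
Proof.
apply: tree_autP => w /=; rewrite {1}/section_fun autM section_funE section_funE.
by rewrite drop_size_cat ?size_taut.
Qed.

Lemma section_one u : section 1 u = 1.
Proof. by apply: tree_autP => w /=; rewrite /section_fun aut1 drop_size_cat. Qed.

Lemma section_cat g u v : section g (u ++ v) = section (section g u) v.
Proof.
apply: tree_autP => w /=; rewrite /section_fun /= /section_fun.
by rewrite size_cat catA drop_drop addnC.
Qed.

Lemma section_inv g u : section g^-1 (g u) = (section g u)^-1.
Proof.
apply: (mulgI (section g u)); rewrite mulgV -section_mul mulgV.
exact: section_one.
Qed.

Lemma sec1 x : sec 1 x = 1.
Proof. exact: section_one. Qed.
Lemma secM k g h x : shift k g -> sec (g * h) x = sec g x * sec h (x + k)%R.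
Proof. by move=> gk; rewrite /sec section_mul gk. Qed.
Lemma secV k g x : shift k g -> sec g^-1 (x + k)%R = (sec g x)^-1.
Proof. by move=> gk; rewrite /sec -gk section_inv. Qed.

Lemma Stab1_subgroup : is_subgroup Stab1.
Proof.
split=> [|g h g0 h0|g g0]; first exact: shift1.
  by rewrite /Stab1 /= -[0%R]addr0; apply: shiftM.
by rewrite /Stab1 /= -[0%R]oppr0; apply: shiftV.
Qed.

Lemma secM0 x : morph_on Stab1 (sec^~ x).
Proof. by move=> g h g0 h0; rewrite /= (secM _ _ g0) addr0. Qed.
Lemma secV0 g x : Stab1 g -> sec g^-1 x = (sec g x)^-1.
Proof. exact: (morphV Stab1_subgroup (@secM0 x)). Qed.
Lemma secF0 g h x : Stab1 g -> Stab1 h -> sec (g / h) x = sec g x / sec h x.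
Proof. exact: (morphF Stab1_subgroup (@secM0 x)). Qed.
Lemma secR0 g h x : Stab1 g -> Stab1 h -> sec [~ g, h] x = [~ sec g x, sec h x].
Proof.
have sS := Stab1_subgroup; move=> g0 h0; rewrite /commg /conjg.
have gV := sgV sS g0; have hV := sgV sS h0; have gh := sgM sS g0 h0.
by rewrite !(secM0 x) ?secV0 //; do 2?[exact: (sgM sS)].
Qed.
Lemma secX0 g n x : Stab1 g -> sec (g ^+ n) x = sec g x ^+ n.
Proof.
move=> g0; elim: n => [|n IHn]; first by rewrite !expg0 sec1.
by rewrite !expgS (secM _ _ g0) addr0 IHn.
Qed.
Lemma secJ0 g h x : Stab1 g -> Stab1 h -> sec (g ^ h) x = sec g x ^ sec h x.
Proof.
have sS := Stab1_subgroup; move=> g0 h0; rewrite /conjg.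
by rewrite !(secM0 x) ?secV0 //; [exact: (sgV sS) | exact: (sgM sS)].
Qed.

Lemma shiftJ k g h : Stab1 g -> shift k h -> Stab1 (g ^ h).
Proof.
move=> g0 hk x; have := shiftM (shiftV hk) (shiftM g0 hk).
by rewrite add0r addNr; apply.
Qed.
Lemma secJ k g h x : Stab1 g -> shift k h ->
  sec (g ^ h) (x + k)%R = sec g x ^ sec h x.
Proof.
move=> g0 hk; rewrite /conjg (secM _ _ (shiftV hk)) addrK (secV _ hk).
by rewrite (secM _ _ g0) addr0.
Qed.

(* spread is the inverse of psi_1. *)
Definition spread_fun (h : 'F_p -> tree_aut p) w : vertex p :=
  if w is i :: v then i :: h (crd i) v else [::].

Lemma spread_bij (h : 'F_p -> tree_aut p) : bijective (spread_fun h).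
Proof.
exists (spread_fun (fun x => (h x)^-1)); case=> //= i v.
  by rewrite Defs.inv_funK.
by rewrite Defs.inv_funVK.
Qed.
Lemma spread_edge (h : 'F_p -> tree_aut p) : {mono spread_fun h : u v / edge u v}.
Proof.
move=> [|i u] [|k v] //=; first by rewrite !edge_nil_cons -!size_eq0 size_taut.
by rewrite !edge_cons; case: eqP => //= ->; rewrite taut_edge.
Qed.
Definition spread (h : 'F_p -> tree_aut p) : tree_aut p := TreeAut (spread_bij h) (@spread_edge h).

Lemma spread_stab (h : 'F_p -> tree_aut p) : Stab1 (spread h).
Proof. by move=> x /=; rewrite taut_nil addr0. Qed.
Lemma sec_spread (h : 'F_p -> tree_aut p) x : sec (spread h) x = h x.
Proof.
by apply: (sec_eq (spread_stab h)) => w /=; rewrite vtxK addr0.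
Qed.

Definition rig x g : tree_aut p := spread (fun y => if y == x then g else 1).
Lemma rig_stab x g : Stab1 (rig x g). Proof. exact: spread_stab. Qed.
Lemma sec_rig x g y : sec (rig x g) y = if y == x then g else 1.
Proof. exact: sec_spread. Qed.
Lemma sec_rigE x g : sec (rig x g) x = g.
Proof. by rewrite sec_rig eqxx. Qed.

Lemma rig_eq x g h : Stab1 h -> sec h x = g -> (forall y, y != x -> sec h y = 1) ->
  rig x g = h.
Proof.
move=> h0 hx hy; apply: (shift_ext (@rig_stab x g) h0) => y.
by rewrite sec_rig; case: eqP => [->|/eqP/hy].
Qed.

Lemma rigM x : morph_on setT (rig x).
Proof.
move=> g h _ _; have sS := Stab1_subgroup; apply: rig_eq => [||y].
- by apply: (sgM sS); exact: rig_stab.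
- by rewrite secM0 ?sec_rigE //; exact: rig_stab.
- by move=> /negPf yx; rewrite secM0 ?sec_rig ?yx ?mulg1 //; exact: rig_stab.
Qed.
Lemma rig1 x : rig x 1 = 1.
Proof. exact: (morph1 is_subgroup_setT (@rigM x)). Qed.
Lemma rigMM x g h : rig x (g * h) = rig x g * rig x h.
Proof. exact: rigM. Qed.
Lemma rigV x g : rig x g^-1 = (rig x g)^-1.
Proof. exact: (morphV is_subgroup_setT (@rigM x)). Qed.

(** A commutator with an element supported below x sees only the section of g at x. This is how
    rigid copies of commutators are found inside normalised subgroups. *)
Lemma comm_rig x g h : Stab1 g -> [~ g, rig x h] = rig x [~ sec g x, h].
Proof.
move=> g0; symmetry; apply: rig_eq => [||y].
- by apply: (sgR Stab1_subgroup) => //; exact: rig_stab.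
- by rewrite secR0 ?sec_rigE //; exact: rig_stab.
- move=> /negPf yx; rewrite secR0 ?sec_rig ?yx ?commg1 //; exact: rig_stab.
Qed.

Lemma rigJ x g h : Stab1 h -> rig x g ^ h = rig x (g ^ sec h x).
Proof.
move=> h0; symmetry; apply: rig_eq => [||y].
- by apply: (sgJ Stab1_subgroup) => //; exact: rig_stab.
- by rewrite secJ0 ?sec_rigE //; exact: rig_stab.
- by move=> /negPf yx; rewrite secJ0 ?sec_rig ?yx ?conj1g //; exact: rig_stab.
Qed.

Lemma rigJ_shift k x g h : shift k h -> rig x g ^ h = rig (x + k)%R (g ^ sec h x).
Proof.
move=> hk; symmetry; apply: rig_eq => [||y].
- by apply: shiftJ hk; exact: rig_stab.
- by rewrite (secJ _ (@rig_stab x g) hk) sec_rigE.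
- move=> yx; rewrite -[y](subrK k) (secJ _ (@rig_stab x g) hk) sec_rig.
  by rewrite subr_eq (negPf yx) conj1g.
Qed.

Lemma Stab1_rig_prod (H : set (tree_aut p)) g : is_subgroup H -> Stab1 g ->
  (forall x, H (rig x (sec g x))) -> H g.
Proof.
move=> sH g0 Hg; have sS := Stab1_subgroup.
suff -> : g = \prod_(x <- enum 'F_p) rig x (sec g x) by apply: sg_prod.
have prS (r : seq 'F_p) : Stab1 (\prod_(x <- r) rig x (sec g x)).
  by apply: sg_prod => // x; exact: rig_stab.
apply: (shift_ext g0 (prS _)) => y.
have : y \in enum 'F_p by rewrite mem_enum.
elim: (enum _) (enum_uniq 'F_p) => //= x r IHr /andP [xr ur].
rewrite big_cons inE secM0 ?sec_rig //; last exact: rig_stab.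
case: eqP => [-> _|_ /= /(IHr ur) <-]; last by rewrite mul1g.
suff -> : sec (\prod_(x <- r) rig x (sec g x)) x = 1 by rewrite mulg1.
elim: r xr {IHr ur} => [|z r IHr]; first by rewrite big_nil sec1.
rewrite inE negb_or => /andP [/negPf xz xr].
by rewrite big_cons secM0 ?sec_rig ?xz ?mul1g ?IHr //; exact: rig_stab.
Qed.

Lemma stab_level1 (H : set (tree_aut p)) g : stab_level H 1 g <-> H g /\ Stab1 g.
Proof.
split=> [[Hg g1]|[Hg g0]]; split=> //; first by move=> x; rewrite addr0 g1.
move=> [|i [|? ?]] //= _; by rewrite -(crdK i) g0 addr0.
Qed.

End Sections.

(** * Spinal groups *)

Section Directed.
Variables (p : nat) (p_prime : prime p).
Implicit Types (f g h : tree_aut p) (x y z k l : 'F_p) (j : 'I_p)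
  (e : 'rV['F_p]_p.-1).
Notation vtx := (vtx p_prime).
Notation sec := (sec p_prime).
Notation shift := (shift p_prime).
Notation Stab1 := (Stab1 p_prime).

Let sS : is_subgroup Stab1 := Stab1_subgroup p_prime.

Definition apow k : tree_aut p := rooted_aut p ^+ (k : nat).

Lemma rooted_shift n : shift (n%:R)%R (rooted_aut p ^+ n).
Proof.
elim: n => [|n IHn]; first by rewrite expg0; exact: shift1.
rewrite expgS -natr1 addrC; apply: shiftM IHn => x /=.
by rewrite ordS_vtx.
Qed.

Lemma sec_rooted n x : sec (rooted_aut p ^+ n) x = 1.
Proof.
elim: n x => [|n IHn] x; first by rewrite expg0 sec1.
have a1 : shift 1%R (rooted_aut p) by exact: (rooted_shift 1).
rewrite expgS (secM _ _ a1) IHn mulg1.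
by apply: (sec_eq a1) => w /=; rewrite ordS_vtx.
Qed.

Lemma rooted_expE m n : (m%:R = n%:R :> 'F_p)%R ->
  rooted_aut p ^+ m = rooted_aut p ^+ n.
Proof.
move=> mn; apply: (shift_ext (rooted_shift m)); first by rewrite mn; exact: rooted_shift.
by move=> x; rewrite !sec_rooted.
Qed.

Lemma rooted_exp_p : rooted_aut p ^+ p = 1.
Proof. by rewrite -[RHS](expg0 (rooted_aut p)); apply: rooted_expE; rewrite pchar_Fp_0. Qed.

Lemma apow_nat n : apow (n%:R)%R = rooted_aut p ^+ n.
Proof. by apply: rooted_expE; rewrite natr_Zp. Qed.
Lemma apow1 : apow 1%R = rooted_aut p. Proof. exact: (apow_nat 1). Qed.
Lemma apow0 : apow 0%R = 1. Proof. exact: (apow_nat 0). Qed.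
Lemma apowD k l : apow (k + l)%R = apow k * apow l.
Proof. by rewrite /apow -expgnDr; apply: rooted_expE; rewrite natrD !natr_Zp. Qed.
Lemma apowN k : apow (- k)%R = (apow k)^-1.
Proof. by apply: (mulgI (apow k)); rewrite -apowD subrr mulgV apow0. Qed.
Lemma apow_shift k : shift k (apow k).
Proof. by have := rooted_shift k; rewrite natr_Zp. Qed.
Lemma sec_apow k x : sec (apow k) x = 1. Proof. exact: sec_rooted. Qed.
Lemma apow_inj : injective apow.
Proof.
move=> k l /(congr1 (fun g : tree_aut p =>
  crd p_prime (head (vtx 0%R) (g [:: vtx 0%R])))).
by rewrite !apow_shift /= !vtxK !add0r.
Qed.

(** The entry e_x for x in Z/p, with the convention e_0 = 0; position i of the row stands for the
    residue i + 1. The sum has at most one term and avoids a case distinction on x. *)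
Definition ev e x : 'F_p := (\sum_(i < p.-1 | i.+1 == x :> nat) e ord0 i)%R.

Lemma ev_is_additive e e' x : ev (e + e')%R x = (ev e x + ev e' x)%R.
Proof. by rewrite /ev -big_split; apply: eq_bigr => i _; rewrite mxE. Qed.
Lemma evZ l e x : ev (l *: e)%R x = (l * ev e x)%R.
Proof. by rewrite /ev big_distrr; apply: eq_bigr => i _; rewrite mxE. Qed.
Lemma ev0 x : ev 0%R x = 0%R.
Proof. by rewrite -(scale0r (0%R : 'rV_p.-1)) evZ mul0r. Qed.
Lemma ev_at0 e : ev e 0%R = 0%R.
Proof. by rewrite /ev big_pred0. Qed.
Lemma ev_pos e (i : 'I_p.-1) x : i.+1 = x :> nat -> ev e x = e ord0 i.
Proof.
move=> ix; rewrite /ev (big_pred1 i) // => k /=.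
by rewrite -ix eqSS val_eqE.
Qed.
Lemma pos_ev (i : 'I_p.-1) : exists2 x : 'F_p, i.+1 = x :> nat & x != 0%R.
Proof.
have ip : (i.+1 < p)%N by have := ltn_ord i; rewrite -ltnS prednK ?prime_gt0.
have E : i.+1 = ((i.+1)%:R%R : 'F_p) :> nat by rewrite Fp_natE // modn_small.
by exists (i.+1%:R)%R => //; rewrite -val_eqE /= -E.
Qed.
Lemma ev_eq0 e : (forall x, ev e x = 0%R) -> e = 0%R.
Proof.
move=> e0; apply/rowP => i; rewrite mxE; have [x ix _] := pos_ev i.
by rewrite -(ev_pos e ix).
Qed.

(** The solution of x + j = p - 1 modulo p: the coordinate where [defining_pos] is [None] and the
    recursion sits. *)
Definition centre j : 'F_p := (- 1 - (j : nat)%:R)%R.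

Lemma centre_inj : injective centre.
Proof.
move=> i j /addrI/oppr_inj/(congr1 (@nat_of_ord _)).
by rewrite !Fp_natE // !modn_small //; apply: val_inj.
Qed.

Definition dir j e := directed_aut j e.

Lemma dir_stab j e : Stab1 (dir j e).
Proof. by case/(stab_level1 p_prime): (directed_stab j e). Qed.

Lemma sec_dir j e x :
  sec (dir j e) x = if x == centre j then dir j e else apow (ev e (x - centre j)%R).
Proof.
have /ffunP /(_ (vtx x)) := psi1_directed j e; rewrite !ffunE => secE.
rewrite -[LHS]/(section (directed_aut j e) [:: vtx x]) secE.
(* Position (x + j) %% p of the row stands for the residue one larger, which is the offset of x from
   the centre. *)
have Ex : (x - centre j = (x + j).+1%:R)%R.
  by rewrite -natr1 natrD natr_Zp /centre opprD !opprK addrA addrAC.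
have {}Ex : (((x + j) %% p).+1 %% p)%N = (x - centre j)%R :> nat.
  by rewrite Ex Fp_natE // -addn1 modnDml addn1.
have p0 := prime_gt0 p_prime.
have np : ((x + j) %% p < p)%N by rewrite ltn_pmod.
rewrite -subr_eq0 /defining_pos /=; case: insubP => [i _ iE|].
  have ip : (i.+1 < p)%N by have := ltn_ord i; rewrite -ltnS prednK.
  rewrite -iE modn_small // in Ex; rewrite (ev_pos e Ex).
  by case: eqP => // E; rewrite E in Ex.
rewrite -ltnS prednK // -leqNgt => pn.
have {pn} pn : ((x + j) %% p).+1%N = p by apply/eqP; rewrite eqn_leq np.
rewrite pn modnn in Ex; case: eqP => // -[]; exact: val_inj.
Qed.

Lemma sec_dir_centre j e : sec (dir j e) (centre j) = dir j e.
Proof. by rewrite sec_dir eqxx. Qed.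

Lemma dirD j e e' : dir j (e + e')%R = dir j e * dir j e'.
Proof.
(* The section at the centre is again a pair related by [R]; at the other coordinates both sides are
   the same power of a. *)
pose R f g := exists e e', f = dir j (e + e')%R /\ g = dir j e * dir j e'.
apply: (@tree_coind _ p_prime R); last by exists e, e'.
move=> _ _ [{}e [{}e' [-> ->]]]; exists 0%R; split.
- exact: dir_stab.
- by apply: (sgM sS); exact: dir_stab.
move=> x; rewrite (secM0 x (@dir_stab j e) (@dir_stab j e')) !sec_dir.
case: eqP => _; first by right; exists e, e'.
by left; rewrite ev_is_additive apowD.
Qed.

Lemma dir0 j : dir j 0%R = 1.
Proof. by apply: (mulgI (dir j 0%R)); rewrite -dirD addr0 mulg1. Qed.

(* The conjugate of a directed automorphism by the power of a that moves the
   coordinate carrying the recursion to z. *)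
Definition D j e z : tree_aut p := dir j e ^ apow (z - centre j)%R.

Lemma D_stab j e z : Stab1 (D j e z).
Proof. exact: shiftJ (@dir_stab j e) (apow_shift _). Qed.

Lemma sec_D j e z x :
  sec (D j e z) x = if x == z then dir j e else apow (ev e (x - z)%R).
Proof.
have E : (x - (z - centre j) - centre j = x - z)%R.
  by rewrite opprB addrA addrAC addrK.
rewrite -{1}[x](subrK (z - centre j)%R) (secJ _ (@dir_stab j e) (apow_shift _)).
by rewrite sec_apow conjg1 sec_dir -subr_eq0 E subr_eq0.
Qed.
Lemma sec_Dz j e z : sec (D j e z) z = dir j e.
Proof. by rewrite sec_D eqxx. Qed.

Lemma D_centre j e : D j e (centre j) = dir j e.
Proof. by rewrite /D subrr apow0 conjg1. Qed.
Lemma DD j e e' z : D j (e + e')%R z = D j e z * D j e' z.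
Proof. by rewrite /D dirD conjMg. Qed.
Lemma D0 j z : D j 0%R z = 1.
Proof. by rewrite /D dir0 conj1g. Qed.
Lemma DN j e z : D j (- e)%R z = (D j e z)^-1.
Proof. by apply: (mulgI (D j e z)); rewrite -DD subrr D0 mulgV. Qed.
Lemma D_apow j e z k : D j e z ^ apow k = D j e (z + k)%R.
Proof. by rewrite /D -conjgM -apowD addrAC. Qed.
Lemma D_apowC j e z k : D j e z * apow k = apow k * D j e (z + k)%R.
Proof. by rewrite -D_apow conjgC. Qed.

Lemma dir_inj j e : dir j e = 1 -> e = 0%R.
Proof.
move=> e1; apply: ev_eq0 => x; have [->|x0] := eqVneq x 0%R; first exact: ev_at0.
have := sec_dir j e (x + centre j)%R; rewrite addrK e1 sec1 -subr_eq0 addrK.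
by rewrite (negPf x0) -apow0 => /apow_inj.
Qed.

Lemma D_exp j e z n : D j e z ^+ n = D j (e *+ n)%R z.
Proof.
by elim: n => [|n IHn]; rewrite ?expg0 ?mulr0n ?D0 // expgS mulrS DD IHn.
Qed.
Lemma D_exp_p j e z : D j e z ^+ p = 1.
Proof. by rewrite D_exp -scaler_nat pchar_Fp_0 // scale0r D0. Qed.

End Directed.

Section SpinalGroup.
Variables (p : nat) (p_prime : prime p) (E : spinal_datum p).
Implicit Types (f g h : tree_aut p) (x y z k l : 'F_p) (j : 'I_p)
  (e : 'rV['F_p]_p.-1) (H : set (tree_aut p)).
Notation vtx := (vtx p_prime).
Notation sec := (sec p_prime).
Notation shift := (shift p_prime).
Notation Stab1 := (Stab1 p_prime).

Let sS : is_subgroup Stab1 := Stab1_subgroup p_prime.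

(** By [dirD] every vector in the span of a family gives a directed automorphism in the group, so
    vectors can be added and normalised freely. *)
Definition family_span j e : bool := (e <= defining_mx E j)%MS.
Notation V := family_span.

Lemma V0 j : V j 0%R. Proof. exact: sub0mx. Qed.
Lemma VD j e e' : V j e -> V j e' -> V j (e + e')%R. Proof. exact: addmx_sub. Qed.
Lemma VZ j l e : V j e -> V j (l *: e)%R. Proof. exact: scalemx_sub. Qed.
Lemma VN j e : V j e -> V j (- e)%R. Proof. by move=> Ve; rewrite -scaleN1r VZ. Qed.
Lemma V_row j i : V j (@defining_vector p E j i). Proof. exact: row_sub. Qed.
Lemma row_neq0 j (i : 'I_(family_size E j)) : defining_vector i <> 0%R.
Proof.
move=> e0; have := defining_free E j; rewrite -kermx_eq0 => /eqP ker0.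
have: (delta_mx (ord0 : 'I_1) i <= kermx (defining_mx E j))%MS.
  by apply/sub_kermxP; rewrite -rowE.
rewrite ker0 submx0 => /eqP/matrixP/(_ ord0 i)/eqP.
by rewrite !mxE !eqxx oner_eq0.
Qed.

Notation G := (spinal_group E).

Lemma G_subgroup : is_subgroup G. Proof. exact: gen_subgroup. Qed.
Hint Resolve G_subgroup : core.

Lemma G_apow k : G (apow k).
Proof. by apply: (sgX _ G_subgroup); apply: sub_gen; left. Qed.

Lemma G_dir j e : V j e -> G (dir j e).
Proof.
have GM e1 e2 : G (dir j e1) -> G (dir j e2) -> G (dir j (e1 + e2)%R).
  by move=> G1 G2; rewrite dirD //; apply: (sgM G_subgroup).
case/submxP => u ->; rewrite mulmx_sum_row.
elim/big_ind: _ => [|//|i _]; first by rewrite dir0 //; exact: (sg1 G_subgroup).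
have Gi : G (dir j (row i (defining_mx E j))).
  by apply: sub_gen; right; exists j, i.
rewrite -[u _ _]natr_Zp scaler_nat; elim: (u _ _ : nat) => [|n IHn].
  by rewrite mulr0n dir0 //; exact: (sg1 G_subgroup).
by rewrite mulrS; apply: GM.
Qed.

Lemma G_D j e z : V j e -> G (D j e z).
Proof.
move=> Ve; apply: (sgJ G_subgroup); [exact: G_dir | exact: G_apow].
Qed.

Lemma G_ind H : is_subgroup H -> H (apow 1%R) -> (forall j e, V j e -> H (dir j e)) ->
  G `<=` H.
Proof.
move=> sH Ha Hb; apply: gen_sub => // g [->|[j [i ->]]]; first by rewrite -(apow1 p_prime).
by apply: Hb; exact: V_row.
Qed.

Lemma V_nontrivial : exists j e, V j e /\ e <> 0%R.
Proof.
have [j] := family_size_neq0 E; move/eqP; rewrite -lt0n => r0.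
by exists j, (defining_vector (Ordinal r0)); split; [exact: V_row | exact: row_neq0].
Qed.

Lemma family_nonempty j e : V j e -> e <> 0%R -> family_size E j <> 0%N.
Proof.
move=> Ve e0 r0; apply: e0; apply/eqP; rewrite -submx0; apply: submx_trans Ve _.
by apply/row_subP => i; have := ltn_ord i; rewrite [X in (_ < X)%N]r0.
Qed.

Lemma V_ev_neq0 e : e <> 0%R -> exists2 x, x != 0%R & ev e x != 0%R.
Proof.
move=> e0; have [//|nx] := pselect (exists2 x, x != 0%R & ev e x != 0%R).
case: e0; apply: (ev_eq0 p_prime) => x; apply/eqP.
have [->|x0] := eqVneq x 0%R; first by rewrite ev_at0.
by have [//|ex] := boolP (ev e x == 0%R); case: nx; exists x.
Qed.

Lemma G_shift g : G g -> exists k, shift k g.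
Proof.
apply: (@G_ind [set g | exists k, shift k g]).
- split=> [|g1 g2 [k k1] [l l2]|g1 [k k1]].
  + by exists 0%R; exact: shift1.
  + by exists (k + l)%R; exact: shiftM.
  + by exists (- k)%R; exact: shiftV.
- by exists 1%R; exact: apow_shift.
- by move=> j e _; exists 0%R; exact: dir_stab.
Qed.

Lemma G_sec g x : G g -> G (sec g x).
Proof.
move=> Gg; suff: [set g | G g /\ forall x, G (sec g x)] g by case=> _; apply.
apply: G_ind Gg.
- split=> [|g1 g2 [G1 S1] [G2 S2]|g1 [G1 S1]].
  + by split=> [|y]; rewrite ?sec1; exact: (sg1 G_subgroup).
  + have [k k1] := G_shift G1; split=> [|y]; first exact: (sgM G_subgroup).
    by rewrite (secM _ _ k1); apply: (sgM G_subgroup).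
  + have [k k1] := G_shift G1; split=> [|y]; first exact: (sgV G_subgroup).
    by rewrite -[y](subrK k) (secV _ k1); apply: (sgV G_subgroup).
- by split=> [|y]; [exact: G_apow | rewrite sec_apow; exact: (sg1 G_subgroup)].
- move=> j e Ve; split=> [|y]; first exact: G_dir.
  by rewrite sec_dir; case: eqP => _; [exact: G_dir | exact: G_apow].
Qed.

Definition G1 : set (tree_aut p) := G `&` Stab1.

Lemma G1_subgroup : is_subgroup G1. Proof. exact: is_subgroupI. Qed.
Lemma G1_sub : G1 `<=` G. Proof. by move=> g []. Qed.
Lemma G1_stab : G1 `<=` Stab1. Proof. by move=> g []. Qed.

Lemma G1_D j e z : V j e -> G1 (D j e z).
Proof. by move=> Ve; split; [exact: G_D | exact: D_stab]. Qed.

(** A directed automorphism is its own section at the centre, and a is obtained as a section by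
    rescaling a nonzero entry to 1 and placing the centre at the matching offset. *)
Lemma G_lift x h : G h -> exists2 g, G1 g & sec g x = h.
Proof.
apply: (@G_ind [set h | exists2 g, G1 g & sec g x = h]).
- have sG1 := G1_subgroup; split=> [|_ _ [g1 G1g <-] [g2 G2g <-]|_ [g1 G1g <-]].
  + by exists 1; rewrite ?sec1 //; exact: (sg1 sG1).
  + exists (g1 * g2); first exact: (sgM sG1).
    by rewrite (secM0 x) //; exact: G1_stab.
  + by exists g1^-1; rewrite ?secV0 //; [exact: (sgV sG1) | exact: G1_stab].
- have [j [e [Ve /V_ev_neq0 [y y0 ey]]]] := V_nontrivial.
  exists (D j ((ev e y)^-1 *: e)%R (x - y)%R); first by apply/G1_D/VZ.
  rewrite sec_D // subKr evZ mulVf // -subr_eq0 subKr.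
  by rewrite (negPf y0).
- by move=> j e Ve; exists (D j e x); rewrite ?sec_Dz //; exact: G1_D.
Qed.

Lemma G1_fi : finite_index G1 G.
Proof.
apply: (@fi_of_fin _ _ (fun g => crd p_prime (head (vtx 0%R) (g [:: vtx 0%R])))).
- exact: G1_subgroup.
- exact: G1_sub.
move=> g h Gg Gh; have [k gk] := G_shift Gg; have [l hl] := G_shift Gh.
rewrite gk hl /= !vtxK !add0r => kl; rewrite -{l}kl in hl.
split; first exact: (sgF G_subgroup).
by have := shiftM gk (shiftV hl); rewrite subrr.
Qed.

Definition gens : seq (tree_aut p) :=
  rooted_aut p :: flatten [seq [seq directed_aut j (defining_vector i) |
    i <- enum 'I_(family_size E j)] | j <- enum 'I_p].

Lemma gensE : generated [set` gens] = G.
Proof.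
congr generated; apply/seteqP; split=> [g|g] /=.
  rewrite inE => /predU1P [->|]; first by left.
  move=> /flattenP [_ /mapP [j _ ->] /mapP [i _ ->]]; right; by exists j, i.
move=> [->|[j [i ->]]]; first exact: mem_head.
rewrite inE; apply/orP; right; apply/flattenP.
eexists; first by apply/mapP; exists j; [rewrite mem_enum | reflexivity].
by apply: map_f; rewrite mem_enum.
Qed.

Lemma gens_p g : g \in gens -> g ^+ p = 1.
Proof.
rewrite inE => /predU1P [->|]; first exact: rooted_exp_p.
move=> /flattenP [_ /mapP [j _ ->] /mapP [i _ ->]].
by rewrite -[directed_aut _ _]/(dir _ _) -D_centre // D_exp_p.
Qed.

Lemma G_lower_central : [/\ finite_index (commutator_subgroup G G) G,
  finite_index (gamma3 G) G & finite_index (commutator_subgroup (gamma3 G) G) G].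
Proof. rewrite -gensE; exact: (lower_central_fi (prime_gt0 p_prime) gens_p). Qed.

End SpinalGroup.

(** * Congruence modulo a normal subgroup *)

Section Congruence.
Context {gT : groupType} (N G : set gT).
Hypotheses (sG : is_subgroup G) (nN : is_normal N G).
Implicit Types (x y z : gT).

Definition eqmod x y := N (x^-1 * y).

Let sN : is_subgroup N := normal_sg nN.

Lemma eqmod_refl x : eqmod x x.
Proof. by rewrite /eqmod mulVg; exact: (sg1 sN). Qed.
Lemma eqmod_sym x y : eqmod x y -> eqmod y x.
Proof. by move=> /(sgV sN); rewrite /eqmod invgM invgK. Qed.
Lemma eqmod_trans y x z : eqmod x y -> eqmod y z -> eqmod x z.
Proof. by move=> xy /(sgM sN xy); rewrite /eqmod !gnorm. Qed.
Lemma eqmodM x x' y y' : G y -> eqmod x x' -> eqmod y y' -> eqmod (x * y) (x' * y').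
Proof.
move=> Gy xx yy; rewrite /eqmod.
have -> : (x * y)^-1 * (x' * y') = (x^-1 * x') ^ y * (y^-1 * y').
  by rewrite /conjg !gnorm.
by apply: (sgM sN) => //; apply: (normal_J nN).
Qed.
Lemma eqmodV x y : G x -> eqmod x y -> eqmod x^-1 y^-1.
Proof.
move=> Gx xy; rewrite /eqmod invgK.
have -> : x * y^-1 = ((x^-1 * y)^-1) ^ x^-1 by rewrite /conjg !gnorm.
by apply: (normal_J nN); [apply: (sgV sN) | apply: (sgV sG)].
Qed.
Lemma eqmodX x y n : G x -> eqmod x y -> eqmod (x ^+ n) (y ^+ n).
Proof.
move=> Gx xy; elim: n => [|n IHn]; first exact: eqmod_refl.
by rewrite !expgS; apply: eqmodM => //; exact: (sgX _ sG).
Qed.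
Lemma eqmod_mem x y : eqmod x y -> N y -> N x.
Proof.
move=> xy Ny; have -> : x = y * (x^-1 * y)^-1 by rewrite !gnorm.
exact: (sgF sN).
Qed.
End Congruence.

(** * Rigid copies of lower central terms *)

Section RegularBranch.
Variables (p : nat) (p_prime : prime p) (p_odd : odd p) (E : spinal_datum p).
Implicit Types (f g h : tree_aut p) (x y z v k l i r s : 'F_p) (j : 'I_p)
  (e : 'rV['F_p]_p.-1) (H K : set (tree_aut p)).
Notation vtx := (vtx p_prime).
Notation sec := (sec p_prime).
Notation Stab1 := (Stab1 p_prime).
Notation rig := (rig p_prime).
Notation G := (spinal_group E).
Notation G1 := (G1 p_prime E).
Notation V := (family_span E).
Notation G' := (commutator_subgroup G G).

Let sS : is_subgroup Stab1 := Stab1_subgroup p_prime.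
Let sG : is_subgroup G := G_subgroup E.
Let G1S := @G1_stab p p_prime E.
Let rig_stab := @rig_stab p p_prime.
Let D_stab := @D_stab p p_prime.

(** The residue 0 is excluded because [ev e 0] is 0 by convention and not an entry. *)
Definition nonconst e := exists x y, [/\ x != 0%R, y != 0%R & ev e x != ev e y].

Lemma comm_rigl x g h : Stab1 g -> [~ rig x h, g] = rig x [~ h, sec g x].
Proof. by move=> g0; rewrite -invgR comm_rig // -rigV invgR. Qed.

Definition everywhere K : set (tree_aut p) := [set g | G g /\ forall v, K (rig v g)].

(** By [G_lift], conjugating [rig v g] by a suitable element of G conjugates its section by any
    prescribed h. *)
Lemma everywhere_normal K : is_normal K G -> is_normal (everywhere K) G.
Proof.
move=> nK; have sK := normal_sg nK; split; first split.
- by split=> [|v]; rewrite ?rig1; [exact: (sg1 sG) | exact: (sg1 sK)].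
- move=> g h [Gg Kg] [Gh Kh]; split=> [|v]; first exact: (sgM sG).
  by rewrite rigMM; apply: (sgM sK).
- move=> g [Gg Kg]; split=> [|v]; first exact: (sgV sG).
  by rewrite rigV; apply: (sgV sK).
- by move=> g [].
- move=> g h [Gg Kg] Gh; split=> [|v]; first exact: (sgJ sG).
  have [Z [GZ Z0] <-] := G_lift p_prime v Gh.
  by rewrite -rigJ //; apply: (normal_J nK).
Qed.

Lemma apow_commute k l : [~ apow k, apow l] = 1 :> tree_aut p.
Proof.
by apply/eqP/commgP; rewrite /commute -!(apowD p_prime) addrC.
Qed.

Lemma comm_D_same j e j' e' v : [~ D j e v, D j' e' v] = rig v [~ dir j e, dir j' e'].
Proof.
symmetry; apply: rig_eq => [||y].
- by apply: (sgR sS); exact: D_stab.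
- by rewrite secR0 ?sec_Dz //; exact: D_stab.
- move=> /negPf yv; rewrite secR0 ?sec_D // ?yv ?apow_commute //; exact: D_stab.
Qed.

(** Away from v and z both sections are powers of a, which commute. *)
Lemma comm_D j e j' e' v z : v != z ->
  [~ D j e v, D j' e' z] = rig v [~ dir j e, apow (ev e' (v - z)%R)] *
                          rig z [~ apow (ev e (z - v)%R), dir j' e'].
Proof.
move=> vz; have zv : (z == v) = false by rewrite eq_sym (negPf vz).
have S2 : Stab1 (rig v [~ dir j e, apow (ev e' (v - z)%R)] *
                          rig z [~ apow (ev e (z - v)%R), dir j' e']).
  by apply: (sgM sS); exact: rig_stab.
apply: (shift_ext _ S2) => [|y].
  by apply: (sgR sS); exact: D_stab.
rewrite secR0 ?sec_D //; try exact: D_stab.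
rewrite (secM0 y) ?sec_rig; try exact: rig_stab.
case: (eqVneq y v) => [->|yv]; first by rewrite (negPf vz) mulg1.
by case: (eqVneq y z) => [->|yz]; rewrite ?mul1g // apow_commute.
Qed.

Lemma G'_normal : is_normal G' G.
Proof. by apply: comm_sub_normal => //; exact: normal_refl. Qed.
Lemma K_normal : is_normal (gamma3 G) G. Proof. exact: gamma3_normal. Qed.

(* The first components of the elements of Stab_G(1) that act trivially on the
   subtree with offset i. *)
Definition cosec i : set (tree_aut p) := [set g | G g /\
  forall v, exists Z, [/\ G1 Z, sec Z v = g & sec Z (v + i)%R = 1]].

Lemma cosec_normal i : is_normal (cosec i) G.
Proof.
have sG1 := G1_subgroup p_prime E; split; first split.
- split; first exact: (sg1 sG).
  by move=> v; exists 1; split; rewrite ?sec1 //; exact: (sg1 sG1).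
- move=> g h [Gg Zg] [Gh Zh]; split; first exact: (sgM sG).
  move=> v; have [Y [Y1 Yv Yi]] := Zg v; have [Z [Z1 Zv Zi]] := Zh v.
  exists (Y * Z); split; first exact: (sgM sG1).
    by rewrite (secM0 v) ?Yv ?Zv //; exact: G1S.
  by rewrite (secM0 (v + i)%R) ?Yi ?Zi ?mulg1 //; exact: G1S.
- move=> g [Gg Zg]; split; first exact: (sgV sG).
  move=> v; have [Y [Y1 Yv Yi]] := Zg v; exists Y^-1; split.
  + exact: (sgV sG1).
  + by rewrite secV0 ?Yv //; exact: G1S.
  + by rewrite secV0 ?Yi ?invg1 //; exact: G1S.
- by move=> g [].
- move=> g h [Gg Zg] Gh; split; first exact: (sgJ sG).
  move=> v; have [Y [Y1 Yv Yi]] := Zg v; have [W W1 Wv] := G_lift p_prime v Gh.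
  exists (Y ^ W); split; first exact: (sgJ sG1).
  + by rewrite secJ0 ?Yv ?Wv //; exact: G1S.
  + by rewrite secJ0 ?Yi ?conj1g //; exact: G1S.
Qed.

(** Two multiples of e are used, with coefficients e_s and -e_i, placed so that their entries at v +
    i are e_s e_i and -e_i e_s and cancel. *)
Lemma D_cosec j e i s : V j e -> i != 0%R -> s != 0%R -> s != i ->
  cosec i (dir j (ev e s *: e)%R * apow (- (ev e i * ev e (s - i)))%R).
Proof.
move=> Ve i0 s0 si; split.
  by apply: (sgM sG); [apply: (G_dir p_prime (VZ _ Ve)) | exact: G_apow].
move=> v; exists (D j (ev e s *: e)%R v * D j (- ev e i *: e)%R (v + i - s)%R).
split; first by apply: (sgM (G1_subgroup p_prime E)); apply: G1_D; apply: VZ.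
  rewrite (secM0 v) ?sec_Dz //; try exact: D_stab.
  have -> : sec (D j (- ev e i *: e)%R (v + i - s)%R) v =
            apow (ev (- ev e i *: e)%R (v - (v + i - s))%R).
    rewrite sec_D //; case: eqP => // E0; case/eqP: si.
    by rewrite -[s](subKr (v + i)%R) -E0 addrC addKr.
  by rewrite evZ mulNr opprB addrCA opprD addNKr.
rewrite (secM0 (v + i)%R) ?sec_D //; try exact: D_stab.
have -> : (v + i == v) = false.
  by apply: contraNF i0 => /eqP E0; rewrite -(addKr v i) E0 addNr.
have -> : (v + i == v + i - s) = false.
  by apply: contraNF s0 => /eqP E0; rewrite -[s](subKr (v + i)%R) -E0 subrr.
rewrite !evZ subKr [(v + i)%R]addrC addrK -(apowD p_prime) mulNr.
by rewrite [X in (X - _)%R]mulrC addrN apow0.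
Qed.

Lemma comm_G' g h : G g -> G h -> G' [~ g, h].
Proof. exact: mem_comm. Qed.

Lemma everywhere_dir2 j e j' e' g : V j e -> V j' e' -> G g ->
  everywhere (gamma3 G) [~ [~ dir j e, dir j' e'], g].
Proof.
move=> Ve Ve' Gg; have Gc : G [~ dir j e, dir j' e'].
  by apply: (sgR sG); exact: (G_dir p_prime).
split=> [|v]; first exact: (sgR sG).
have [Z G1Z <-] := G_lift p_prime v Gg; rewrite -comm_rigl; last exact: G1S.
apply: mem_comm; last exact: G1_sub G1Z.
by rewrite -comm_D_same; apply: comm_G'; exact: (G_D p_prime).
Qed.

(** The commutator of [D j e v] with [D j' e' (v + i)] has two components; commuting it with Z kills
    the second by hypothesis and puts the result into [gamma3 G]. *)
Lemma rig_comm_gamma3 i j e j' e' v Z : i != 0%R -> V j e -> V j' e' -> G1 Z ->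
  [~ [~ apow (ev e i), dir j' e'], sec Z (v + i)%R] = 1 ->
  gamma3 G (rig v [~ [~ dir j e, apow (ev e' (- i)%R)], sec Z v]).
Proof.
move=> i0 Ve Ve' G1Z ZC; have vi : v != (v + i)%R.
  by rewrite -subr_eq0 opprD addNKr oppr_eq0.
suff -> : rig v [~ [~ dir j e, apow (ev e' (- i)%R)], sec Z v] =
  [~ [~ D j e v, D j' e' (v + i)%R], Z].
  apply: mem_comm; last exact: G1_sub G1Z.
  by apply: comm_G'; exact: (G_D p_prime).
have E1 : (v - (v + i) = - i)%R by rewrite opprD addNKr.
have E2 : (v + i - v = i)%R by rewrite addrC addKr.
have Z0 := G1S G1Z; rewrite comm_D // E1 E2.
apply: rig_eq.
- by apply: (sgR sS) => //; apply: (sgM sS); exact: rig_stab.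
- rewrite secR0 // ?(secM0 v) ?sec_rigE ?sec_rig ?(negPf vi) ?mulg1 //; try exact: rig_stab.
  by apply: (sgM sS); exact: rig_stab.
- move=> y yv; rewrite secR0 //; last by apply: (sgM sS); exact: rig_stab.
  rewrite (secM0 y) ?sec_rig ?(negPf yv) ?mul1g; try exact: rig_stab.
  by case: eqP => [->|_]; rewrite ?comm1g.
Qed.

(** The second component dies for one of two reasons: the element of Stab_G(1) is trivial there, or
    e_i = 0. Rescaling e' turns the power of a in the first component into a itself. *)
Lemma everywhere_cosec i j e j' e' g : i != 0%R -> V j e -> V j' e' ->
  ev e' (- i)%R != 0%R -> cosec i g \/ (ev e i = 0%R /\ G g) ->
  everywhere (gamma3 G) [~ [~ dir j e, apow 1%R], g].
Proof.
move=> i0 Ve Ve' e'i gP; have Gg : G g by case: gP => -[].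
split=> [|v]; first by do 2?apply: (sgR sG) => //; [exact: (G_dir p_prime) | exact: G_apow].
pose e1 := ((ev e' (- i))^-1 *: e')%R.
have e1i : ev e1 (- i)%R = 1%R by rewrite evZ mulVf.
rewrite -e1i; case: gP => [[_ /(_ v) [Z [G1Z <- Zi]]]|[ei _]].
  by apply: (@rig_comm_gamma3 _ _ _ j' _ _ Z) => //; [exact: VZ | rewrite Zi commg1].
have [Z G1Z <-] := G_lift p_prime v Gg.
by apply: (@rig_comm_gamma3 _ _ _ j' _ _ Z) => //; [exact: VZ | rewrite ei apow0 // !comm1g].
Qed.

Lemma Fp_fermat (x : 'F_p) : (x ^+ p = x)%R.
Proof.
rewrite -[x]natr_Zp -natrX; apply: val_inj; rewrite /= !Fp_natE //.
exact: fermat_little.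
Qed.

Lemma Fp_nat_neq0 n : (0 < n < p)%N -> (n%:R != 0 :> 'F_p)%R.
Proof. by case/andP=> n0 np; rewrite -val_eqE /= Fp_natE // modn_small // -lt0n. Qed.

Lemma Fp_2neq0 : (2%:R != 0 :> 'F_p)%R.
Proof. by apply: Fp_nat_neq0; rewrite odd_prime_gt2. Qed.

(* A vector whose support is closed under addition and with e_i e_r proportional
   to e_(i+r) is a multiple of a homomorphism from Z/p to the units of F_p. *)
Lemma const_of_mult e : e <> 0%R ->
  (forall i r, ev e i != 0 -> ev e r != 0 -> i + r != 0 -> ev e (i + r) != 0)%R ->
  (forall i r i' r', ev e i != 0 -> ev e i' != 0 -> r != 0 -> r' != 0 ->
     i + r != 0 -> i' + r' != 0 ->
     ev e i * ev e r * ev e (i' + r') = ev e i' * ev e r' * ev e (i + r))%R ->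
  (forall x, x != 0%R -> ev e x != 0%R) /\ ~ nonconst e.
Proof.
move=> /(V_ev_neq0 p_prime) [u u0 eu] closed mult.
have full x : x != 0%R -> ev e x != 0%R.
  (* A support closed under addition contains all nonzero multiples of u, that is, every nonzero
     residue. *)
  move=> x0; suff H n : (0 < n < p)%N -> ev e (u *+ n)%R != 0%R.
    have := H (x / u : 'F_p)%R; rewrite -mulr_natr natr_Zp mulrCA divff // mulr1; apply.
    rewrite (ltn_ord (vtx (x / u)%R)) andbT lt0n.
    by rewrite -[X in _ != X]/(nat_of_ord (0%R : 'F_p)) val_eqE mulf_neq0 ?invr_eq0.
  elim: n => // -[|n] IHn n2 //.
  have n1 : (0 < n.+1 < p)%N by case/andP: n2 => _ /ltnW.
  rewrite mulrSr; apply: closed => //; first exact: IHn.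
  by rewrite -mulrSr -mulr_natr mulf_neq0 // Fp_nat_neq0.
split=> // -[x [y [x0 y0 /negP []]]].
pose c := ev e 1%R; pose q := (ev e 2%:R / c)%R.
have c0 : c != 0%R by apply: full; exact: oner_neq0.
have two0 := Fp_2neq0; have d0 := full _ two0.
have multE i r : (i != 0 -> r != 0 -> i + r != 0 -> ev e (i + r) = ev e i * ev e r * q / c)%R.
  move=> i0 r0 ir0; have := mult i r 1%R 1%R (full i i0) c0 r0 (oner_neq0 _) ir0 two0.
  rewrite -[(1 + 1)%R]/(2%:R%R) -/c => M.
  by rewrite /q !mulrA M [(c * c * _)%R]mulrC !mulrA !mulfK.
have powE n : (0 < n < p)%N -> (ev e n%:R = c * q ^+ n.-1)%R.
  elim: n => // -[|n] IHn n2; first by rewrite expr0 mulr1.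
  have n1 : (0 < n.+1 < p)%N by case/andP: n2 => _ /ltnW.
  rewrite -natr1 multE ?Fp_nat_neq0 ?oner_neq0 ?natr1 ?Fp_nat_neq0 // IHn // -/c /=.
  by rewrite exprSr mulrA mulrAC mulfK.
(* Evaluating [multE] at 2 + (-1) = 1 gives c = c q^p, and q^p = q. Oddness of p ensures that 2 is a
   nonzero residue. *)
have q1 : q = 1%R.
  have p2 : (2 < p)%N by rewrite odd_prime_gt2.
  have N1 : (-1 = (p.-1)%:R :> 'F_p)%R.
    by apply/eqP; rewrite eq_sym -addr_eq0 natr1 prednK ?prime_gt0 // pchar_Fp_0.
  have N2 : (2%:R + -1 = 1 :> 'F_p)%R by rewrite -[2%:R%R]/(1 + 1)%R addrK.
  have := multE 2%:R%R (-1)%R two0; rewrite N2 oppr_eq0 oner_neq0 => /(_ isT isT).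
  have -> : (ev e 2%:R = c * q)%R by rewrite /q mulrC divfK.
  have [p1 pE] : (0 < p.-1 < p)%N /\ p = p.-1.-1.+2.
    by move: p2; case: (p) => [|[|[|n]]] //= _; rewrite ltnSn.
  have qp : (q ^+ p.-1.-1 * (q * q) = q)%R.
    by rewrite -expr2 -exprD addn2 -pE Fp_fermat.
  rewrite N1 powE // -/c => H; apply: (mulfI c0); rewrite mulr1 -[in LHS]qp [RHS]H.
  by field.
have evE z : z != 0%R -> ev e z = c.
  move=> z0; rewrite -[z]natr_Zp powE ?q1 ?expr1n ?mulr1 //.
  by rewrite (ltn_ord (vtx z)) andbT lt0n.
by rewrite !evE.
Qed.

End RegularBranch.

Section RigidGamma3.
Variables (p : nat) (p_prime : prime p) (p_odd : odd p) (E : spinal_datum p).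
Implicit Types (f g h : tree_aut p) (x y z v k l i r s : 'F_p) (j : 'I_p)
  (e : 'rV['F_p]_p.-1) (H K M N : set (tree_aut p)).
Notation G := (spinal_group E).
Notation V := (family_span E).
Notation G' := (commutator_subgroup G G).
Notation cosec := (cosec p_prime E).
Notation everywhere := (everywhere p_prime E).

Let sG : is_subgroup G := G_subgroup E.

Lemma apowX k n : apow k ^+ n = apow (k * n%:R)%R :> tree_aut p.
Proof.
elim: n => [|n IHn]; first by rewrite mulr0 apow0.
by rewrite expgS IHn -(apowD p_prime) -natr1 mulrDr mulr1 addrC.
Qed.
Lemma dirX j e n : dir j e ^+ n = dir j (n%:R *: e)%R.
Proof.
by rewrite -!(D_centre p_prime) D_exp // scaler_nat.
Qed.
Lemma dirX_F j e k : dir j e ^+ (k : nat) = dir j (k *: e)%R.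
Proof. by rewrite dirX natr_Zp. Qed.
Lemma apowX_F k l : apow k ^+ (l : nat) = apow (k * l)%R :> tree_aut p.
Proof. by rewrite apowX natr_Zp. Qed.

Lemma apow_mem H k : is_subgroup H -> k != 0%R -> H (apow k) -> H (apow 1%R).
Proof.
by move=> sH k0 Hk; rewrite -(mulfV k0) -apowX_F; exact: (sgX _ sH).
Qed.
Lemma dir_mem H j e k : is_subgroup H -> k != 0%R -> H (dir j (k *: e)%R) -> H (dir j e).
Proof.
move=> sH k0 Hk; rewrite -[e]scale1r -(mulVf k0) -scalerA -dirX_F.
exact: (sgX _ sH).
Qed.

Lemma G_sub H : is_subgroup H -> H (apow 1%R) -> (forall j e, V j e -> H (dir j e)) ->
  G `<=` H.
Proof. exact: (G_ind p_prime). Qed.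

Hypothesis nonconst_families : forall j e, V j e -> e <> 0%R ->
  exists2 e0, V j e0 & nonconst e0.

Let supp x := exists j e, V j e /\ ev e x != 0%R.

(** Modulo H the elements of [D_cosec] give b^(e_(i+r)) = a^(e_i e_r). If a were outside H, only its
    trivial power would lie in H, and comparing exponents would put the vector under
    [const_of_mult], whose conclusion the choice of [e1] contradicts. *)
Lemma cosec_cover H : is_normal H G ->
  (forall i, supp i -> supp (- i)%R) ->
  (exists j e, [/\ V j e, e <> 0%R & forall x, supp x -> ev e x != 0%R]) ->
  (forall i, i != 0%R -> supp (- i)%R -> cosec i `<=` H) -> G `<=` H.
Proof.
move=> nH suppN [j [e [Ve e0 supp_e]]] cosecH; have sH := normal_sg nH.
have supp_of j' e' x : V j' e' -> ev e' x != 0%R -> supp x by exists j', e'.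
have Hcos e1 i s : V j e1 -> i != 0%R -> s != 0%R -> s != i -> supp i ->
    H (dir j (ev e1 s *: e1)%R * apow (- (ev e1 i * ev e1 (s - i)))%R).
  move=> Ve1 i0 s0 si /suppN i_supp; apply: (cosecH i) => //.
  exact: D_cosec.
have Ha : H (apow 1%R).
  have [//|Ha] := pselect (H (apow 1%R)).
  (* If every nonzero residue lies in some support, a non-constant vector of family j serves;
     otherwise e itself does, because its support cannot be full. *)
  have [e1 [Ve1 e10 e1P]] : exists e1, [/\ V j e1, e1 <> 0%R &
      (forall x, x != 0%R -> ev e1 x != 0%R) -> nonconst e1].
    have [full|nfull] := pselect (forall x, x != 0%R -> supp x).
      have [e1 Ve1 nc] := nonconst_families Ve e0; exists e1; split=> // e10.
      by case: nc => [x [y [_ _]]]; rewrite e10 !ev0 eqxx.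
    exists e; split=> // full; case: nfull => x /full ex; exact: supp_of Ve ex.
  have nz x : ev e1 x != 0%R -> x != 0%R.
    by apply: contraNneq => ->; rewrite ev_at0.
  have apow_H k : H (apow k) -> k = 0%R.
    by move=> Hk; apply/eqP; apply: contra_notT Ha => k0; exact: apow_mem Hk.
  have cong i r : ev e1 i != 0%R -> r != 0%R -> (i + r != 0)%R ->
      eqmod H (dir j (ev e1 (i + r)%R *: e1)%R) (apow (ev e1 i * ev e1 r)%R).
    move=> ei r0 ir0; have i0 := nz _ ei.
    have := Hcos e1 i (i + r)%R Ve1 i0 ir0; rewrite [(i + r)%R]addrC addrK.
    rewrite -subr_eq0 addrK => /(_ r0 (supp_of _ _ _ Ve1 ei)).
    rewrite (apowN p_prime) => /(sgV sH); rewrite invgM invgK.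
    set a := apow _; set b := dir _ _ => Hab.
    rewrite /eqmod; have -> : b^-1 * a = (a * b^-1) ^ a by rewrite /conjg !gnorm.
    by apply: (normal_J nH) => //; exact: G_apow.
  have closed i r : (ev e1 i != 0 -> ev e1 r != 0 -> i + r != 0 -> ev e1 (i + r) != 0)%R.
    move=> ei er ir0; apply/eqP => eir; have := cong i r ei (nz _ er) ir0.
    rewrite eir scale0r dir0 // /eqmod invg1 mul1g => /apow_H/eqP.
    by rewrite mulf_eq0 (negPf ei) (negPf er).
  have [] := const_of_mult p_prime p_odd e10 closed; last by move=> /e1P.
  move=> i r i' r' ei ei' r0 r0' ir0 ir0'.
  have GV x : G (dir j (x *: e1)%R) by apply: (G_dir p_prime); apply: VZ.
  have := eqmodX sG nH (ev e1 (i' + r')%R) (GV _) (cong i r ei r0 ir0).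
  have := eqmodX sG nH (ev e1 (i + r)%R) (GV _) (cong i' r' ei' r0' ir0').
  rewrite !apowX_F !dirX_F !scalerA mulrC => /(eqmod_sym nH) c1 c2.
  have := eqmod_trans nH c1 c2; rewrite /eqmod -(apowN p_prime) -(apowD p_prime).
  by move=> /apow_H/eqP; rewrite addrC subr_eq0 => /eqP.
apply: G_sub => // j' e' Ve'.
have [->|/eqP e'0] := eqVneq e' 0%R; first by rewrite dir0 //; exact: (sg1 sH).
have [s s0 es] := V_ev_neq0 p_prime e'0.
(* With a already in H, [D_cosec] for the offset -s and the parameter s leaves the e'_s-th power of
   [dir j' e']; s and -s differ as p is odd. *)
have Ns : (- s != 0)%R by rewrite oppr_eq0.
have sNs : s != (- s)%R.
  by rewrite -addr_eq0 -mulr2n -mulr_natr mulf_neq0 // Fp_2neq0.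
have := D_cosec p_prime Ve' Ns s0 sNs.
move=> /(cosecH (- s)%R Ns _); rewrite opprK => /(_ (supp_of _ _ _ Ve' es)).
rewrite (sgMr _ sH); first exact: dir_mem.
by rewrite -[X in apow X]mul1r -apowX_F; exact: (sgX _ sH).
Qed.

(** If e vanishes at some nonzero i with -i in a support, the unwanted component is trivial from the
    start. Otherwise the union of all supports is symmetric and contained in that of e, and
    [cosec_cover] applies. *)
Lemma everywhere_dir_apow j e g : V j e -> G g ->
  everywhere (gamma3 G) [~ [~ dir j e, apow 1%R], g].
Proof.
move=> Ve Gg; have nN := everywhere_normal p_prime (K_normal E).
have [[i [i0 [j' [e' [Ve' e'i]]] ei]]|noi] :=
    pselect (exists i, [/\ i != 0%R, supp (- i)%R & ev e i = 0%R]).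
  by apply: (everywhere_cosec i0 Ve Ve' e'i); right.
have supp_e i : i != 0%R -> supp (- i)%R -> ev e i != 0%R.
  by move=> i0 si; apply/eqP => ei; apply: noi; exists i.
have supp0 i : supp i -> i != 0%R.
  by case=> [j' [e' [_]]]; apply: contraNneq => ->; rewrite ev_at0.
have suppN i : supp i -> supp (- i)%R.
  move=> si; exists j, e; split=> //; apply: supp_e; first by rewrite oppr_eq0 supp0.
  by rewrite opprK.
set N := everywhere (gamma3 G) in nN *; have sN := normal_sg nN.
set c := [~ dir j e, apow 1%R].
have Gc : G c by apply: (sgR sG); [exact: (G_dir p_prime) | exact: G_apow].
(* The centraliser of c modulo N need not be normal; using all conjugates of c makes it so. *)
pose C := [set g | G g /\ forall h, G h -> N [~ c ^ h, g]].
suff GC : G `<=` C by have [_ /(_ _ (sg1 sG))] := GC _ Gg; rewrite conjg1.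
have nC : is_normal C G.
  split; first split.
  - by split=> [|h _]; rewrite ?commg1; [exact: (sg1 sG) | exact: (sg1 sN)].
  - move=> x y [Gx cx] [Gy cy]; split=> [|h Gh]; first exact: (sgM sG).
    have ->: [~ c ^ h, x * y] = [~ c ^ h, y] * [~ c ^ h, x] ^ y.
      by rewrite /commg /conjg !gnorm.
    by apply: (sgM sN); [exact: cy | apply: (normal_J nN) => //; exact: cx].
  - move=> x [Gx cx]; split=> [|h Gh]; first exact: (sgV sG).
    have ->: [~ c ^ h, x^-1] = ([~ c ^ h, x] ^ x^-1)^-1 by rewrite /commg /conjg !gnorm.
    by apply: (sgV sN); apply: (normal_J nN); [exact: cx | exact: (sgV sG)].
  - by move=> x [].
  - move=> x y [Gx cx] Gy; split=> [|h Gh]; first exact: (sgJ sG).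
    have ->: [~ c ^ h, x ^ y] = [~ c ^ (h * y^-1), x] ^ y by rewrite [RHS]conjRg -conjgM mulgVK.
    by apply: (normal_J nN) => //; apply: cx; exact: (sgF sG).
apply: (cosec_cover nC suppN).
  have [j' [e' [Ve' e'0]]] := V_nontrivial E.
  have [x x0 ex] := V_ev_neq0 p_prime e'0.
  exists j, e; split=> //.
    move=> e0; have sx : supp x by exists j', e'.
    by move: (supp_e x x0 (suppN _ sx)); rewrite e0 ev0 eqxx.
  by move=> y sy; apply: supp_e; [exact: supp0 | exact: suppN].
move=> i i0 [j' [e' [Ve' e'i]]] x cx.
have nD := cosec_normal p_prime E i.
split=> [|h Gh]; first exact: normal_sub nD _ cx.
have -> : [~ c ^ h, x] = [~ c, x ^ h^-1] ^ h by rewrite [RHS]conjRg conjgKV.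
apply: (normal_J nN) => //; apply: (everywhere_cosec i0 Ve Ve' e'i); left.
by apply: (normal_J nD) => //; exact: (sgV sG).
Qed.

Lemma G_derived_sub M : is_normal M G -> M [~ apow 1%R, apow 1%R] ->
  (forall j e, V j e -> M [~ dir j e, apow 1%R]) ->
  (forall j e j' e', V j e -> V j' e' -> M [~ dir j e, dir j' e']) -> G' `<=` M.
Proof.
move=> nM Maa Mba Mbb; apply: derived_sub_gen => //.
move=> x y [->|[j [i ->]]] [->|[k [l ->]]].
- by rewrite -(apow1 p_prime).
- rewrite -invgR; apply: (sgV (normal_sg nM)).
  by rewrite -(apow1 p_prime); apply: Mba; exact: V_row.
- by rewrite -(apow1 p_prime); apply: Mba; exact: V_row.
- by apply: Mbb; exact: V_row.
Qed.

(** It is enough that G' is central modulo [everywhere (gamma3 G)], and this can be tested on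
    commutators of generators. *)
Lemma gamma3_everywhere : gamma3 G `<=` everywhere (gamma3 G).
Proof.
have nN := everywhere_normal p_prime (K_normal E).
have nC := central_mod_normal sG nN.
apply: comm_sub (normal_sg nN) _ => x g G'x Gg.
suff G'C : G' `<=` central_mod (everywhere (gamma3 G)) G by case: (G'C _ G'x) => _; apply.
apply: G_derived_sub => //.
- by rewrite commgg; exact: (sg1 (normal_sg nC)).
- move=> j e Ve; split=> [|h Gh]; last exact: everywhere_dir_apow.
  by apply: (sgR sG); [exact: (G_dir p_prime) | exact: G_apow].
- move=> j e j' e' Ve Ve'; split=> [|h Gh]; last exact: everywhere_dir2.
  by apply: (sgR sG); exact: (G_dir p_prime).
Qed.

End RigidGamma3.

(** * Rigid copies of the derived subgroup *)

Section RigidDerived.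
Variables (p : nat) (p_prime : prime p) (p_odd : odd p) (E : spinal_datum p).
Implicit Types (f g h : tree_aut p) (x y z v k l i r s : 'F_p) (j : 'I_p)
  (e : 'rV['F_p]_p.-1) (H K M N : set (tree_aut p)).
Notation rig := (rig p_prime).
Notation G := (spinal_group E).
Notation V := (family_span E).
Notation G' := (commutator_subgroup G G).
Notation everywhere := (everywhere p_prime E).

Let sG : is_subgroup G := G_subgroup E.
Let rig_stab := @rig_stab p p_prime.

Definition nonsym e := exists x, ev e x != ev e (- x)%R.

Lemma nonsym_nonconst e : nonsym e -> nonconst e.
Proof.
move=> [x ex]; have x0 : x != 0%R by apply: contraNneq ex => ->; rewrite oppr0.
by exists x, (- x)%R; rewrite oppr_eq0.
Qed.

Hypothesis nonsym_families : forall j e, V j e -> e <> 0%R ->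
  exists2 e0, V j e0 & nonsym e0.

Let nonconst_families j e : V j e -> e <> 0%R -> exists2 e0, V j e0 & nonconst e0.
Proof. by move=> Ve /(nonsym_families Ve) [e0 Ve0 /nonsym_nonconst]; exists e0. Qed.

Let nK : is_normal (gamma3 G) G := K_normal E.
Let sK : is_subgroup (gamma3 G) := normal_sg nK.
Let nG' : is_normal G' G := G'_normal E.
Let sG' : is_subgroup G' := normal_sg nG'.

Let gamma3_rig v g : gamma3 G g -> G' (rig v g).
Proof.
move=> /(gamma3_everywhere p_prime p_odd nonconst_families) [_ /(_ v)].
by apply: comm_subl => //; exact: normal_refl.
Qed.

Lemma comm_eqmodr g h n : G g -> G h -> eqmod (gamma3 G) [~ g, h ^+ n] ([~ g, h] ^+ n).
Proof. by move=> Gg Gh; apply: comm_expg => //; exact: normal_refl. Qed.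

(** Rigid copies of [gamma3 G] lie in G', so a computation modulo [gamma3 G] may be carried out
    inside a rigid copy modulo G'. *)
Lemma rig_eqmod v g h : eqmod (gamma3 G) g h -> eqmod G' (rig v g) (rig v h).
Proof. by move=> /(gamma3_rig v); rewrite /eqmod rigMM rigV. Qed.

Lemma rig_commute x y g h : x != y -> rig x g * rig y h = rig y h * rig x g.
Proof.
move=> xy; apply/eqP; have := comm_rig y h (rig_stab x g).
by rewrite sec_rig eq_sym (negPf xy) comm1g rig1 => /eqP/commgP/eqP.
Qed.

Section OneVector.
Variables (j : 'I_p) (e : 'rV['F_p]_p.-1).
Hypothesis Ve : V j e.
Let b := dir j e.
Let c := [~ b, apow 1%R].
Let Gb : G b. Proof. exact: (G_dir p_prime). Qed.
Let Gc : G c. Proof. by apply: (sgR sG) => //; exact: G_apow. Qed.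

Let cpow k := c ^+ (k : nat).

Lemma comm_b_apow k : eqmod (gamma3 G) [~ b, apow k] (cpow k).
Proof.
rewrite -[k in apow k]mul1r -(apowX_F p_prime); apply: comm_eqmodr => //.
exact: G_apow.
Qed.

Lemma cpow_nat n : eqmod (gamma3 G) (c ^+ n) (cpow n%:R%R).
Proof.
have Ga : G (apow 1%R) by exact: G_apow.
apply: (@eqmod_trans _ _ _ nK [~ b, apow n%:R%R]); last exact: comm_b_apow.
apply: (eqmod_sym nK).
by rewrite -[n%:R%R]mul1r -(apowX p_prime); exact: comm_eqmodr.
Qed.

Lemma cpowD k l : eqmod (gamma3 G) (cpow k * cpow l) (cpow (k + l)%R).
Proof.
have -> : (k + l = ((k : nat) + (l : nat))%N%:R)%R by rewrite natrD !natr_Zp.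
by rewrite -expgnDr; exact: cpow_nat.
Qed.

(** Up to G' this is the commutator of [D j e v] with the D at v + i whose vector is l times e: its
    two components are powers of c modulo [gamma3 G]. *)
Lemma rig_c_shift v i l : i != 0%R ->
  G' (rig v (cpow (l * ev e (- i))%R) * (rig (v + i)%R (cpow (l * ev e i)%R))^-1).
Proof.
move=> i0; have vi : v != (v + i)%R by rewrite -subr_eq0 opprD addNKr oppr_eq0.
have: G' [~ D j e v, D j (l *: e)%R (v + i)%R].
  by apply: comm_G'; apply: (G_D p_prime); rewrite ?VZ.
have E2 : (v + i - v = i)%R by rewrite addrC addKr.
rewrite comm_D // E2 opprD addNKr evZ.
set u := rig v _; set w := rig _ _ => G'uw.
have uE : eqmod G' u (rig v (cpow (l * ev e (- i))%R)).
  by apply: rig_eqmod; exact: comm_b_apow.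
have wE : eqmod G' w ((rig (v + i)%R (cpow (l * ev e i)%R))^-1).
  rewrite -rigV; apply: rig_eqmod; rewrite -dirX_F // mulrC.
  have Ga : G (apow (ev e i)) by exact: G_apow.
  apply: (@eqmod_trans _ _ _ nK ([~ apow (ev e i), b] ^+ l)).
    exact: comm_eqmodr.
  rewrite -invgR expVgn; apply: (eqmodV sG nK).
    by apply: (sgX _ sG); exact: (sgR sG).
  apply: (@eqmod_trans _ _ _ nK (cpow (ev e i) ^+ l)).
    by apply: (eqmodX sG nK); [exact: (sgR sG) | exact: comm_b_apow].
  have -> : (ev e i * l = ((ev e i : nat) * (l : nat))%N%:R)%R.
    by rewrite natrM !natr_Zp.
  have -> : cpow (ev e i) ^+ l = c ^+ ((ev e i : nat) * (l : nat))%N by rewrite expgnA.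
  exact: cpow_nat.
have -> : rig v (cpow (l * ev e (- i))%R) * (rig (v + i)%R (cpow (l * ev e i)%R))^-1 =
  u * w * ((u^-1 * rig v (cpow (l * ev e (- i))%R)) *
    (w^-1 * (rig (v + i)%R (cpow (l * ev e i)%R))^-1)).
  have -> : u * w * (u^-1 * rig v (cpow (l * ev e (- i))%R) *
      (w^-1 * (rig (v + i)%R (cpow (l * ev e i)%R))^-1)) =
    u * (w * (u^-1 * rig v (cpow (l * ev e (- i))%R))) *
      (w^-1 * (rig (v + i)%R (cpow (l * ev e i)%R))^-1) by rewrite !gnorm.
  have -> : w * (u^-1 * rig v (cpow (l * ev e (- i))%R)) =
      u^-1 * rig v (cpow (l * ev e (- i))%R) * w.
    by rewrite /w /u -rigV -rigMM rig_commute // eq_sym.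
  by rewrite !gnorm.
by apply: (sgM sG') => //; apply: (sgM sG').
Qed.

Hypothesis nonsym_e : nonsym e.

(** After p steps of length i the exponent is multiplied by q^p = q while the coordinate returns to
    v. So the copy of c^(1-q) lies in G', and q != 1 by non-symmetry. If e_(-i) = 0, a single step
    is enough. *)
Lemma rig_c_G' v : G' (rig v c).
Proof.
have [i ei] := nonsym_e.
have i0 : i != 0%R by apply: contraNneq ei => ->; rewrite oppr0.
have cp : gamma3 G (c ^+ p).
  have := cpow_nat p; rewrite pchar_Fp_0 // /cpow expg0.
  by move=> /(eqmod_mem nK); apply; exact: (sg1 sK).
have finish w k : k != 0%R -> G' (rig w (cpow k)) -> G' (rig w c).
  move=> k0 /(sgX (k^-1)%R sG') Gk; have [c1 c2] : eqmod (gamma3 G) (c ^+ 1) (cpow 1%R) /\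
      eqmod (gamma3 G) (c ^+ ((k : nat) * (k^-1%R : nat))%N) (cpow 1%R).
    split; first exact: (cpow_nat 1).
    have -> : (1 = ((k : nat) * (k^-1%R : nat))%N%:R :> 'F_p)%R by rewrite natrM !natr_Zp mulfV.
    exact: cpow_nat.
  have := rig_eqmod w (eqmod_trans nK c1 (eqmod_sym nK c2)).
  move=> /(eqmod_mem nG'); rewrite expg1; apply.
  have rX n g : rig w (g ^+ n) = rig w g ^+ n.
    by elim: n => [|n IHn]; rewrite ?expg0 ?rig1 // !expgS rigMM IHn.
  by rewrite expgnA rX.
pose Rel x k y l := G' (rig x (cpow k) * (rig y (cpow l))^-1).
have Rel_trans y l x k z r : Rel x k y l -> Rel y l z r -> Rel x k z r.
  by move=> /(sgM sG') H /H; rewrite !gnorm.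
have [m0|m0] := eqVneq (ev e (- i)) 0%R.
  have n0 : ev e i != 0%R by rewrite m0 in ei.
  have := rig_c_shift (v - i)%R 1%R i0.
  rewrite m0 mulr0 !mul1r subrK /cpow expg0 rig1 mul1g (sgVE _ sG').
  exact: finish.
pose q := (ev e i / ev e (- i))%R.
have step x k : Rel x k (x + i)%R (q * k)%R.
  have := rig_c_shift x (k / ev e (- i))%R i0; rewrite divfK //.
  by rewrite mulrAC -mulrA mulrC.
have steps n x k : Rel x k (x + i *+ n)%R (q ^+ n * k)%R.
  elim: n => [|n IHn]; first by rewrite addr0 mul1r /Rel mulgV; exact: (sg1 sG').
  apply: Rel_trans IHn _; rewrite mulrSr addrA exprS -mulrA; exact: step.
have q1 : (1 - q != 0)%R.
  rewrite subr_eq0 eq_sym; apply: contraNneq ei => q1.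
  by rewrite -[ev e i](divfK m0) -/q q1 mul1r.
have := steps p v 1%R; rewrite -mulr_natr pchar_Fp_0 // mulr0 addr0 Fp_fermat // mulr1.
rewrite /Rel -rigV -rigMM => Gq; apply: (finish v _ q1).
apply: (eqmod_mem nG') Gq; apply: rig_eqmod.
have GX n : G (c ^+ n) by exact: (sgX _ sG).
have Eq : eqmod (gamma3 G) (cpow (1 - q) * cpow q) (cpow 1%R).
  by have := cpowD (1 - q) q; rewrite subrK.
have -> : cpow (1 - q)%R = cpow (1 - q)%R * cpow q * (cpow q)^-1 by rewrite mulgK.
apply: (eqmodM nK) => //; last exact: eqmod_refl nK _.
exact: (sgV sG (GX _)).
Qed.
End OneVector.

Lemma G'_everywhere : G' `<=` everywhere G'.
Proof.
have nU := everywhere_normal p_prime nG'; have sU := normal_sg nU.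
have Ga : G (apow 1%R) by exact: G_apow.
have dirG j e : V j e -> G (dir j e) by exact: (G_dir p_prime).
have nonsymG j e : V j e -> nonsym e -> everywhere G' [~ dir j e, apow 1%R].
  move=> Ve ns; split=> [|v]; last exact: rig_c_G'.
  by apply: (sgR sG) => //; exact: dirG.
apply: (G_derived_sub p_prime nU).
- by rewrite commgg; exact: (sg1 sU).
- move=> j e Ve; have [->|/eqP e0] := eqVneq e 0%R.
    by rewrite dir0 // comm1g; exact: (sg1 sU).
  have [e1 Ve1 ns1] := nonsym_families Ve e0.
  have [|sym] := pselect (nonsym e); first exact: nonsymG.
  (* A symmetric e is the difference of the non-symmetric vectors e + e1 and e1; the commutator with
     a becomes a quotient of conjugates accordingly. *)
  have ns2 : nonsym (e + e1)%R.
    have [x ex] := ns1; exists x; rewrite !ev_is_additive.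
    have -> : ev e x = ev e (- x)%R.
      by apply/eqP; apply: contra_notT sym => ?; exists x.
    by rewrite (inj_eq (addrI _)).
  have -> : [~ dir j e, apow 1%R] =
      [~ dir j (e + e1)%R, apow 1%R] ^ (dir j e1)^-1 / [~ dir j e1, apow 1%R] ^ (dir j e1)^-1.
    by rewrite dirD // /commg /conjg !gnorm.
  apply: (sgF sU); apply: (normal_J nU); rewrite ?(sgVE _ sG) //; try exact: dirG.
    by apply: nonsymG => //; exact: VD.
  exact: nonsymG.
- move=> j e j' e' Ve Ve'; split=> [|v]; first by apply: (sgR sG); exact: dirG.
  by rewrite -comm_D_same; apply: comm_G'; exact: (G_D p_prime).
Qed.

End RigidDerived.

(** * Words *)

Section Words.
Variables (p : nat) (p_prime : prime p) (p_odd : odd p) (E : spinal_datum p).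
Implicit Types (f g h : tree_aut p) (x y z v k l i r s : 'F_p) (j : 'I_p)
  (e : 'rV['F_p]_p.-1) (H K M N : set (tree_aut p)).
Notation vtx := (vtx p_prime).
Notation sec := (sec p_prime).
Notation shift := (shift p_prime).
Notation Stab1 := (Stab1 p_prime).
Notation G := (spinal_group E).
Notation G1 := (G1 p_prime E).
Notation V := (family_span E).

Let sS : is_subgroup Stab1 := Stab1_subgroup p_prime.
Let sG1 : is_subgroup G1 := G1_subgroup p_prime E.
Let D_stab := @D_stab p p_prime.

Definition letter : Type := ('I_p * 'rV['F_p]_p.-1 * 'F_p)%type.
Definition wd (s : seq letter) : tree_aut p := \prod_(t <- s) D t.1.1 t.1.2 t.2.
Definition okw (w : seq ('I_p * 'rV['F_p]_p.-1)) := all (fun t => V t.1 t.2) w.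

Implicit Types (sw : seq letter) (w : seq ('I_p * 'rV['F_p]_p.-1)).

Lemma wd_nil : wd [::] = 1. Proof. exact: big_nil. Qed.
Lemma wd_cons t sw : wd (t :: sw) = D t.1.1 t.1.2 t.2 * wd sw. Proof. exact: big_cons. Qed.
Lemma wd_cat sw sw' : wd (sw ++ sw') = wd sw * wd sw'. Proof. exact: big_cat. Qed.

Lemma wd_stab sw : Stab1 (wd sw).
Proof. by apply: (sg_prod _ sS) => t; exact: D_stab. Qed.

Lemma wd_mem H sw : is_subgroup H -> okw (map fst sw) ->
  (forall j e z, V j e -> H (D j e z)) -> H (wd sw).
Proof.
move=> sH + HD; elim: sw => [|t sw IHs] /=; first by rewrite wd_nil => _; exact: (sg1 sH).
by move=> /andP [Vt /IHs Hs]; rewrite wd_cons; apply: (sgM sH) => //; apply: HD.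
Qed.

Lemma wd_G1 sw : okw (map fst sw) -> G1 (wd sw).
Proof. by move=> ok; apply: wd_mem => // j e z; exact: G1_D. Qed.

Lemma wd_apow sw k : wd sw * apow k = apow k * wd [seq (t.1, t.2 + k)%R | t <- sw].
Proof.
elim: sw => [|t sw IHs] /=; first by rewrite wd_nil mulg1 mul1g.
by rewrite wd_cons -mulgA IHs mulgA (D_apowC p_prime) -mulgA [in RHS]wd_cons.
Qed.

(** The positions of the letters are forgotten: powers of a can be collected on the left at the cost
    of translating positions, while lengths and classes depend only on families and vectors. *)
Definition wrepr (g : tree_aut p) k w := exists2 sw, map fst sw = w & g = apow k * wd sw.

Lemma repr1 : wrepr 1 0%R [::].
Proof. by exists [::]; rewrite // wd_nil apow0 // mulg1. Qed.
Lemma repr_mul g h k l w w' : wrepr g k w -> wrepr h l w' -> wrepr (g * h) (k + l)%R (w ++ w').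
Proof.
move=> [sw <- ->] [sw' <- ->]; exists ([seq (t.1, t.2 + l)%R | t <- sw] ++ sw').
  by rewrite map_cat -map_comp.
by rewrite wd_cat apowD // -!mulgA [wd sw * _]mulgA wd_apow !mulgA.
Qed.
Lemma repr_D j e z : wrepr (D j e z) 0%R [:: (j, e)].
Proof. by exists [:: (j, e, z)]; rewrite // wd_cons wd_nil apow0 // mulg1 mul1g. Qed.
Lemma repr_dir j e : wrepr (dir j e) 0%R [:: (j, e)].
Proof. by rewrite -(D_centre p_prime); exact: repr_D. Qed.
Lemma repr_apow k : wrepr (apow k) k [::].
Proof. by exists [::]; rewrite // wd_nil mulg1. Qed.

Lemma wd_rev sw : (wd sw)^-1 = wd [seq (t.1.1, - t.1.2, t.2)%R | t <- rev sw].
Proof.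
elim: sw => [|t sw IHs]; first by rewrite wd_nil invg1.
rewrite wd_cons invgM IHs rev_cons map_rcons -cats1 wd_cat wd_cons wd_nil mulg1.
by rewrite DN.
Qed.

Lemma repr_inv g k w : wrepr g k w -> wrepr g^-1 (- k)%R [seq (t.1, - t.2)%R | t <- rev w].
Proof.
move=> [sw <- ->]; rewrite invgM wd_rev -apowN // wd_apow.
by eexists; last reflexivity; rewrite -!map_comp -map_rev -map_comp.
Qed.

Lemma okw_cat w w' : okw (w ++ w') = okw w && okw w'. Proof. exact: all_cat. Qed.
Lemma okw_inv w : okw w -> okw [seq (t.1, - t.2)%R | t <- rev w].
Proof.
move=> ok; apply/allP => _ /mapP [t tw ->] /=; apply: VN.
by move: tw; rewrite mem_rev => /(allP ok).
Qed.

Lemma G_repr g : G g -> exists k w, okw w /\ wrepr g k w.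
Proof.
apply: (@G_ind _ p_prime E [set g | exists k w, okw w /\ wrepr g k w]).
- split=> [|g1 g2 [k [w [ok rg]]] [l [w' [ok' rg']]]|g1 [k [w [ok rg]]]].
  + by exists 0%R, [::]; split=> //; exact: repr1.
  + by exists (k + l)%R, (w ++ w'); rewrite okw_cat ok ok'; split=> //; exact: repr_mul.
  + by eexists _, _; split; [exact: okw_inv ok | exact: repr_inv rg].
- by exists 1%R, [::]; split=> //; exact: repr_apow.
- move=> j e Ve; exists 0%R, [:: (j, e)]; split; last exact: repr_dir.
  by rewrite /okw /= Ve.
Qed.

Lemma repr_shift g k w : wrepr g k w -> shift k g.
Proof.
move=> [sw _ ->]; rewrite -[k in shift k]addr0.
by apply: shiftM; [exact: apow_shift | exact: wd_stab].
Qed.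

Lemma shift_uniq k l g : shift k g -> shift l g -> k = l.
Proof.
move=> /(_ 0%R) + /(_ 0%R) => -> /(congr1 (fun u => crd p_prime (head (vtx 0%R) u))).
by rewrite /= !vtxK !add0r.
Qed.

Lemma G1_repr g : G1 g -> exists sw, okw (map fst sw) /\ g = wd sw.
Proof.
move=> [Gg g0]; have [k [w [ok rg]]] := G_repr Gg.
have k0 := shift_uniq (repr_shift rg) g0; rewrite k0 in rg.
by case: rg => sw E1 ->; exists sw; rewrite E1 apow0 // mul1g.
Qed.

Definition word_at (sw : seq letter) v := [seq t <- sw | t.2 == v].

(** A letter survives in exactly one section and contributes a power of a to all others, so the
    sections share the letters of sw among them. *)
Lemma repr_sec sw v :
  wrepr (sec (wd sw) v) (\sum_(t <- sw) ev t.1.2 (v - t.2))%R (map fst (word_at sw v)).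
Proof.
elim: sw => [|[[j e] z] sw IHs]; first by rewrite wd_nil sec1 big_nil; exact: repr1.
rewrite wd_cons (secM0 v (D_stab j e z) (wd_stab _)) big_cons sec_D //= [v == _]eq_sym.
case: eqP => [->|_] /=; last exact: repr_mul (repr_apow _) IHs.
by rewrite subrr ev_at0; exact: repr_mul (repr_dir j e) IHs.
Qed.

End Words.

(** * Normal subgroups and branching *)

Section SectionsOfSubgroups.
Variables (p : nat) (p_prime : prime p) (p_odd : odd p) (E : spinal_datum p).
Implicit Types (f g h : tree_aut p) (x y z v k l i r s : 'F_p) (j : 'I_p)
  (e : 'rV['F_p]_p.-1) (H K M N : set (tree_aut p)).
Notation sec := (sec p_prime).
Notation Stab1 := (Stab1 p_prime).
Notation rig := (rig p_prime).
Notation G := (spinal_group E).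
Notation G1 := (G1 p_prime E).
Notation V := (family_span E).

Let sS : is_subgroup Stab1 := Stab1_subgroup p_prime.
Let sG : is_subgroup G := G_subgroup E.
Let sG1 : is_subgroup G1 := G1_subgroup p_prime E.
Let D_stab := @D_stab p p_prime.
Let G1S := @G1_stab p p_prime E.

Definition secg H x : set (tree_aut p) := (sec^~ x) @` (H `&` Stab1).

Lemma mem_secg H g x : H g -> Stab1 g -> secg H x (sec g x).
Proof. by move=> Hg g0; exists g. Qed.

Lemma secg_subgroup H x : is_subgroup H -> is_subgroup (secg H x).
Proof.
move=> sH; apply: (image_subgroup sS (secM0 x)); last by move=> g [].
exact: is_subgroupI.
Qed.

Lemma secgS H M x : H `<=` M -> secg H x `<=` secg M x.
Proof. by move=> HM _ [g [/HM Mg g0] <-]; exact: mem_secg. Qed.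

Lemma secgG x : secg G x = G.
Proof.
apply/seteqP; split=> [_ [g [Gg _] <-]|h /(G_lift p_prime x) [g [Gg g0] <-]].
  exact: G_sec.
exact: mem_secg.
Qed.

Lemma secg_sub H x : H `<=` G -> secg H x `<=` G.
Proof. by move=> /(@secgS _ _ x); rewrite secgG. Qed.

Lemma secg_fi H M x : is_subgroup M -> finite_index H M -> finite_index (secg H x) (secg M x).
Proof.
move=> sM fH; have sMS : is_subgroup (M `&` Stab1) by exact: is_subgroupI.
have fHM : finite_index (H `&` Stab1) (M `&` Stab1).
  have := fi_setI sM fH sMS (@subIsetl _ _ _); rewrite setIA.
  by congr (finite_index (_ `&` _) _); apply/seteqP; split=> g; [case|split=> //; apply: (fi_sub fH)].
by apply: (fi_image sMS _ fHM) => g h [_ g0] [_ h0]; exact: secM0.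
Qed.

Lemma secg_fiG H x : finite_index H G -> finite_index (secg H x) G.
Proof. by move=> /(secg_fi x sG); rewrite secgG. Qed.

Lemma secg_normal N x : is_normal N G -> is_normal (secg N x) G.
Proof.
move=> nN; have sN := normal_sg nN; split; first exact: secg_subgroup.
  by apply: secg_sub; exact: normal_sub nN.
move=> _ h [g [Ng g0] <-] /(G_lift p_prime x) [k [Gk k0] <-].
rewrite -secJ0 //; apply: mem_secg; first exact: (normal_J nN).
exact: (sgJ sS).
Qed.

(** Conjugation by a power of a moves a section to another coordinate without changing it. *)
Lemma secg_normal_eq N x y : is_normal N G -> secg N x = secg N y.
Proof.
move=> nN; suff sub u z : secg N u `<=` secg N z by apply/seteqP; split.
move=> _ [g [Ng g0] <-]; exists (g ^ apow (z - u)%R).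
  split; first by apply: (normal_J nN) => //; exact: G_apow.
  by apply: shiftJ g0 _; exact: apow_shift.
rewrite -[z in sec _ z](subrK u) [(z - u + u)%R]addrC.
by rewrite (secJ _ g0 (apow_shift _ _)) sec_apow conjg1.
Qed.

Hypothesis nonconst_families : forall j e, V j e -> e <> 0%R ->
  exists2 e0, V j e0 & nonconst e0.

Notation K := (gamma3 G).

Lemma K_everywhere v g : K g -> K (rig v g).
Proof. by move=> /(gamma3_everywhere p_prime p_odd nonconst_families) [_]. Qed.

Lemma K_sub : K `<=` G. Proof. exact: normal_sub (K_normal E). Qed.

Lemma rig_fi H x : finite_index H G -> finite_index [set y | K y /\ H (rig x y)] K.
Proof.
move=> fH; apply: (fi_preim (normal_sg (K_normal E)) _ fH) => //.
  by move=> g h _ _; exact: rigMM.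
by move=> _ [g Kg <-]; apply: K_sub; exact: K_everywhere.
Qed.

Lemma K_fi : finite_index K G. Proof. by case: (G_lower_central p_prime E). Qed.

Lemma rig_fiG H x : finite_index H G -> finite_index [set y | K y /\ H (rig x y)] G.
Proof. by move=> fH; apply: (fi_trans sG _ K_fi); exact: rig_fi. Qed.

Lemma pow_fi (A : 'F_p -> set (tree_aut p)) : (forall x, finite_index (A x) G) ->
  finite_index [set g | G1 g /\ forall x, A x (sec g x)] G.
Proof.
move=> fA; apply: (fi_trans sG _ (G1_fi p_prime E)).
have fAx x : finite_index [set g | G1 g /\ A x (sec g x)] G1.
  apply: (fi_preim sG1 _ (fA x)) => //; first by move=> g h /G1S ? /G1S ?; exact: secM0.
  by move=> _ [g [Gg _] <-]; exact: G_sec.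
have := fi_bigcapT sG1 fAx; congr (finite_index _ _).
by apply/seteqP; split=> g [Gg gA]; split=> // x; case: (gA x).
Qed.

(** H contains all elements of Stab_G(1) with sections in the given subgroups, and these form a
    finite-index subgroup. *)
Lemma fi_of_rig H : is_subgroup H -> H `<=` G ->
  (forall x, exists2 A, finite_index A G & forall g, A g -> H (rig x g)) ->
  finite_index H G.
Proof.
move=> sH HG HA; pose A x := projT1 (cid2 (HA x)).
have fA x : finite_index (A x) G by rewrite /A; case: cid2.
have AH x g : A x g -> H (rig x g) by rewrite /A; case: cid2 => B ? /= ?; auto.
apply: fi_up (pow_fi fA) _ HG => // g [[Gg g0] gA].
by apply: (Stab1_rig_prod sH g0) => x; exact: AH.
Qed.

(** Following the coordinate 0 loses nothing for normal N, by [secg_normal_eq]. *)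
Fixpoint secn n N : set (tree_aut p) := if n is m.+1 then secn m (secg N 0%R) else N.

(** Elements of Stab_G(1) with a common section at one coordinate are congruent modulo H. This moves
    the vector k e at z to q k e at z + s; p moves return to z with q^p = q. *)
Lemma dir_of_const_mod H : is_normal H G ->
  (forall v g, G1 g -> sec g v = 1 -> H g) -> forall j e, V j e -> H (dir j e).
Proof.
move=> nH HR; have sH := normal_sg nH.
have nc j e : V j e -> nonconst e -> H (dir j e).
  move=> Ve [x0 [y0 [x00 y00 exy0]]].
  (* The two residues are swapped if necessary so that q has a nonzero denominator. *)
  have [x [y [x0' y0' exy ey]]] : exists x y, [/\ x != 0%R, y != 0%R, ev e x != ev e y & ev e y != 0%R].
    have [ey|ey] := eqVneq (ev e y0) 0%R; last by exists x0, y0.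
    by exists y0, x0; split=> //; [rewrite eq_sym | move: exy0; rewrite ey].
  pose Rel z k z' l := H (D j (k *: e)%R z / D j (l *: e)%R z').
  have RelT z' l z k z'' r : Rel z k z' l -> Rel z' l z'' r -> Rel z k z'' r.
    by rewrite /Rel => h1 h2; have := sgM sH h1 h2; rewrite mulgA mulgVK.
  pose q := (ev e x / ev e y)%R; pose s := (x - y)%R.
  have step z k : Rel z k (z + s)%R (q * k)%R.
    rewrite /Rel -(DN p_prime) -(scaleNr (q * k)%R e); apply: (HR (z + x)%R).
      by apply: (sgM sG1); apply: G1_D; exact: VZ.
    rewrite (secM0 (z + x)%R) ?sec_D //; try exact: D_stab.
    have -> : (z + x == z) = false.
      by apply: contraNF x0' => /eqP E0; rewrite -(addKr z x) E0 addNr.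
    have E1 : (z + x - (z + s) = y)%R by rewrite /s opprD addrACA subrr add0r opprB addrC subrK.
    have -> : (z + x == z + s) = false by rewrite -subr_eq0 E1 (negPf y0').
    rewrite E1 [(z + x)%R]addrC addrK !evZ -apowD // /q mulNr mulrAC divfK //.
    by rewrite [(k * _)%R]mulrC subrr apow0.
  have steps n z k : Rel z k (z + s *+ n)%R (q ^+ n * k)%R.
    elim: n => [|n IHn]; first by rewrite addr0 mul1r /Rel mulgV; exact: (sg1 sH).
    by apply: RelT IHn _; rewrite mulrSr addrA exprS -mulrA; exact: step.
  have q1 : (1 - q != 0)%R.
    rewrite subr_eq0 eq_sym; apply: contraNneq exy => q1.
    by rewrite -[ev e x](divfK ey) -/q q1 mul1r.
  have := steps p (centre j) 1%R.
  rewrite -mulr_natr pchar_Fp_0 // mulr0 addr0 Fp_fermat // mulr1 /Rel -(DN p_prime) -(DD p_prime).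
  by rewrite -(scalerBl 1%R q e) D_centre //; exact: dir_mem.
move=> j e Ve; have [->|/eqP e0] := eqVneq e 0%R; first by rewrite dir0 //; exact: (sg1 sH).
have [e1 Ve1 nc1] := nonconst_families Ve e0.
have [|c] := pselect (nonconst e); first exact: nc.
have nc2 : nonconst (e + e1)%R.
  have [x [y [x0 y0 exy]]] := nc1; exists x, y; split=> //; rewrite !ev_is_additive.
  have -> : ev e x = ev e y by apply/eqP; apply: contra_notT c => ?; exists x, y.
  by rewrite (inj_eq (addrI _)).
rewrite -[e](addrK e1) dirD // -[dir j (- e1)%R]mul1g.
have -> : dir j (- e1)%R = (dir j e1)^-1.
  by apply: (mulgI (dir j e1)); rewrite -dirD // subrr dir0 // mulgV.
by rewrite mul1g; apply: (sgF sH); apply: nc => //; exact: VD.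
Qed.

End SectionsOfSubgroups.

Section NormalSubgroups.
Variables (p : nat) (p_prime : prime p) (p_odd : odd p) (E : spinal_datum p).
Implicit Types (f g h : tree_aut p) (x y z v k l i r s : 'F_p) (j : 'I_p)
  (e : 'rV['F_p]_p.-1) (H K M N : set (tree_aut p)).
Notation sec := (sec p_prime).
Notation shift := (shift p_prime).
Notation Stab1 := (Stab1 p_prime).
Notation rig := (rig p_prime).
Notation G := (spinal_group E).
Notation G1 := (G1 p_prime E).
Notation V := (family_span E).
Notation secg := (secg p_prime).
Notation secn := (secn p_prime).
Notation K := (gamma3 G).

Let sS : is_subgroup Stab1 := Stab1_subgroup p_prime.
Let sG : is_subgroup G := G_subgroup E.
Let sG1 : is_subgroup G1 := G1_subgroup p_prime E.
Let rig_stab := @rig_stab p p_prime.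
Let G1S := @G1_stab p p_prime E.

Hypothesis nonconst_families : forall j e, V j e -> e <> 0%R ->
  exists2 e0, V j e0 & nonconst e0.

Let nK : is_normal K G := K_normal E.
Let Keverywhere := K_everywhere p_prime p_odd nonconst_families.
Let rigfi := rig_fiG p_prime p_odd nonconst_families.

Lemma apow_neq1 k : k != 0%R -> apow k <> 1 :> tree_aut p.
Proof. by move=> /eqP k0; rewrite -apow0 // => /(apow_inj p_prime). Qed.

Lemma normal_full N : is_normal N G ->
  (forall g, G g -> exists2 h, G1 h & N (g / h)) ->
  (forall v g, G1 g -> sec g v = 1 -> N g) -> N = G.
Proof.
move=> nN NG1 NR; have sN := normal_sg nN.
apply/seteqP; split; first exact: normal_sub nN.
have Ndir := dir_of_const_mod nonconst_families nN NR.
have NG1sub : G1 `<=` N.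
  move=> g /G1_repr [sw [ok ->]]; apply: (wd_mem sN ok) => j e z Ve.
  by apply: (normal_J nN); [exact: Ndir | exact: G_apow].
apply: (G_ind p_prime sN) => //.
have [h G1h] := NG1 (apow 1%R) (G_apow 1%R).
by rewrite (sgMr _ sN) //; apply: (sgV sN); exact: NG1sub.
Qed.

(** Representatives of the section group are sections of elements of Stab_G(1) congruent to old
    representatives. Dispensing with [c0] lowers the measure of [secn_full_cover]. *)
Lemma secg_cover_drop N v (cs : seq (tree_aut p)) c0 : is_normal N G -> c0 \in cs ->
  (forall h, G h -> exists t g, [/\ t \in cs, t != c0, G1 g, N (g / t) & secg N v (h / sec g v)]) ->
  exists2 cs', (size cs' < size cs)%N & forall h, G h -> exists2 t, t \in cs' & secg N v (h / t).
Proof.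
move=> nN c0s cov; have sN := normal_sg nN.
pose rep t := sec (xget 1 [set u | G1 u /\ N (u / t)]) v.
exists [seq rep t | t <- cs & t != c0].
  rewrite size_map size_filter ltn_neqAle count_size andbT -all_count.
  by apply/allPn; exists c0; rewrite // eqxx.
move=> h /cov [t [g [ts tc0 G1g Ngt Nh]]]; exists (rep t).
  by apply: map_f; rewrite mem_filter tc0.
rewrite /rep; case: xgetP => [u _ [G1u Nut]|/(_ g)]; last by case.
have -> : h / sec u v = (h / sec g v) * sec (g / u) v.
  by rewrite secF0 ?mulgA ?mulgVK //; exact: G1S.
have sNv := secg_subgroup p_prime v sN.
apply: (sgM sNv) => //; apply: mem_secg; last by apply: (sgF sS); exact: G1S.
have -> : g / u = (g / t) / (u / t) by rewrite !gnorm.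
exact: (sgF sN).
Qed.

(* Either all coset representatives survive in the section of N at a vertex, and
   then N contains the kernels of the sections, or the index drops. *)
Lemma secn_full_cover m N (cs : seq (tree_aut p)) : (size cs <= m)%N -> is_normal N G ->
  (forall g, G g -> exists2 x, x \in cs & N (g / x)) -> exists n, secn n N = G.
Proof.
elim: m N cs => [|m IHm] N cs szm nN cov.
  by have [x] := cov _ (sg1 sG); case: cs szm {cov}.
have sN := normal_sg nN.
have rec v c0 : c0 \in cs ->
  (forall h, G h -> exists t g, [/\ t \in cs, t != c0, G1 g, N (g / t) & secg N v (h / sec g v)]) ->
  exists n, secn n N = G.
  move=> c0s /(secg_cover_drop nN c0s) [cs' szcs' cov'].
  have [|||n nE] := IHm (secg N 0%R) cs'.
  - by rewrite -ltnS; apply: leq_trans szm.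
  - exact: secg_normal.
  - by rewrite (secg_normal_eq p_prime 0%R v nN).
  by exists n.+1.
have sNv v := secg_subgroup p_prime v sN.
have [P1|/existsNP [g0 /not_implyP [Gg0 Pg0]]] :=
    pselect (forall g, G g -> exists2 h, G1 h & N (g / h)); last first.
  have [c0 c0s Nc0] := cov _ Gg0; apply: (rec 0%R c0 c0s) => h.
  move=> /(G_lift p_prime 0%R) [g G1g <-]; have [t ts Nt] := cov _ (G1_sub G1g).
  exists t, g; split=> //; last by rewrite mulgV; exact: (sg1 (sNv _)).
  apply/eqP => tc0; apply: Pg0; exists g => //.
  have -> : g0 / g = (g0 / c0) / (g / t) by rewrite tc0 !gnorm.
  exact: (sgF sN).
(* An element u outside N that is trivial at v makes its coset redundant: sections at v coming from
   it already come from N. *)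
have [P2|/existsNP [v /existsNP [u /not_implyP [G1u /not_implyP [uv Nu]]]]] :=
    pselect (forall v g, G1 g -> sec g v = 1 -> N g).
  by exists 0%N; exact: normal_full.
have [c0 c0s Nc0] := cov _ (G1_sub G1u); apply: (rec v c0 c0s) => h.
move=> /(G_lift p_prime v) [g G1g <-]; have [t ts Nt] := cov _ (G1_sub G1g).
have [tc0|tc0] := eqVneq t c0; last first.
  by exists t, g; split=> //; rewrite mulgV; exact: (sg1 (sNv _)).
have [t1 t1s Nt1] := cov _ (sg1 sG); exists t1, 1; split=> //; last 1 first.
- rewrite sec1 invg1 mulg1 -[sec g v]mulg1 -invg1 -uv -secF0; try exact: G1S.
  apply: mem_secg; last by apply: (sgF sS); exact: G1S.
  have -> : g / u = (g / t) / (u / c0) by rewrite tc0 !gnorm.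
  exact: (sgF sN).
- apply/eqP => t1c0; apply: Nu; have -> : u = (u / c0) / (1 / t1).
    by rewrite t1c0 mul1g invgK mulgVK.
  exact: (sgF sN).
- exact: (sg1 sG1).
Qed.

Lemma secn_full N : is_normal N G -> finite_index N G -> exists n, secn n N = G.
Proof.
move=> nN fN; have [cs _ cov] := fi_cover fN sG.
exact: secn_full_cover (leqnn _) nN cov.
Qed.

(** If the trivial subgroup had finite index, its iterated sections, all trivial, would reach G by
    [secn_full]. *)
Lemma fi_nontrivial H : finite_index H G -> exists2 h, H h & h <> 1.
Proof.
move=> fH; have [//|H1] := pselect (exists2 h, H h & h <> 1).
have H1E : H = [set 1].
  apply/seteqP; split=> [h Hh|_ ->]; last exact: (sg1 (fi_sg fH)).
  by apply: contrapT => h1; apply: H1; exists h.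
have sec1E x : secg [set 1] x = [set 1].
  apply/seteqP; split=> [_ [_ [-> _] <-]|_ ->]; first by rewrite /= sec1.
  by exists 1; rewrite ?sec1 //; split=> //; exact: (sg1 sS).
have nH : is_normal H G.
  split; [exact: fi_sg fH | exact: fi_sub fH | rewrite H1E => _ g -> _].
  by rewrite conj1g.
have [n] := secn_full nH fH; rewrite H1E.
have -> : secn n [set 1] = [set 1] by elim: n => //= n IHn; rewrite sec1E.
move=> GE; have : G (apow 1%R) by exact: G_apow.
rewrite -GE => /apow_neq1; case.
exact: oner_neq0.
Qed.

Lemma preim_rig_subgroup H x : is_subgroup H -> is_subgroup [set y | H (rig x y)].
Proof.
move=> sH; split=> [|y z Hy Hz|y Hy] /=.
- by rewrite rig1; exact: (sg1 sH).
- by rewrite rigMM; exact: (sgM sH).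
- by rewrite rigV; exact: (sgV sH).
Qed.

(** Induction on the depth where the sections of N become G. There a lower central term of finite
    index appears; above, [comm_rig] puts rigid copies of [[secg N x, K]] into [[N, K]]. *)
Lemma comm_K_fi N : is_normal N G -> finite_index N G ->
  finite_index (commutator_subgroup N K) G.
Proof.
move=> nN fN; have [n] := secn_full nN fN.
elim: n N nN {fN} => [|n IHn] N nN /= nE.
  rewrite nE; have [_ _ f4] := G_lower_central p_prime E; apply: (fi_up sG _ f4).
  - exact: comm_subgroup.
  - apply: comm_sub; first exact: comm_subgroup.
    by move=> x g Kx Gg; rewrite -invgR; apply: (sgV (comm_subgroup _ _)); exact: mem_comm.
  - exact: normal_sub (comm_sub_normal sG (normal_refl sG) nK).
have nC := comm_sub_normal sG nN nK.
apply: (fi_of_rig (normal_sg nC) (normal_sub nC)) => x.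
exists (commutator_subgroup (secg N x) K).
  by rewrite (secg_normal_eq p_prime x 0%R nN); apply: IHn => //; exact: secg_normal.
move=> c; apply: (comm_sub (preim_rig_subgroup x (normal_sg nC))) => _ y [g [Ng g0] <-] Ky /=.
by rewrite -comm_rig //; apply: mem_comm => //; exact: Keverywhere.
Qed.

(** Since g carries the support of [rig x y] away from x, the section of [[~ g, rig x y]] at x is
    y. *)
Lemma comm_rig_moved g k x (y z : tree_aut p) : shift k g -> k != 0%R ->
  [~ [~ g, rig x y], rig x z] = rig x [~ y, z].
Proof.
move=> gk k0.
have E1 : [~ g, rig x y] = rig (x + k)%R (y^-1 ^ sec g x) * rig x y.
  by rewrite commgEr -rigV (rigJ_shift _ _ gk).
rewrite E1 comm_rig; last by apply: (sgM sS); exact: rig_stab.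
rewrite (secM0 x) ?sec_rig ?eqxx; try exact: rig_stab.
have -> : (x == x + k) = false.
  by apply: contraNF k0 => /eqP E2; rewrite -(addKr x k) -E2 addNr.
by rewrite mul1g.
Qed.

(** If g moves the first level, N contains the rigid copies of [[K, K]]. Otherwise the section of N
    below the moved vertex has finite index by induction, and N contains the rigid copies of
    [[secg N x, K]]. *)
Lemma normal_fi_depth n N g w : is_normal N G -> N g -> (size w <= n)%N -> g w <> w ->
  finite_index N G.
Proof.
elim: n N g w => [|n IHn] N g w nN Ng.
  by case: w => // _; rewrite taut_nil.
have sN := normal_sg nN; have Gg := normal_sub nN Ng.
have [k gk] := G_shift p_prime Gg; move=> szw gw.
have [k0|k0] := eqVneq k 0%R; last first.
  apply: (fi_of_rig sN (normal_sub nN)) => x.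
  exists (commutator_subgroup K K); first by apply: comm_K_fi => //; exact: K_fi.
  move=> c; apply: (comm_sub (preim_rig_subgroup x sN)) => y z Ky Kz /=.
  rewrite -(comm_rig_moved _ _ _ gk k0).
  have GK u : K u -> G (rig x u) by move=> /(Keverywhere x); exact: (normal_sub nK).
  by apply: (normal_R nN); [apply: (normal_R nN) => //; exact: GK | exact: GK].
rewrite k0 in gk.
elim/(@vertex_ind _ p_prime) : w szw gw => [|v w _] szw; first by rewrite taut_nil.
rewrite (shift_cons _ _ gk) addr0 => gw.
have fNv : finite_index (secg N v) G.
  apply: (IHn _ (sec g v) w) => //; [exact: secg_normal | exact: mem_secg |].
  by move=> E1; rewrite E1 in gw.
apply: (fi_of_rig sN (normal_sub nN)) => x.
exists (commutator_subgroup (secg N x) K).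
  by rewrite (secg_normal_eq p_prime x v nN); apply: comm_K_fi => //; exact: secg_normal.
move=> c; apply: (comm_sub (preim_rig_subgroup x sN)) => _ y [h [Nh h0] <-] Ky /=.
rewrite -comm_rig //; apply: (normal_R nN) => //.
by apply: (normal_sub nK); exact: Keverywhere.
Qed.

Lemma neq1_moves g : g <> 1 -> exists w, g w <> w.
Proof.
move=> g1; apply: contrapT => H; apply: g1; apply: tree_autP => u.
by apply: contrapT => gu; apply: H; exists u.
Qed.

Lemma normal_fi N g : is_normal N G -> N g -> g <> 1 -> finite_index N G.
Proof. by move=> nN Ng /neq1_moves [w]; exact: (normal_fi_depth nN Ng (leqnn _)). Qed.

(** If c moved the first level, it would move the support of a nontrivial rigid element of N that it
    centralises; at deeper vertices the argument passes to sections. *)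
Lemma centraliser_trivial N c : is_normal N G -> finite_index N G -> G c ->
  (forall n, N n -> commute c n) -> c = 1.
Proof.
move=> nN fN Gc cN; apply: contrapT => /neq1_moves [w].
move: {2}(size w) (leqnn (size w)) => n.
elim: n N w c nN fN Gc cN => [|n IHn] N w c nN fN Gc cN.
  by case: w => // _; rewrite taut_nil.
have [k ck] := G_shift p_prime Gc; move=> szw; have [k0|k0] := eqVneq k 0%R; last first.
  have [y [Ky Ny] y1] := fi_nontrivial (rigfi 0%R fN); case: y1.
  have := rigJ_shift 0%R y ck.
  have -> : rig 0%R y ^ c = rig 0%R y.
    by apply/conjg_fixP/commgP/commute_sym/cN.
  move=> /(congr1 (sec^~ 0%R)) /=; rewrite sec_rigE sec_rig add0r eq_sym.
  by rewrite (negPf k0).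
rewrite k0 in ck.
elim/(@vertex_ind _ p_prime) : w szw => [|v w _] szw; first by rewrite taut_nil.
rewrite (shift_cons _ _ ck) addr0 => cw; case: (IHn (secg N v) w (sec c v)) => //.
- exact: secg_normal.
- exact: secg_fiG.
- exact: G_sec.
- by move=> _ [h [Nh h0] <-]; rewrite /commute -!(secM0 v) // (cN _ Nh).
- by move=> E1; rewrite E1 in cw.
Qed.

Lemma comm_normal_fi M N : is_normal M G -> is_normal N G -> finite_index M G ->
  finite_index N G -> finite_index (commutator_subgroup M N) G.
Proof.
move=> nM nN fM fN; have nC := comm_sub_normal sG nM nN.
have [c Mc c1] := fi_nontrivial fM.
have [all1|/existsNP [n /not_implyP [Nn /commgP/eqP cn]]] :=
    pselect (forall n, N n -> commute c n).
  by case: c1; apply: (centraliser_trivial nN fN) => //; exact: normal_sub nM _ Mc.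
by apply: (normal_fi nC) cn; exact: mem_comm.
Qed.

End NormalSubgroups.

(** * Rigid level stabilisers and conjugation in Aut(T) *)

Section RigidStabilisers.
Variables (p : nat) (x0 : 'I_p).
Implicit Types (g h k f : tree_aut p) (u v w t : vertex p) (A : set (tree_aut p)).

Lemma mul_inv_act g u : g (g^-1 u) = u.
Proof. by rewrite -[LHS]/((g^-1 * g) u) mulVg. Qed.
Lemma inv_mul_act g u : g^-1 (g u) = u.
Proof. by rewrite -[LHS]/((g * g^-1) u) mulgV. Qed.
Lemma conj_act g f u : (g ^ f) u = f (g (f^-1 u)).
Proof. by []. Qed.
Lemma act_inj g : injective g. Proof. exact: can_inj (inv_mul_act g). Qed.

Lemma act_prefix g u w w' : g (u ++ w) = u ++ w' -> g u = u.
Proof. by rewrite -(take_taut g u w) => ->; rewrite take_size_cat. Qed.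

Lemma rstab_fix A t k : rstab_vertex A t k -> k t = t.
Proof.
move=> [_ kP]; apply: contrapT => /eqP kt; case/eqP: (kt); apply: (@act_inj k).
apply: kP; apply: contra kt => /prefixP [w E].
have := congr1 size E; rewrite size_cat size_taut => /eqP.
rewrite -[X in X == _]addn0 eqn_add2l eq_sym size_eq0 => /eqP w0.
by rewrite E w0 cats0.
Qed.

Lemma rstab_stable A t k w : rstab_vertex A t k -> exists w', k (t ++ w) = t ++ w'.
Proof.
by move=> /rstab_fix kt; exists (section k t w); rewrite section_stab.
Qed.

Lemma rstab_vertex_subgroup A t : is_subgroup A -> is_subgroup (rstab_vertex A t).
Proof.
move=> sA; split=> [|g h [Ag gt] [Ah ht]|g [Ag gt]].
- by split=> //; exact: (sg1 sA).
- by split=> [|v tv]; [exact: (sgM sA) | rewrite autM gt // ht].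
- split=> [|v tv]; first exact: (sgV sA).
  by rewrite -{1}(gt v tv) inv_mul_act.
Qed.

Lemma rstab_prod A n (h : n.-tuple 'I_p -> tree_aut p) (r : seq (n.-tuple 'I_p))
    (t : n.-tuple 'I_p) w :
  (forall t : n.-tuple 'I_p, rstab_vertex A t (h t)) -> uniq r ->
  (\prod_(s <- r) h s) (t ++ w) = if t \in r then h t (t ++ w) else t ++ w.
Proof.
move=> hP; elim: r w => [|s r IHr] w; first by rewrite big_nil.
move=> /= /andP [sr ur]; rewrite big_cons autM inE.
have [ts|ts] := eqVneq t s => /=.
  rewrite -ts in sr *; have [w' ->] := rstab_stable w (hP t).
  by rewrite IHr // (negbTE sr).
have -> : h s (t ++ w) = t ++ w; last exact: IHr.
have [_ ->] := hP s => //; apply: contra ts => /prefixP [w' E].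
apply/eqP/val_inj; have := congr1 (take n) E.
by rewrite !take_size_cat ?size_tuple.
Qed.

(** The group [rstab_level A n] described without its product: the factors reappear as restrictions
    to the subtrees. This form is easy to conjugate. *)
Definition locally_rigid A n g := forall t : n.-tuple 'I_p,
  exists2 k, rstab_vertex A t k & forall w, g (t ++ w) = k (t ++ w).

Lemma locally_rigid_fix A n g t : locally_rigid A n g -> (size t <= n)%N -> g t = t.
Proof.
move=> gP tn; pose u := t ++ nseq (n - size t) x0.
have un : size u == n by rewrite size_cat size_nseq subnKC.
have [k /rstab_fix kt gk] := gP (Tuple un).
by apply: (@act_prefix g t (nseq (n - size t) x0) (nseq (n - size t) x0));
  rewrite -/u -[u]cats0 (gk [::]) cats0.
Qed.

Lemma vertex_split n u : (n <= size u)%N -> exists (t : n.-tuple 'I_p) w, u = t ++ w.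
Proof.
move=> nu; have un : size (take n u) == n by rewrite size_takel.
by exists (Tuple un), (drop n u); rewrite /= cat_take_drop.
Qed.

Lemma locally_rigid_ext A n g h : locally_rigid A n g -> locally_rigid A n h ->
  (forall (t : n.-tuple 'I_p) w, g (t ++ w) = h (t ++ w)) -> g = h.
Proof.
move=> gP hP gh; apply: tree_autP => u; have [nu|/ltnW un] := leqP n (size u).
  by have [t [w ->]] := vertex_split nu.
by rewrite (locally_rigid_fix gP un) (locally_rigid_fix hP un).
Qed.

Lemma rstab_levelP A n g : rstab_level A n g <-> locally_rigid A n g.
Proof.
have prodE (h : n.-tuple 'I_p -> tree_aut p) : (forall t : n.-tuple 'I_p, rstab_vertex A t (h t)) ->
    forall (t : n.-tuple 'I_p) w, (\prod_t h t) (t ++ w) = h t (t ++ w).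
  by move=> hP t w; rewrite (rstab_prod _ _ hP) ?index_enum_uniq // mem_index_enum.
split=> [[h hP <-] t|gP]; first by exists (h t) => // w; exact: prodE.
pose h (t : n.-tuple 'I_p) := projT1 (cid2 (gP t)).
have hP (t : n.-tuple 'I_p) : rstab_vertex A t (h t) by rewrite /h; case: cid2.
have hE (t : n.-tuple 'I_p) w : g (t ++ w) = h t (t ++ w) by rewrite /h; case: cid2.
exists h => //; apply: (@locally_rigid_ext A n) => // [t|t w].
  by exists (h t) => // w; exact: prodE.
by rewrite prodE.
Qed.

Lemma locally_rigid_subgroup A n : is_subgroup A -> is_subgroup (locally_rigid A n).
Proof.
move=> sA; split=> [t|g h gP hP t|g gP t]; have sR := rstab_vertex_subgroup t sA.
- by exists 1 => //; exact: (sg1 sR).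
- have [k kP gk] := gP t; have [l lP hl] := hP t.
  exists (k * l) => [|w]; first exact: (sgM sR).
  by rewrite !autM gk; have [w' ->] := rstab_stable w kP.
- have [k kP gk] := gP t; exists k^-1 => [|w]; first exact: (sgV sR).
  apply: (@act_inj g); rewrite mul_inv_act.
  have [w' E] := rstab_stable w (sgV sR kP).
  by rewrite E gk -E mul_inv_act.
Qed.

Lemma rstab_level_subgroup A n : is_subgroup A -> is_subgroup (rstab_level A n).
Proof.
move=> sA; suff -> : rstab_level A n = locally_rigid A n.
  exact: locally_rigid_subgroup.
by apply/seteqP; split=> g /rstab_levelP.
Qed.

Lemma rstab_level_sub A n : is_subgroup A -> rstab_level A n `<=` A.
Proof. by move=> sA _ [h hP <-]; apply: (sg_prod _ sA) => t; case: (hP t). Qed.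

Lemma prefix_act f t v : prefix t v -> prefix (f t) (f v).
Proof. by move=> /prefixP [w ->]; rewrite section_funE prefix_prefix. Qed.

Lemma locally_rigid_conj A n g f : locally_rigid A n g ->
  locally_rigid (conj_by f A) n (g ^ f).
Proof.
move=> gP t; have un : size (f^-1 t) == n by rewrite size_taut size_tuple.
have [k [Ak kP] gk] := gP (Tuple un).
exists (k ^ f); last first.
  by move=> w; rewrite !conj_act section_funE (gk (section_fun _ _ _)).
split=> [|v tv]; first by exists k.
rewrite conj_act kP ?mul_inv_act //; apply: contra tv => /(prefix_act f).
by rewrite /= !mul_inv_act.
Qed.

Lemma transitive_conj A f : spherically_transitive A -> spherically_transitive (conj_by f A).
Proof.
move=> trA u v uv; have [|g Ag gu] := trA (f^-1 u) (f^-1 v); first by rewrite !size_taut.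
by exists (g ^ f); [exists g | rewrite conj_act gu mul_inv_act].
Qed.

Lemma stab_level_conj A n g f : stab_level A n g -> stab_level (conj_by f A) n (g ^ f).
Proof.
move=> [Ag gn]; split=> [|u un]; first by exists g.
by rewrite conj_act gn ?size_taut // mul_inv_act.
Qed.

End RigidStabilisers.

(** * Transitivity, fractality and branching *)

Section Branch.
Variables (p : nat) (p_prime : prime p) (p_odd : odd p) (E : spinal_datum p).
Implicit Types (f g h : tree_aut p) (x y z v k l i r s : 'F_p) (j : 'I_p)
  (e : 'rV['F_p]_p.-1) (H K M N : set (tree_aut p)).
Notation vtx := (vtx p_prime).
Notation sec := (sec p_prime).
Notation Stab1 := (Stab1 p_prime).
Notation rig := (rig p_prime).
Notation G := (spinal_group E).
Notation G1 := (G1 p_prime E).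
Notation V := (family_span E).
Notation G' := (commutator_subgroup G G).
Notation K := (gamma3 G).

Let sS : is_subgroup Stab1 := Stab1_subgroup p_prime.
Let sG : is_subgroup G := G_subgroup E.
Let rig_stab := @rig_stab p p_prime.

Lemma G_transitive : spherically_transitive G.
Proof.
move=> u; elim/(@vertex_ind _ p_prime): u => [|x u IHu] v uv.
  by exists 1; [exact: (sg1 sG) | rewrite (size0nil (esym uv))].
elim/(@vertex_ind _ p_prime): v uv => // y v _ [/IHu [h Gh hu]].
have [g [Gg g0] gx] := G_lift p_prime x Gh.
exists (g * apow (y - x)%R); first by apply: (sgM sG) => //; exact: G_apow.
rewrite autM (shift_cons _ _ g0) addr0 gx hu.
by rewrite (shift_cons _ _ (apow_shift _ _)) sec_apow addrC subrK.
Qed.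

Lemma G_section g u : G g -> G (section g u).
Proof.
elim/(@vertex_ind _ p_prime): u g => [|x u IHu] g Gg.
  suff -> : section g [::] = g by [].
  by apply: tree_autP => w; rewrite /= /section_fun drop0.
by rewrite -cat1s section_cat; apply: IHu; exact: G_sec.
Qed.

Lemma G_fractal : fractal G.
Proof.
move=> u; apply/seteqP; split=> [_ [g [Gg _] <-]|h Gh]; first exact: G_section.
elim/(@vertex_ind _ p_prime): u h Gh => [|x u IHu] h Gh.
  exists h; first by split; rewrite ?taut_nil.
  by apply: tree_autP => w; rewrite /= /section_fun drop0.
have [k [Gk ku] <-] := IHu h Gh; have [g [Gg g0] gx] := G_lift p_prime x Gk.
exists g; first by split=> //; rewrite (shift_cons _ _ g0) addr0 gx ku.
by rewrite -cat1s section_cat -[section g _]/(sec g x) gx.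
Qed.

Lemma G'_stab : G' `<=` Stab1.
Proof.
apply: comm_sub => // g h /(G_shift p_prime) [k gk] /(G_shift p_prime) [l hl].
have := shiftM (shiftV gk) (shiftM (shiftV hl) (shiftM gk hl)).
by rewrite addrCA addKr addNr.
Qed.

Lemma K_G' : K `<=` G'. Proof. by apply: comm_subl; exact: G'_normal. Qed.

Hypothesis nonconst_families : forall j e, V j e -> e <> 0%R ->
  exists2 e0, V j e0 & nonconst e0.

(** The elements of G that fix level n and have all their sections there in [gamma3 G]: a
    finite-index source of rigid elements. *)
Fixpoint Kpow n : set (tree_aut p) :=
  if n is m.+1 then [set g | G1 g /\ forall x, Kpow m (sec g x)] else K.

Lemma Kpow_fi n : finite_index (Kpow n) G.
Proof. by elim: n => [|n IHn]; [exact: K_fi | exact: (@pow_fi p p_prime E (fun=> Kpow n) (fun=> IHn))]. Qed.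

Lemma Kpow_local n g t : Kpow n g -> size t = n ->
  exists k : tree_aut p, [/\ K k, forall v : vertex p, ~~ prefix t v -> k v = v & forall w, g (t ++ w) = k (t ++ w)].
Proof.
elim: n g t => [|n IHn] g t.
  by move=> Kg /size0nil ->; exists g; split=> // v; rewrite prefix0s.
elim/(@vertex_ind _ p_prime): t => // x t _ [[Gg g0] gK] [tn].
have [k [Kk kv kt]] := IHn _ _ (gK x) tn.
have r0 := rig_stab x k; exists (rig x k); split; first exact: (K_everywhere p_prime p_odd nonconst_families).
  elim/(@vertex_ind _ p_prime) => [|y v _] tv; first by rewrite taut_nil.
  rewrite (shift_cons _ _ r0) addr0 sec_rig; case: eqP => [E1|//].
  by rewrite kv //; apply: contra tv; rewrite E1 /= eqxx.
by move=> w; rewrite cat_cons (shift_cons _ _ g0) (shift_cons _ _ r0) sec_rigE kt.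
Qed.

Lemma Kpow_rigid n g : Kpow n g -> locally_rigid G n g.
Proof.
move=> Kg t; have [k [Kk kv kt]] := Kpow_local Kg (size_tuple t).
by exists k => //; split=> //; exact: (K_sub Kk).
Qed.

Lemma conj_branch f : branch (conj_by f G).
Proof.
split; first by apply: transitive_conj; exact: G_transitive.
move=> n; have sGf := conj_by_subgroup f sG; pose x0 := vtx 0%R.
apply: fi_up (fi_conj f (Kpow_fi n) sG) _ _ => //.
- exact: (rstab_level_subgroup x0).
- move=> _ [g /Kpow_rigid Kg <-]; apply/(rstab_levelP x0).
  exact: locally_rigid_conj.
- exact: rstab_level_sub.
Qed.

Lemma K_contains_power : contains_power K.
Proof.
move=> h Kh; exists (spread p_prime (fun x => h (vtx x))).
  apply: (Stab1_rig_prod (normal_sg (K_normal E)) (@spread_stab _ _ _)) => x.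
  by rewrite sec_spread; exact: (K_everywhere p_prime p_odd nonconst_families).
apply/ffunP => i; rewrite ffunE -(crdK p_prime i) -[LHS]/(sec _ _).
by rewrite sec_spread.
Qed.

Lemma conj_gamma3_fi f : finite_index (gamma3 (conj_by f G)) (conj_by f G).
Proof. by rewrite -conj_by_gamma3; apply: fi_conj => //; exact: K_fi. Qed.

Lemma conj_regular_branch f : regular_branch_along f (conj_by f G) (gamma3 (conj_by f G)).
Proof.
rewrite /regular_branch_along conj_byK conj_by_gamma3 conj_byK; split.
- by split; [exact: conj_branch | exact: G_fractal].
- have [k Kk k1] := fi_nontrivial p_prime nonconst_families (K_fi p_prime E).
  rewrite -conj_by_gamma3 => K1; have : conj_by f K (k ^ f) by exists k.
  by rewrite K1 => /eqP; rewrite conjg_eq1 => /eqP.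
- rewrite -conj_by_gamma3 => _ [k Kk <-]; apply: stab_level_conj.
  by apply/(stab_level1 p_prime); split; [exact: (K_sub Kk) | exact: G'_stab (K_G' Kk)].
- exact: conj_gamma3_fi.
- exact: K_contains_power.
Qed.

Lemma G_just_infinite : just_infinite G.
Proof.
split.
  move=> finG; have f1 : finite_index [set 1] G.
    have /finite_seqP [cs csE] := finG.
    apply: (@cover_fi _ _ _ cs); first exact: is_subgroup_set1.
      by move=> _ ->; exact: (sg1 sG).
    by move=> g; rewrite csE => gcs; exists g => //; rewrite mulgV.
  have [h -> //] := fi_nontrivial p_prime nonconst_families f1.
move=> N nN N1; have [g Ng g1] : exists2 g, N g & g <> 1.
  apply: contrapT => H; apply: N1; apply/seteqP; split=> [g Ng|_ ->].
    by apply: contrapT => g1; apply: H; exists g.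
  exact: (sg1 (normal_sg nN)).
exact: (normal_fi p_prime p_odd nonconst_families nN Ng g1).
Qed.

End Branch.

(** * Abelianisation, contraction and congruence subgroups *)

Section AbelianClasses.
Variables (p : nat) (p_prime : prime p) (p_odd : odd p) (E : spinal_datum p).
Implicit Types (f g h : tree_aut p) (x y z v k l i r s : 'F_p) (j : 'I_p)
  (e : 'rV['F_p]_p.-1) (H K M N : set (tree_aut p)).
Notation sec := (sec p_prime).
Notation shift := (shift p_prime).
Notation Stab1 := (Stab1 p_prime).
Notation rig := (rig p_prime).
Notation G := (spinal_group E).
Notation V := (family_span E).
Notation G' := (commutator_subgroup G G).
Notation K := (gamma3 G).
Notation wrepr := (@wrepr p).
Notation wd := (@wd p).
Notation okw := (okw E).
Notation letter := (letter p).
Implicit Types (sw : seq letter) (w : seq ('I_p * 'rV['F_p]_p.-1)).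

Let sS : is_subgroup Stab1 := Stab1_subgroup p_prime.
Let sG : is_subgroup G := G_subgroup E.
Let rig_stab := @rig_stab p p_prime.
Let D_stab := @D_stab p p_prime.

(** The coordinate for family j of the image in the abelianisation of G; [cls_uniq] shows
    independence of the word. *)
Definition cls w j : 'rV['F_p]_p.-1 := (\sum_(t <- w | t.1 == j) t.2)%R.

Lemma cls_cat w w' j : cls (w ++ w') j = (cls w j + cls w' j)%R.
Proof. exact: big_cat. Qed.
Lemma cls_perm w w' j : perm_eq w w' -> cls w j = cls w' j.
Proof. exact: perm_big. Qed.
Lemma cls_inv w j : cls [seq (t.1, - t.2)%R | t <- rev w] j = (- cls w j)%R.
Proof.
rewrite /cls big_map -sumrN; apply: perm_big.
by rewrite perm_rev.
Qed.
Lemma cls1 j e (i : 'I_p) : cls [:: (j, e)] i = if j == i then e else 0%R.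
Proof. by rewrite /cls big_mkcond big_seq1. Qed.
Lemma cls_V w j : okw w -> V j (cls w j).
Proof.
move=> ok; rewrite /cls big_seq_cond; elim/big_ind: _ => [||t]; first exact: V0.
  exact: VD.
by case/andP=> /(allP ok) + /eqP <-.
Qed.
Lemma cls_split sw j :
  cls (map fst sw) j = (\sum_v cls (map fst (word_at sw v)) j)%R.
Proof.
rewrite {1}/cls big_map (partition_big (fun t : letter => t.2) predT) //=.
by apply: eq_bigr => v _; rewrite /cls big_map big_filter_cond; apply: eq_bigl => t; rewrite andbC.
Qed.

Lemma okw_filter (P : pred letter) sw : okw (map fst sw) -> okw (map fst [seq t <- sw | P t]).
Proof.
move=> ok; apply/allP => _ /mapP [t + ->]; rewrite mem_filter => /andP [_ ts].
by apply: (allP ok); exact: map_f.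
Qed.

Lemma size_word_at sw v : ~~ all (fun t : letter => t.2 == v) sw ->
  (size (map fst (word_at sw v)) < size sw)%N.
Proof.
by move=> nall; rewrite size_map size_filter ltn_neqAle count_size andbT -all_count.
Qed.

(** The effect of taking a section where all letters sit: each letter moves to the centre of its own
    family, which separates the families. *)
Definition recentre sw : seq letter := [seq (t.1, centre t.1.1) | t <- sw].

Lemma sec_wd_same sw z : all (fun t : letter => t.2 == z) sw ->
  sec (wd sw) z = wd (recentre sw).
Proof.
elim: sw => [|[[j e] y] sw IHs] /=; first by rewrite wd_nil sec1.
case/andP=> /eqP -> /IHs {}IHs.
by rewrite !wd_cons (secM0 z (D_stab j e z) (wd_stab _ _)) IHs sec_Dz //= D_centre.
Qed.

Lemma wd_same sw j z : all (fun t : letter => (t.1.1 == j) && (t.2 == z)) sw ->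
  wd sw = D j (cls (map fst sw) j) z.
Proof.
elim: sw => [|[[i e] y] sw IHs] /=; first by rewrite wd_nil /cls big_nil D0.
case/andP=> /andP [/eqP -> /eqP ->] /IHs {}IHs.
by rewrite wd_cons IHs /= -DD // /cls big_cons eqxx.
Qed.

Lemma cls_other sw j (i : 'I_p) : all (fun t : letter => t.1.1 == j) sw -> i != j ->
  cls (map fst sw) i = 0%R.
Proof.
move=> sj ij; rewrite /cls big_map big_seq_cond big1 // => t /andP [/(allP sj)/eqP -> /eqP ji].
by rewrite ji eqxx in ij.
Qed.

(* Contraction: passing to sections shortens words, until a single letter
   whose class is not in U remains. *)
Section Contraction.
Variables (U : 'I_p -> 'rV['F_p]_p.-1 -> Prop) (Phi : tree_aut p -> Prop).
Hypotheses (U0 : forall j, U j 0%R)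
  (UD : forall j e e', U j e -> U j e' -> U j (e + e')%R).
Hypothesis Phi_sec : forall sw v, okw (map fst sw) -> Phi (wd sw) -> Phi (sec (wd sw) v).
Hypothesis Phi_stab : forall k w g, okw w -> wrepr g k w -> Phi g ->
  (exists j, ~ U j (cls w j)) ->
  exists sw, [/\ okw (map fst sw), (size sw <= size w)%N,
    exists j, ~ U j (cls (map fst sw) j) & Phi (wd sw)].

Lemma bad_word_at sw : (exists j, ~ U j (cls (map fst sw) j)) ->
  exists v, exists j, ~ U j (cls (map fst (word_at sw v)) j).
Proof.
move=> [j nU]; apply: contrapT => H; apply: nU; rewrite cls_split.
elim/big_ind: _ => [||v _]; [exact: U0 | exact: UD |].
by apply: contrapT => nU; apply: H; exists v, j.
Qed.

Lemma contraction k w g : okw w -> wrepr g k w -> Phi g -> (exists j, ~ U j (cls w j)) ->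
  exists j e z, [/\ V j e, Phi (D j e z) & ~ U j e].
Proof.
move: {2}(size w) (leqnn (size w)) => n.
elim: n w g k => [|n IHn] w g k szw okw0 rg Pg bad0.
  have w0 : w = [::] by apply: size0nil; apply/eqP; rewrite -leqn0.
  by case: bad0 => j []; rewrite w0 /cls big_nil; exact: U0.
have [sw [ok szs bad P]] := Phi_stab okw0 rg Pg bad0.
have {}szs := leq_trans szs szw.
have split_case sw' : (size sw' <= n.+1)%N -> okw (map fst sw') ->
    (exists j, ~ U j (cls (map fst sw') j)) -> Phi (wd sw') ->
    (forall v, ~~ all (fun t : letter => t.2 == v) sw') ->
    exists j e z, [/\ V j e, Phi (D j e z) & ~ U j e].
  move=> sz' ok' /bad_word_at [v bad'] P' nall.
  apply: (IHn _ _ _ _ (okw_filter _ ok') (repr_sec _ _ v) (Phi_sec v ok' P') bad').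
  by rewrite -ltnS; apply: leq_trans sz'; exact: size_word_at.
have [/existsP [z allz]|/existsPn nall] :=
    boolP [exists z : 'F_p, all (fun t : letter => t.2 == z) sw]; last exact: split_case nall.
have [/existsP [j allj]|/existsPn nallj] :=
    boolP [exists j : 'I_p, all (fun t : letter => t.1.1 == j) sw].
  have all2 : all (fun t : letter => (t.1.1 == j) && (t.2 == z)) sw.
    by apply/allP => t ts; rewrite (allP allj t ts) (allP allz t ts).
  rewrite (wd_same all2) in P; exists j, (cls (map fst sw) j), z; split=> //.
    exact: cls_V.
  by case: bad => i nUi; have [<-|ij] := eqVneq i j => //; case: nUi; rewrite (cls_other allj ij).
(* All letters sit at z but belong to several families. One section recentres them without loss; the
   centres differ, so every further section is strictly shorter. *)
have fstE : map fst (recentre sw) = map fst sw by rewrite -map_comp.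
apply: (split_case (recentre sw)); rewrite ?fstE ?size_map //.
  by rewrite -(sec_wd_same allz); exact: Phi_sec.
move=> v; apply/negP; rewrite all_map => allv.
have [j jv|nv] := pickP (fun j => centre j == v).
  case/negP: (nallj j); apply: sub_all allv => t /= /eqP tv.
  by apply/eqP/(@centre_inj _ p_prime); rewrite tv (eqP jv).
case: sw ok szs bad P allz nallj fstE allv => [|t sw] /=.
  by move=> _ _ [j []]; rewrite /cls big_nil.
by move=> _ _ _ _ _ _ _ /andP []; rewrite nv.
Qed.

End Contraction.

(** Contracting a word of nonzero class for the identity would end with a trivial [D j e z] for a
    nonzero e. *)
Lemma cls_repr1 k w j : okw w -> wrepr 1 k w -> cls w j = 0%R.
Proof.
move=> ok r1; apply: contrapT => cj.
have [] := @contraction (fun _ e => e = 0%R) (fun g => g = 1) _ _ _ _ k w 1 ok r1 (erefl _).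
- by [].
- by move=> _ e e' -> ->; rewrite addr0.
- by move=> sw v _ ->; rewrite sec1.
- move=> l w' g ok' rg g1 bad; rewrite g1 in rg.
  have l0 : l = 0%R := shift_uniq (repr_shift p_prime rg) (shift1 p_prime).
  rewrite l0 in rg; case: rg => sw E1 E2; exists sw; rewrite E1; split=> //.
    by rewrite -E1 size_map.
  by rewrite E2 apow0 // mul1g.
- by exists j.
move=> i [e [z [_ De e0]]]; apply: e0; apply: (dir_inj p_prime (j := i)).
by rewrite -(sec_Dz p_prime i e z) De sec1.
Qed.

Lemma cls_uniq g k l w w' j : okw w -> okw w' -> wrepr g k w -> wrepr g l w' ->
  cls w j = cls w' j.
Proof.
move=> ok ok' rg rg'; apply/eqP; rewrite -subr_eq0 -cls_inv -cls_cat; apply/eqP.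
have := repr_mul p_prime rg (repr_inv p_prime rg'); rewrite mulgV; apply: cls_repr1.
by rewrite okw_cat ok okw_inv.
Qed.

Lemma G'_cls g : G' g -> exists k w, [/\ okw w, wrepr g k w & forall j, cls w j = 0%R].
Proof.
apply: (comm_sub (H := [set g | exists k w, [/\ okw w, wrepr g k w & forall j, cls w j = 0%R]])).
  split=> [|x1 x2 [k [w [ok r1 c1]]] [l [w' [ok' r2 c2]]]|x1 [k [w [ok r1 c1]]]].
  - by exists 0%R, [::]; split=> // [|j]; [exact: repr1 | rewrite /cls big_nil].
  - exists (k + l)%R, (w ++ w'); split=> [||j]; first by rewrite okw_cat ok.
      exact: repr_mul.
    by rewrite cls_cat c1 c2 addr0.
  - eexists _, _; split=> [||j]; [exact: okw_inv ok | exact: repr_inv p_prime _ _ _ r1 |].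
    by rewrite cls_inv c1 oppr0.
move=> g1 g2 /(G_repr p_prime) [k [w [ok r1]]] /(G_repr p_prime) [l [w' [ok' r2]]] /=.
have rV1 := repr_inv p_prime r1; have rV2 := repr_inv p_prime r2.
have mul := repr_mul p_prime.
exists (- k + (- l + (k + l)))%R, ([seq (t.1, - t.2)%R | t <- rev w] ++
  [seq (t.1, - t.2)%R | t <- rev w'] ++ w ++ w').
split=> [||j]; first by rewrite !okw_cat !okw_inv ?ok.
  exact: (mul _ _ _ _ _ _ rV1 (mul _ _ _ _ _ _ rV2 (mul _ _ _ _ _ _ r1 r2))).
by rewrite !cls_cat !cls_inv addrCA addKr addNr.
Qed.

Section CommonVector.
Variables (j j' : 'I_p) (e : 'rV['F_p]_p.-1).
Hypotheses (Ve : V j e) (Ve' : V j' e) (jj' : j <> j') (e0 : e <> 0%R).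
Hypothesis nonsym_families : forall j e, V j e -> e <> 0%R ->
  exists2 e0, V j e0 & nonsym e0.

Let tau := dir j e * (dir j' e)^-1.

Lemma tau_notin : ~ G' tau.
Proof.
have r1 : wrepr tau 0%R [:: (j, e); (j', - e)%R].
  exists [:: (j, e, centre j); (j', - e, centre j')%R] => //.
  by rewrite !wd_cons wd_nil !D_centre // mulg1 apow0 // mul1g /tau -!(D_centre p_prime) DN.
move=> /G'_cls [k [w [ok r2 c]]]; apply: e0.
rewrite -(c j) (cls_uniq j ok _ r2 r1).
  rewrite /cls !big_cons big_nil /= eqxx; case: eqP => [E1|_]; last by rewrite addr0.
  by case: jj'.
by rewrite /okw /= Ve VN.
Qed.

(* All the rigid copies of tau coincide modulo G', because D j e z and dir j e
   are conjugate. *)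
Lemma rig_tau x : exists2 g, G' g & rig x tau = tau * g.
Proof.
have tauE : rig x tau = D j e x * (D j' e x)^-1.
  apply: rig_eq => [||y yx].
  - by apply: (sgF sS); exact: D_stab.
  - by rewrite secF0 ?sec_Dz //; exact: D_stab.
  - by rewrite secF0 ?sec_D ?(negPf yx) ?mulgV //; exact: D_stab.
exists (tau^-1 * rig x tau); last by rewrite mulVKg.
have Gb := G_dir p_prime Ve; have Gb' := G_dir p_prime Ve'.
have nG := normal_refl sG; have nG' := G'_normal E.
rewrite tauE -/(eqmod G' _ _); apply: (eqmodM nG').
- exact: (sgV sG).
- by apply: mem_comm => //; exact: G_apow.
- by apply: (eqmodV sG nG') => //; apply: mem_comm => //; exact: G_apow.
Qed.

Lemma tau_level n : exists g, [/\ G' (tau^-1 * g), G g & forall u, size u = n -> g u = u].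
Proof.
have nG' := G'_normal E; have sG' := normal_sg nG'.
elim: n => [|n [g [G'g Gg gn]]].
  exists tau; split; first by rewrite mulVg; exact: (sg1 sG').
    by apply: (sgF sG); exact: (G_dir p_prime).
  by move=> u /size0nil ->; rewrite taut_nil.
have [c G'c tauc] := rig_tau 0%R.
have G'gr : G' (rig 0%R (tau^-1 * g)).
  by have [_] := G'_everywhere p_prime p_odd nonsym_families G'g; apply.
have E1 : tau^-1 * rig 0%R g = c * rig 0%R (tau^-1 * g).
  have aux (u1 u2 u3 : tree_aut p) : u1^-1 * u3 = u2 * ((u1 * u2)^-1 * u3).
    by rewrite !gnorm.
  by rewrite rigMM rigV tauc; exact: aux.
exists (rig 0%R g); split.
- by rewrite E1; exact: (sgM sG').
- have -> : rig 0%R g = tau * (c * rig 0%R (tau^-1 * g)) by rewrite -E1 mulVKg.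
  apply: (sgM sG); first by apply: (sgF sG); exact: (G_dir p_prime).
  by apply: (normal_sub nG'); exact: (sgM sG').
- elim/(@vertex_ind _ p_prime) => // y u _ [un].
  have r0 := rig_stab 0%R g; rewrite (shift_cons _ _ r0) addr0 sec_rig.
  by case: eqP => // _; rewrite gn.
Qed.

Lemma not_congruence f : ~ congruence_subgroup_property (conj_by f G).
Proof.
have nG' := G'_normal E; have sG' := normal_sg nG'.
have [fG' _ _] := G_lower_central p_prime E.
move=> /(_ _ (fi_conj f fG' sG)) [n].
have [g [G'g Gg gn]] := tau_level n.
move=> /(_ (g ^ f)) []; first by apply: stab_level_conj; split.
move=> h G'h /conjg_inj hg; apply: tau_notin.
have -> : tau = g * (tau^-1 * g)^-1 by rewrite invgM mulVKg invgK.
by rewrite -hg; apply: (sgF sG') => //; rewrite hg.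
Qed.

End CommonVector.

Lemma shift_exp g k n : shift k g -> shift (k *+ n)%R (g ^+ n).
Proof.
move=> gk; elim: n => [|n IHn]; first by rewrite expg0; exact: shift1.
by rewrite expgS mulrS; exact: shiftM.
Qed.

Lemma exp_p_stab g k : shift k g -> Stab1 (g ^+ p).
Proof.
by move=> /(shift_exp p) gp x; rewrite gp -mulr_natr pchar_Fp_0 // mulr0.
Qed.

Lemma sec_exp g k n x : shift k g ->
  sec (g ^+ n) x = \prod_(v <- [seq (x + k *+ t)%R | t <- iota 0 n]) sec g v.
Proof.
move=> gk; elim: n x => [|n IHn] x; first by rewrite big_nil expg0 sec1.
rewrite expgS (secM _ _ gk) IHn /= big_cons addr0; congr (_ * _).
rewrite (iotaDl 1 0) -map_comp; congr bigop; apply: eq_map => t /=.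
by rewrite mulrS addrA.
Qed.

Lemma orbit_perm k y : k != 0%R ->
  perm_eq [seq (y + k *+ t)%R | t <- iota 0 p] (enum 'F_p).
Proof.
move=> k0; set l := map _ _.
have ul : uniq l.
  rewrite map_inj_in_uniq ?iota_uniq // => t u.
  rewrite !mem_iota add0n => /andP [_ tp] /andP [_ up] E1.
  have E2 : (k *+ t = k *+ u)%R := addrI y E1.
  have /(mulfI k0) E3 : (k * t%:R = k * u%:R)%R by rewrite !mulr_natr.
  have := congr1 (@nat_of_ord _) E3.
  by rewrite (Fp_natE p_prime) (Fp_natE p_prime u) (modn_small tp) (modn_small up).
have sizeF : size (enum 'F_p) = p by rewrite -cardE card_Fp.
have sub : {subset l <= enum 'F_p} by move=> z _; rewrite mem_enum.
have [|_ lE] := uniq_min_size ul sub; first by rewrite sizeF size_map size_iota.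
exact: uniq_perm ul (enum_uniq _) lE.
Qed.

Lemma repr_prod sw (l : seq 'F_p) :
  wrepr (\prod_(v <- l) sec (wd sw) v) (\sum_(v <- l) \sum_(t <- sw) ev t.1.2 (v - t.2))%R
        (flatten [seq map fst (word_at sw v) | v <- l]).
Proof.
elim: l => [|v l IHl]; first by rewrite !big_nil; exact: repr1.
by rewrite !big_cons; exact: (repr_mul p_prime (repr_sec p_prime sw v) IHl).
Qed.

Lemma word_at_perm sw (l : seq 'F_p) : perm_eq l (enum 'F_p) ->
  perm_eq (flatten [seq map fst (word_at sw v) | v <- l]) (map fst sw).
Proof.
move=> lF; apply/permP => a; rewrite count_flatten sumnE !big_map.
rewrite (perm_big _ lF) big_enum /= count_map -sum1_count.
rewrite (partition_big (fun t : letter => t.2) predT) //=.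
by apply: eq_bigr => v _; rewrite count_map count_filter sum1_count.
Qed.

Lemma ev_sum_word sw (l : seq 'F_p) : perm_eq l (enum 'F_p) ->
  (\sum_(v <- l) \sum_(t <- sw) ev t.1.2 (v - t.2) = \sum_(t <- sw) \sum_x ev t.1.2 x)%R.
Proof.
move=> lF; rewrite exchange_big; apply: eq_bigr => t _; rewrite (perm_big _ lF) big_enum.
by apply/esym; apply: (reindex_inj (subIr t.2)).
Qed.

(** The p-th power runs through a full orbit of coordinates, so a section of it collects every
    letter once, and every vector adds the sum of all its entries to the exponent of a. *)
Lemma repr_sec_exp_p sw k x : k != 0%R ->
  exists2 w, perm_eq w (map fst sw) &
    wrepr (sec ((apow k * wd sw) ^+ p) x) (\sum_(t <- sw) \sum_x ev t.1.2 x)%R w.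
Proof.
move=> k0; have gk : shift k (apow k * wd sw).
  by rewrite -[k in shift k]addr0; apply: shiftM; [exact: apow_shift | exact: wd_stab].
rewrite (sec_exp _ _ gk); set l := map _ (iota 0 p).
have -> : \prod_(v <- l) sec (apow k * wd sw) v =
          \prod_(v <- [seq (v + k)%R | v <- l]) sec (wd sw) v.
  rewrite [RHS]big_map; apply: eq_bigr => v _.
  by rewrite (secM _ _ (apow_shift _ _)) sec_apow mul1g.
have lF : perm_eq [seq (v + k)%R | v <- l] (enum 'F_p).
  have -> : [seq (v + k)%R | v <- l] = [seq (x + k + k *+ t)%R | t <- iota 0 p].
    by rewrite -map_comp; apply: eq_map => t /=; rewrite addrAC.
  exact: orbit_perm.
eexists; first exact: word_at_perm lF.
by rewrite -(ev_sum_word sw lF); exact: repr_prod.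
Qed.

(* With s the sum of the entries of e, the sections of the p-th power of
   a^s b are conjugate to a^s b. *)
Lemma torsion_sum j e : torsion G -> V j e -> (\sum_x ev e x = 0)%R.
Proof.
move=> torG Ve; have [k kE] : exists k, k = (\sum_x ev e x)%R by eexists.
rewrite -kE; have [//|k0] := eqVneq k 0%R.
pose g := apow k * D j e (centre j).
have Gg : G g by apply: (sgM sG); [exact: G_apow | exact: (G_D p_prime)].
have gk : shift k g.
  by rewrite -[k in shift k]addr0; apply: shiftM; [exact: apow_shift | exact: D_stab].
suff H n : (0 < n)%N -> g ^+ n <> 1 by have [n /H] := torG _ Gg.
have [n1] := ubnP n; elim: n1 n => // n1 IHn n nn1 n0 gn.
have pn : (p %| n)%N.
  have := shift_exp n gk; rewrite gn => /(shift_uniq (shift1 p_prime))/esym/eqP.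
  by rewrite -mulr_natr mulf_eq0 (negPf k0) orFb -(dvdn_pcharf (pchar_Fp p_prime)).
have [m nE] := dvdnP pn; rewrite nE in n0 gn.
have m0 : (0 < m)%N by case: m n0 {nE gn}.
have mn1 : (m < n1)%N.
  by rewrite -ltnS; apply: leq_trans nn1; rewrite nE !ltnS ltn_Pmulr ?prime_gt1.
have gp0 := exp_p_stab gk.
have [w wE rw] := repr_sec_exp_p [:: (j, e, centre j)] 0%R k0.
have {}wE : w = [:: (j, e)] by apply: perm_small_eq wE.
have gE : apow k * wd [:: (j, e, centre j)] = g by rewrite wd_cons wd_nil mulg1.
move: rw; rewrite gE big_seq1 wE -kE => -[[|[[j1 e1] z] [|? ?]] //= [-> ->]].
rewrite wd_cons wd_nil mulg1 /= => secE.
have gJ : apow k * D j e z = g ^ apow (z - centre j)%R.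
  rewrite /g conjMg D_apow // [(centre j + _)%R]addrC subrK; congr (_ * _).
  by rewrite /conjg -!(apowD p_prime) -(apowN p_prime) -(apowD p_prime) addrCA addNr addr0.
apply: (IHn m mn1 m0); apply/eqP.
rewrite -(conjg_eq1 _ (apow (z - centre j)%R)) conjXg -gJ -secE -secX0 //.
by rewrite -expgnA mulnC gn sec1.
Qed.

(** A constant vector has p - 1 equal entries, whose sum is minus the entry. *)
Lemma nonconst_of_sum0 e : (\sum_x ev e x = 0)%R -> e <> 0%R -> nonconst e.
Proof.
move=> sum0 e0; apply: contrapT => c; have [x x0 ex] := V_ev_neq0 p_prime e0.
have evE y : y != 0%R -> ev e y = ev e x.
  by move=> y0; apply/eqP; apply: contra_notT c => exy; exists y, x.
move: sum0; rewrite (bigD1 0%R) //= ev_at0 add0r (eq_bigr (fun=> ev e x)) //.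
rewrite sumr_const cardC1 card_Fp // -mulr_natr => /eqP.
rewrite mulf_eq0 (negPf ex) /= => /eqP /(congr1 (fun y => y + 1)%R).
rewrite natr1 prednK ?prime_gt0 // pchar_Fp_0 // add0r => /esym/eqP.
Qed.

End AbelianClasses.

(** * Dense subgroups *)

Section DenseSubgroups.
Variables (p : nat) (p_prime : prime p) (p_odd : odd p) (E : spinal_datum p).
Implicit Types (f g h : tree_aut p) (x y z v k l i r s : 'F_p) (j : 'I_p)
  (e : 'rV['F_p]_p.-1) (H K M N : set (tree_aut p)).
Notation sec := (sec p_prime).
Notation shift := (shift p_prime).
Notation Stab1 := (Stab1 p_prime).
Notation G := (spinal_group E).
Notation V := (family_span E).
Notation secg := (secg p_prime).
Notation K := (gamma3 G).
Notation wrepr := (@wrepr p).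
Notation wd := (@wd p).
Notation okw := (okw E).
Notation letter := (letter p).
Implicit Types (sw : seq letter) (w : seq ('I_p * 'rV['F_p]_p.-1)).

Let sS : is_subgroup Stab1 := Stab1_subgroup p_prime.
Let sG : is_subgroup G := G_subgroup E.
Let D_stab := @D_stab p p_prime.

Lemma stab1_fi H : is_subgroup H -> H `<=` G -> finite_index (H `&` Stab1) H.
Proof.
move=> sH HG; have := fi_setI sG (G1_fi p_prime E) sH HG.
congr (finite_index _ H); apply/seteqP; split=> g; first by case=> -[].
by move=> [Hg g0]; split=> //; split=> //; exact: HG.
Qed.

Lemma dense_sec M H x : is_subgroup H -> H `<=` G -> dense_in M H ->
  dense_in (secg M x) (secg H x).
Proof.
move=> sH HG dM L _ fL [h [Hh h0] <-].
have sHS : is_subgroup (H `&` Stab1) by exact: is_subgroupI.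
have fL' : finite_index [set g | (H `&` Stab1) g /\ L (sec g x)] H.
  apply: (fi_trans sH _ (stab1_fi sH HG)); apply: (fi_preim sHS _ fL) => //.
    by move=> g1 g2 [_ ?] [_ ?]; exact: secM0.
  exact: secg_subgroup.
have [m Mm [[_ mh0] Lm]] := dM _ _ fL' Hh.
have m0 : Stab1 m by rewrite -(sgMr m sS (sgV sS h0)).
by exists (sec m x); [exact: mem_secg | rewrite -secF0].
Qed.

Lemma conj_byG h : G h -> conj_by h G = G.
Proof.
by move=> Gh; apply/seteqP; split=> g; rewrite conj_byE => Gg;
  [rewrite -(conjgKV h g) | ]; apply: (sgJ sG) => //; exact: (sgV sG).
Qed.

Lemma dense_conj M h : dense_in M G -> G h -> dense_in (conj_by h M) G.
Proof. by move=> dM Gh; rewrite -[X in dense_in _ X](conj_byG Gh); exact: dense_in_conj. Qed.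

Lemma dense_shift M k : dense_in M G -> exists2 m, M m & shift k m.
Proof.
move=> dM; have [m Mm [_ mk]] := dM _ _ (G1_fi p_prime E) (G_apow k).
exists m => //; rewrite -(mulgVK (apow k) m) -[k in shift k]add0r.
by apply: shiftM => //; exact: apow_shift.
Qed.

Definition dense_subgroup M := [/\ is_subgroup M, M `<=` G & dense_in M G].

(** Conjugation is included because the sections of a dense subgroup at different coordinates agree
    only up to conjugation in G. *)
Inductive reach M : set (tree_aut p) -> Prop :=
| reach_refl : reach M M
| reach_sec M' x : reach M M' -> reach M (secg M' x)
| reach_conj M' h : reach M M' -> G h -> reach M (conj_by h M').

Lemma reach_trans M N H : reach M N -> reach N H -> reach M H.
Proof.
by move=> MN; elim=> [//|M' x _ IH|M' h _ IH Gh]; [exact: reach_sec | exact: reach_conj].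
Qed.

Lemma reach_dense M M' : dense_subgroup M -> reach M M' -> dense_subgroup M'.
Proof.
move=> dM; elim=> [//|{}M' x _ [sM MG dM']|{}M' h _ [sM MG dM'] Gh]; split.
- exact: secg_subgroup.
- exact: secg_sub.
- by have := @dense_sec M' G x sG (@subset_refl _ _) dM'; rewrite secgG.
- exact: conj_by_subgroup.
- by rewrite -[X in _ `<=` X](conj_byG Gh); exact: conj_byS.
- exact: dense_conj.
Qed.

(** A well-founded tree with G at its leaves; the depth is not bounded in advance. *)
Inductive bar M : Prop :=
| bar_full : M = G -> bar M
| bar_step : (forall x, bar (secg M x)) -> bar M.

Lemma secg_conj M h k x : shift k h ->
  secg (conj_by h M) (x + k)%R = conj_by (sec h x) (secg M x).
Proof.
move=> hk; apply/seteqP; split.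
  move=> _ [_ [[g Mg <-] gh0] <-].
  have g0 : Stab1 g.
    have := shiftJ gh0 (shiftV hk); rewrite conjgK; apply.
  by rewrite (secJ _ g0 hk); exists (sec g x) => //; exact: mem_secg.
move=> _ [_ [g [Mg g0] <-] <-]; rewrite -(secJ _ g0 hk); apply: mem_secg.
  by exists g.
exact: shiftJ g0 hk.
Qed.

Lemma bar_conj M h : bar M -> G h -> bar (conj_by h M).
Proof.
move=> bM; elim: bM h => [{}M -> h Gh|{}M _ IH h Gh]; first by apply: bar_full; exact: conj_byG.
have [k hk] := G_shift p_prime Gh; apply: bar_step => x.
by rewrite -(subrK k x) (secg_conj _ _ hk); apply: IH; exact: G_sec.
Qed.

Lemma conj_by_mem M m : is_subgroup M -> M m -> conj_by m M = M.
Proof.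
move=> sM Mm; apply/seteqP; split=> g; rewrite conj_byE => Mg.
  by rewrite -(conjgKV m g); apply: (sgJ sM).
by apply: (sgJ sM) => //; exact: (sgV sM).
Qed.

Lemma secg_dense_conj M x y : dense_subgroup M ->
  exists2 h, G h & secg M y = conj_by h (secg M x).
Proof.
move=> [sM MG dM]; have [m Mm mk] := dense_shift (y - x)%R dM.
exists (sec m x); first by apply: G_sec; exact: MG.
by rewrite -(secg_conj _ _ mk) conj_by_mem // addrC subrK.
Qed.

(** One path suffices: a dense subgroup contains elements realising every translation of the first
    level, so its sections are all conjugate, and [bar] is invariant under conjugation in G. *)
Lemma bar_reach M M' : dense_subgroup M -> reach M M' -> bar M' -> bar M.
Proof.
move=> dM MM'; elim: MM' => [//|{}M' x MM' IH bM'|{}M' h MM' IH Gh bM']; apply: IH.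
  apply: bar_step => y.
  by have [h Gh ->] := secg_dense_conj x y (reach_dense dM MM'); exact: bar_conj.
by rewrite -(conj_byK h M'); apply: bar_conj => //; exact: (sgV sG).
Qed.

Hypothesis sum0 : forall j e, V j e -> (\sum_x ev e x = 0)%R.

Lemma dense_cls M j e : dense_subgroup M -> V j e ->
  exists m k w, [/\ M m, okw w, wrepr m k w & forall i : 'I_p, cls w i = if j == i then e else 0%R].
Proof.
move=> [sM MG dM] Ve; have [fG' _ _] := G_lower_central p_prime E.
have [m Mm /(G'_cls p_prime) [k [w [ok rw c]]]] := dM _ _ fG' (G_dir p_prime Ve).
exists m, (k + 0)%R, (w ++ [:: (j, e)]); split=> // [||i].
- by rewrite okw_cat ok /okw /= Ve.
- by rewrite -(mulgVK (dir j e) m); apply: (repr_mul p_prime) => //; exact: repr_dir.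
- by rewrite cls_cat c add0r cls1.
Qed.

Lemma dense_reach_dir M : dense_subgroup M ->
  exists M' j e, [/\ reach M M', V j e, e <> 0%R & M' (dir j e)].
Proof.
move=> dM; have [j0 [e0 [Ve0 e00]]] := V_nontrivial E.
have [m [k [w [Mm ok rw c]]]] := dense_cls dM Ve0.
have [] := @contraction _ p_prime E (fun _ e => e = 0%R)
  (fun g => exists2 M', reach M M' & M' g) _ _ _ _ k w m ok rw.
- by [].
- by move=> _ e e' -> ->; rewrite addr0.
- move=> sw v _ [M' MM' M'g]; exists (secg M' v); first exact: reach_sec.
  by apply: mem_secg => //; exact: wd_stab.
- move=> l w' g ok' [sw swE gE] [M' MM' M'g] [i ci].
  have [l0|l0] := eqVneq l 0%R.
    exists sw; rewrite swE; split=> //; [by rewrite -swE size_map | by exists i |].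
    by exists M' => //; rewrite -[wd sw]mul1g -(apow0 p_prime) -l0 -gE.
  (* An element translating the first level is replaced by a section of its p-th power. The letters
     are the same up to order, and as each vector has entry sum 0, this section fixes the first
     level. *)
  have [w2 w2E [sw2 sw2E gE2]] := repr_sec_exp_p p_prime sw 0%R l0.
  have [sM' M'G _] := reach_dense dM MM'.
  rewrite -gE big1_seq in gE2; last first.
    move=> t /andP [_ ts]; apply: (sum0 (j := t.1.1)).
    by apply: (allP ok'); rewrite -swE; exact: map_f.
  rewrite swE in w2E; exists sw2; rewrite sw2E; split.
  + by rewrite /okw (perm_all _ w2E).
  + by rewrite -(perm_size w2E) -sw2E size_map.
  + by exists i; rewrite (cls_perm _ w2E).
  + exists (secg M' 0%R); first exact: reach_sec.
    rewrite -[wd sw2]mul1g -(apow0 p_prime) -gE2; apply: mem_secg.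
      exact: (sgX _ sM').
    by have [kg] := G_shift p_prime (M'G _ M'g); exact: exp_p_stab.
- by exists M => //; exact: reach_refl.
- by exists j0; rewrite c eqxx.
move=> j [e [z [Ve [M' MM' M'D] e_neq0]]]; exists (secg M' z), j, e; split=> //.
  exact: reach_sec.
by rewrite -(sec_Dz p_prime j e z); apply: mem_secg => //; exact: D_stab.
Qed.

End DenseSubgroups.

Section DenseReach.
Variables (p : nat) (p_prime : prime p) (p_odd : odd p) (E : spinal_datum p).
Implicit Types (f g h : tree_aut p) (x y z v k l i r s : 'F_p) (j : 'I_p)
  (e : 'rV['F_p]_p.-1) (H K M N : set (tree_aut p)).
Notation sec := (sec p_prime).
Notation Stab1 := (Stab1 p_prime).
Notation G := (spinal_group E).
Notation V := (family_span E).
Notation secg := (secg p_prime).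
Notation secn := (secn p_prime).
Notation K := (gamma3 G).
Notation wrepr := (@wrepr p).
Notation dense_subgroup := (dense_subgroup E).
Notation reach := (reach p_prime E).
Notation bar := (bar p_prime E).
Notation wd := (@wd p).
Notation okw := (okw E).
Notation letter := (letter p).
Implicit Types (sw : seq letter) (w : seq ('I_p * 'rV['F_p]_p.-1)).

Let sS : is_subgroup Stab1 := Stab1_subgroup p_prime.
Let sG : is_subgroup G := G_subgroup E.
Let D_stab := @D_stab p p_prime.

Hypothesis sum0 : forall j e, V j e -> (\sum_x ev e x = 0)%R.

Lemma V_two_ev j e : V j e -> e <> 0%R ->
  exists x y, [/\ x != 0%R, y != 0%R, x != y, ev e x != 0%R & ev e y != 0%R].
Proof.
move=> Ve /(V_ev_neq0 p_prime) [x x0 ex].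
have [y [yx ey]] : exists y, y != x /\ ev e y != 0%R.
  apply: contrapT => H; case/eqP: ex; have := sum0 Ve.
  rewrite (bigD1 x) //= big1 ?addr0 // => y yx.
  by apply/eqP; apply: contra_notT H => ey; exists y.
exists x, y; split=> //; last by rewrite eq_sym.
by apply: contraNneq ey => ->; rewrite ev_at0.
Qed.

Lemma secg_apow_eq M x y : is_subgroup M -> M (apow 1%R) -> secg M x = secg M y.
Proof.
move=> sM Ma; have Mk : M (apow (y - x)%R).
  by rewrite -[(y - x)%R]mul1r -(apowX_F p_prime); exact: (sgX _ sM).
have := secg_conj M x (apow_shift p_prime (y - x)%R).
by rewrite conj_by_mem // addrC subrK sec_apow conj_by1.
Qed.

Lemma secg_dir M j e : M (dir j e) -> secg M (centre j) (dir j e).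
Proof.
by move=> Mb; rewrite -(sec_dir_centre p_prime j e); apply: mem_secg => //; exact: dir_stab.
Qed.

Lemma secg_apow M j e i : M (dir j e) -> i != 0%R -> secg M (centre j + i)%R (apow (ev e i)).
Proof.
move=> Mb i0; have := mem_secg (centre j + i)%R Mb (dir_stab p_prime j e).
have E1 : (centre j + i - centre j = i)%R by rewrite addrC addKr.
by rewrite sec_dir // -subr_eq0 E1 (negPf i0).
Qed.

Lemma size_sum_word_at sw : (\sum_v size (word_at sw v) = size sw)%N.
Proof.
rewrite -[RHS](size_map fst) -(perm_size (word_at_perm sw (perm_refl _))).
rewrite size_flatten sumnE big_map big_map big_enum.
by apply: eq_bigr => v _; rewrite size_map.
Qed.

Lemma size_word_at3 sw x y z : x != y -> x != z -> y != z ->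
  (size (word_at sw x) + size (word_at sw y) + size (word_at sw z) <= size sw)%N.
Proof.
move=> xy xz yz; rewrite -[leqRHS]size_sum_word_at (bigD1 x) //= (bigD1 y) 1?eq_sym //=.
rewrite (bigD1 z) /=; last by rewrite ![z == _]eq_sym xz yz.
by rewrite !addnA leq_addr.
Qed.

Lemma secg_conj_dir M j e sw i x : is_subgroup M -> M (apow 1%R) ->
  M (dir j e ^ wd sw) -> i != 0%R ->
  secg M x (dir j e ^ sec (wd sw) (centre j)) /\
  secg M x (apow (ev e i) ^ sec (wd sw) (centre j + i)%R).
Proof.
move=> sM Ma Mb i0; have b0 := dir_stab p_prime j e; have w0 := wd_stab p_prime sw.
have bw0 := sgJ sS b0 w0; split.
  rewrite (secg_apow_eq x (centre j) sM Ma) -[X in X ^ _](sec_dir_centre p_prime j e).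
  by rewrite -secJ0 //; exact: mem_secg.
have := mem_secg (centre j + i)%R Mb bw0; rewrite secJ0 // sec_dir //.
have E1 : (centre j + i - centre j = i)%R by rewrite addrC addKr.
by rewrite -subr_eq0 E1 (negPf i0) (secg_apow_eq x (centre j + i)%R sM Ma).
Qed.

(** With a in M all coordinates give the same section group. It contains b^u and a^(e_i) conjugated
    by t, with u and t the sections of the word at the centre and at offset i; undoing t leaves b^(u
    t^-1). Two nonzero entries of e give two choices of i, and for one of them u and t together miss
    a letter. *)
Lemma conj_word_shrink j e M sw : dense_subgroup M -> M (apow 1%R) -> V j e -> e <> 0%R ->
  okw (map fst sw) -> M (dir j e ^ wd sw) -> ~~ all (fun t : letter => t.2 == centre j) sw ->
  exists M' w g k, [/\ reach M M', M' (apow 1%R), okw w, (size w < size sw)%N &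
                      wrepr g k w /\ M' (dir j e ^ g)].
Proof.
move=> dM Ma Ve e0 ok Mb nall; have [sM MG _] := dM.
have [x [y [x0 y0 xy ex ey]]] := V_two_ev Ve e0.
pose n z := size (word_at sw z); set c := centre j.
have [i [i0 ei ni]] : exists i, [/\ i != 0%R, ev e i != 0%R & (n c + n (c + i)%R < size sw)%N].
  have nc : (n c < size sw)%N by have := size_word_at nall; rewrite size_map.
  have cx z : z != 0%R -> c != (c + z)%R by move=> z0; rewrite -subr_eq0 opprD addNKr oppr_eq0.
  have := size_word_at3 sw (cx x x0) (cx y y0); rewrite (inj_eq (addrI c)) => /(_ xy) n3.
  have [nx|nx] := ltnP (n c + n (c + x)%R) (size sw); first by exists x.
  exists y; split=> //.
  have : (size sw + n (c + y)%R <= size sw)%N by apply: leq_trans n3; rewrite leq_add2r.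
  by rewrite -[leqRHS]addn0 leq_add2l leqn0 => /eqP ->; rewrite addn0.
have [Mc Mi] := secg_conj_dir 0%R sM Ma Mb i0.
have rc := repr_sec p_prime sw c; have ri := repr_sec p_prime sw (c + i)%R.
set u := sec (wd sw) c in rc Mc; set t := sec (wd sw) (c + i)%R in ri Mi.
have Gt : G t by apply: G_sec; exact: (G1_sub (wd_G1 p_prime ok)).
exists (conj_by t^-1 (secg M 0%R)), (map fst (word_at sw c) ++
  [seq (t.1, - t.2)%R | t <- rev (map fst (word_at sw (c + i)%R))]), (u * t^-1).
eexists; split; last split.
- apply: reach_conj; last exact: (sgV sG).
  by apply: reach_sec; exact: reach_refl.
- apply: (apow_mem p_prime _ ei).
    by apply: conj_by_subgroup; exact: secg_subgroup.
  by rewrite conj_byE invgK.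
- by rewrite okw_cat okw_inv okw_filter.
- by rewrite size_cat !size_map size_rev size_map.
- exact: (repr_mul p_prime rc (repr_inv p_prime ri)).
- by rewrite conj_byE invgK -conjgM mulgVK.
Qed.

(** Shortening stalls only if all letters sit at the centre of j. If this persists after recentring,
    they all belong to family j, and the conjugating word commutes with [dir j e]. *)
Lemma conj_word_reach n j e M g k w : dense_subgroup M -> M (apow 1%R) -> V j e -> e <> 0%R ->
  okw w -> wrepr g k w -> (size w <= n)%N -> M (dir j e ^ g) ->
  exists M', [/\ reach M M', M' (apow 1%R) & M' (dir j e)].
Proof.
elim/ltn_ind: n M g k w => n IHn M g k w dM Ma Ve e0 ok [sw swE gE] szw Mb.
have [sM MG _] := dM.
have shrink M1 sw1 : reach M M1 -> M1 (apow 1%R) -> okw (map fst sw1) -> (size sw1 <= n)%N ->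
    M1 (dir j e ^ wd sw1) -> ~~ all (fun t : letter => t.2 == centre j) sw1 ->
    exists M', [/\ reach M M', M' (apow 1%R) & M' (dir j e)].
  move=> MM1 M1a ok1 sz1 M1b nall1; have dM1 := reach_dense dM MM1.
  have [M' [w' [g' [k' [M1M' M'a ok' szw' [rg' M'b]]]]]] :=
    conj_word_shrink dM1 M1a Ve e0 ok1 M1b nall1.
  have dM' := reach_dense dM1 M1M'.
  have [M2 [M'M2 M2a M2b]] :=
    IHn _ (leq_trans szw' sz1) M' g' k' w' dM' M'a Ve e0 ok' rg' (leqnn _) M'b.
  by exists M2; split=> //; apply: reach_trans M'M2; exact: reach_trans M1M'.
pose sw1 := [seq (t.1, t.2 - k)%R | t <- sw].
have Mk : M (apow (- k)%R).
  by rewrite -[(- k)%R]mul1r -(apowX_F p_prime); exact: (sgX _ sM).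
have sw1E : map fst sw1 = w by rewrite -map_comp.
have Mb1 : M (dir j e ^ wd sw1).
  have -> : wd sw1 = g * apow (- k)%R.
    by rewrite gE -mulgA (wd_apow p_prime) mulgA -apowD // subrr apow0 // mul1g.
  by rewrite conjgM; apply: (sgJ sM).
have sz1 : (size sw1 <= n)%N by rewrite -(size_map fst) sw1E.
have ok1 : okw (map fst sw1) by rewrite sw1E.
have [all1|] := boolP (all (fun t : letter => t.2 == centre j) sw1); last first.
  by apply: (shrink M) => //; exact: reach_refl.
have [x [_ [x0 _ _ ex _]]] := V_two_ev Ve e0.
have [Mc Mi] := secg_conj_dir 0%R sM Ma Mb1 x0.
have MM1 : reach M (secg M 0%R) by apply: reach_sec; exact: reach_refl.
rewrite (sec_wd_same p_prime all1) in Mc.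
have M1a : secg M 0%R (apow 1%R).
  apply: (apow_mem p_prime _ ex); first exact: secg_subgroup.
  move: Mi; have := repr_sec p_prime sw1 (centre j + x)%R.
  have -> : word_at sw1 (centre j + x)%R = [::].
    rewrite /word_at; apply/eqP; rewrite -size_eq0 size_filter -leqn0 leqNgt -has_count.
    apply/hasPn => t /(allP all1) /eqP ->.
    by rewrite -subr_eq0 opprD addNKr oppr_eq0.
  move=> [sw2 /(congr1 size)]; rewrite size_map => /size0nil -> ->.
  rewrite wd_nil mulg1; set l := (\sum_(_ <- _) _)%R.
  by have /eqP := apow_commute p_prime (ev e x) l; rewrite -conjg_fix => /eqP ->.
have [all2|] := boolP (all (fun t : letter => t.2 == centre j) (recentre sw1)); last first.
  apply: (shrink (secg M 0%R)) => //; last by rewrite size_map.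
  by rewrite -map_comp.
exists (secg M 0%R); split=> //; move: Mc.
rewrite (@wd_same _ p_prime (recentre sw1) j (centre j)); last first.
  apply/allP => _ /mapP [t ts ->] /=.
  have /= ct := allP all2 _ (map_f (fun t : letter => (t.1, centre t.1.1)) ts).
  by rewrite ct andbT; apply/eqP/(@centre_inj _ p_prime)/eqP.
rewrite D_centre //; set e1 := cls _ _.
have -> : dir j e ^ dir j e1 = dir j e; last by [].
by apply/conjg_fixP/commgP; rewrite /commute -!dirD // addrC.
Qed.

(** The section group at offset i contains a^(e_i), hence a; that at the centre contains [dir j e].
    They are conjugate by some h, and [conj_word_reach] removes h. *)
Lemma dense_reach_apow M j e : dense_subgroup M -> V j e -> e <> 0%R -> M (dir j e) ->
  exists M', [/\ reach M M', M' (apow 1%R) & M' (dir j e)].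
Proof.
move=> dM Ve e0 Mb; have [i i0 ei] := V_ev_neq0 p_prime e0; have [sM _ _] := dM.
pose M1 := secg M (centre j + i)%R.
have MM1 : reach M M1 by apply: reach_sec; exact: reach_refl.
have dM1 := reach_dense dM MM1.
have M1a : M1 (apow 1%R).
  by apply: (apow_mem p_prime _ ei); [exact: secg_subgroup | exact: secg_apow].
have [h Gh M1E] := secg_dense_conj p_prime (centre j) (centre j + i)%R dM.
have M1b : M1 (dir j e ^ h) by rewrite /M1 M1E; exists (dir j e) => //; exact: secg_dir.
have [k [w [ok rh]]] := G_repr p_prime Gh.
have [M' [M1M' M'a M'b]] := conj_word_reach dM1 M1a Ve e0 ok rh (leqnn _) M1b.
by exists M'; split=> //; exact: reach_trans M1M'.
Qed.

(** Induction on the number of directed automorphisms missing from M. Contraction, with U given by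
    the vectors already present, leads to a section group with a new one; a and all the old ones are
    kept on the way. *)
Lemma dense_reach_full j e n M : V j e -> e <> 0%R ->
  dense_subgroup M -> M (apow 1%R) -> M (dir j e) ->
  (#|[set t : 'I_p * 'rV['F_p]_p.-1 | V t.1 t.2 && ~~ `[< M (dir t.1 t.2) >]]%SET| <= n)%N ->
  exists2 M', reach M M' & M' = G.
Proof.
move=> Ve e0; elim: n M => [|n IHn] M dM Ma Mb; have [sM MG _] := dM.
  rewrite leqn0 cards_eq0 => /eqP nil; exists M; first exact: reach_refl.
  apply/seteqP; split=> //; apply: (G_ind p_prime sM Ma) => j1 e1 Ve1.
  apply: contrapT => nM.
  have : ((j1, e1) \in [set t : 'I_p * 'rV['F_p]_p.-1 | V t.1 t.2 && ~~ `[< M (dir t.1 t.2) >]]%SET).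
    by rewrite inE Ve1 /=; apply/asboolPn.
  by rewrite nil inE.
move=> card_le.
have [[j0 [e1 [Ve1 nM]]]|all] := pselect (exists j0 e1, V j0 e1 /\ ~ M (dir j0 e1)); last first.
  exists M; first exact: reach_refl.
  apply/seteqP; split=> //; apply: (G_ind p_prime sM Ma) => j1 e1 Ve1.
  by apply: contrapT => nM; apply: all; exists j1, e1.
pose good M' := [/\ reach M M', M' (apow 1%R) & forall (i1 : 'I_p) e', M (dir i1 e') -> M' (dir i1 e')].
have good_sec M' x : good M' -> good (secg M' x).
  move=> [MM' M'a M'b]; have [sM' _ _] := reach_dense dM MM'.
  have [i i0 ei] := V_ev_neq0 p_prime e0; split.
  - exact: reach_sec.
  - rewrite (secg_apow_eq x (centre j + i)%R sM' M'a).
    apply: (apow_mem p_prime _ ei); first exact: secg_subgroup.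
    by apply: secg_apow => //; exact: M'b.
  - move=> i1 e' Mi; rewrite (secg_apow_eq x (centre i1) sM' M'a).
    by apply: secg_dir; exact: M'b.
have [m [k [w [Mm ok rw c]]]] := dense_cls p_prime dM Ve1.
have [] := @contraction _ p_prime E (fun q e' => M (dir q e'))
  (fun g => exists2 M', good M' & M' g) _ _ _ _ k w m ok rw.
- by move=> i; rewrite dir0 //; exact: (sg1 sM).
- by move=> i e2 e3 M2 M3; rewrite dirD //; exact: (sgM sM).
- move=> sw v _ [M' gM' M'g]; exists (secg M' v); first exact: good_sec.
  by apply: mem_secg => //; exact: wd_stab.
- move=> l w' g ok' [sw swE gE] [M' gM' M'g] bad; exists sw; rewrite swE; split=> //.
    by rewrite -swE size_map.
  exists M' => //; have [MM' M'a _] := gM'; have [sM' _ _] := reach_dense dM MM'.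
  rewrite -(sgMl _ sM' (_ : M' (apow l))) -?gE //.
  by rewrite -[l]mul1r -(apowX_F p_prime); exact: (sgX _ sM').
- by exists M => //; split=> //; exact: reach_refl.
- by exists j0; rewrite c eqxx.
move=> i [e' [z [Ve' [M' gM' M'D] nMe']]].
have [MM2 M2a M2b] := good_sec M' z gM'.
have M2e' : secg M' z (dir i e').
  by rewrite -(sec_Dz p_prime i e' z); apply: mem_secg => //; exact: D_stab.
have [|M3 M2M3 M3G] := IHn (secg M' z) (reach_dense dM MM2) M2a (M2b _ _ Mb).
  rewrite -ltnS; apply: leq_trans card_le; apply: proper_card; apply/properP; split.
    apply/fintype.subsetP => -[i1 e2]; rewrite !inE /= => /andP [-> /asboolPn n2].
    by apply/asboolPn => M2; apply: n2; exact: M2b.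
  by exists (i, e'); rewrite !inE /= Ve' /=; [apply/asboolPn | apply/negPn/asboolP].
by exists M3 => //; exact: reach_trans M2M3.
Qed.

Lemma dense_bar M : dense_subgroup M -> bar M.
Proof.
move=> dM; have [M1 [j [e [MM1 Ve e0 M1b]]]] := dense_reach_dir p_prime sum0 dM.
have [M2 [M1M2 M2a M2b]] := dense_reach_apow (reach_dense dM MM1) Ve e0 M1b.
have MM2 := reach_trans MM1 M1M2.
have [M3 M2M3 M3G] := dense_reach_full Ve e0 (reach_dense dM MM2) M2a M2b (leqnn _).
by apply: (bar_reach dM (reach_trans MM2 M2M3)); exact: bar_full.
Qed.

(** After n sections N, and with it H, has become G, and [dense_bar] takes over. *)
Lemma dense_fi_bar n N M H : is_subgroup M -> M `<=` H -> is_subgroup H -> H `<=` G ->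
  is_normal N G -> N `<=` H -> dense_in M H -> secn n N = G -> bar M.
Proof.
elim: n N M H => [|n IHn] N M H sM MH sH HG nN NH dM /=.
  move=> NG; apply: dense_bar; have HE : H = G by apply/seteqP; split=> //; rewrite -NG.
  by rewrite HE in MH dM *; split.
move=> nE; apply: bar_step => x; apply: (IHn (secg N x) _ (secg H x)).
- exact: secg_subgroup.
- exact: secgS.
- exact: secg_subgroup.
- exact: secg_sub.
- exact: secg_normal.
- exact: secgS.
- by move=> L h; exact: (dense_sec sH HG dM).
- by rewrite (secg_normal_eq p_prime x 0%R nN).
Qed.

End DenseReach.

(** * From finite-index sections to finite index *)

Section DenseFiniteIndex.
Variables (p : nat) (p_prime : prime p) (p_odd : odd p) (E : spinal_datum p).
Implicit Types (f g h : tree_aut p) (x y z v k l i r s : 'F_p) (j : 'I_p)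
  (e : 'rV['F_p]_p.-1) (H K M N : set (tree_aut p)).
Notation sec := (sec p_prime).
Notation Stab1 := (Stab1 p_prime).
Notation rig := (rig p_prime).
Notation G := (spinal_group E).
Notation G1 := (G1 p_prime E).
Notation V := (family_span E).
Notation secg := (secg p_prime).
Notation K := (gamma3 G).
Notation bar := (bar p_prime E).
Notation letter := (letter p).
Implicit Types (sw : seq letter) (w : seq ('I_p * 'rV['F_p]_p.-1)).

Let sS : is_subgroup Stab1 := Stab1_subgroup p_prime.
Let sG : is_subgroup G := G_subgroup E.
Let rig_stab := @rig_stab p p_prime.

Hypothesis sum0 : forall j e, V j e -> (\sum_x ev e x = 0)%R.

Let nonconst_families j e : V j e -> e <> 0%R -> exists2 e0, V j e0 & nonconst e0.
Proof. by move=> Ve e0; exists e => //; apply: (nonconst_of_sum0 p_prime) (sum0 Ve) e0. Qed.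

Let rigfi := rig_fiG p_prime p_odd nonconst_families.

(** As Y normalises F, the commutator of f in F with a rigid element of Y lies in F, and it is the
    rigid copy of a commutator with the section of f. *)
Lemma normalised_bar_fi F Y : bar F -> is_subgroup F -> F `<=` Y -> finite_index Y G ->
  (forall f g, F f -> Y g -> F (f ^ g)) -> finite_index F G.
Proof.
move=> bF; elim: bF Y => [{}F ->|{}F _ IH] Y sF FY fY FJ; first exact: fi_refl.
have sY := fi_sg fY; have YG := fi_sub fY.
apply: (fi_of_rig (p_prime := p_prime) sF (subset_trans FY YG)) => x.
have fFx : finite_index (secg F x) G.
  apply: (IH x (secg Y x)).
  - exact: secg_subgroup.
  - exact: secgS.
  - exact: secg_fiG.
  - move=> _ _ [f [Ff f0] <-] [y [Yy y0] <-]; rewrite -secJ0 //.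
    by apply: mem_secg; [exact: FJ | exact: (sgJ sS)].
pose A := core (secg F x `&` [set y | K y /\ Y (rig x y)]) G.
have fA : finite_index A G by apply: core_fi => //; apply: fi_inter => //; exact: rigfi.
have nA : is_normal A G.
  by apply: core_normal => //; apply: is_subgroupI (fi_sg fFx) (fi_sg (rigfi x fY)).
exists (commutator_subgroup A A).
  exact: (comm_normal_fi p_prime p_odd nonconst_families nA nA fA fA).
move=> c; apply: (comm_sub (@preim_rig_subgroup p p_prime F x sF)) => a b Aa Ab /=.
have [[f [Ff f0] <-] _] := core_sub sG Aa.
have [_ [_ Yb]] := core_sub sG Ab.
by rewrite -comm_rig // commgEl; apply: (sgM sF); [exact: (sgV sF) | exact: FJ].
Qed.

Section Lifting.
Variables (M H : set (tree_aut p)).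
Hypotheses (sM : is_subgroup M) (MH : M `<=` H) (fH : finite_index H G).
Hypotheses (dM : dense_in M H) (fMx : forall x, finite_index (secg M x) G).

Let sH : is_subgroup H := fi_sg fH.
Let HG : H `<=` G := fi_sub fH.

(** The common ground for M and H: normal of finite index in G, inside every section of M, and with
    all rigid copies in H. *)
Let Y := core [set g | G g /\ forall x, (secg M x `&` [set y | K y /\ H (rig x y)]) g] G.

Let fY : finite_index Y G.
Proof.
apply: core_fi => //; apply: fi_bigcapT => // x.
by apply: fi_inter => //; exact: rigfi.
Qed.
Let sY : is_subgroup Y := fi_sg fY.
Let YG : Y `<=` G := fi_sub fY.
Let nY : is_normal Y G.
Proof.
apply: core_normal => //; apply: fi_sg (fi_bigcapT sG _) => x.
by apply: fi_inter => //; exact: rigfi.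
Qed.
Let Y_in (y : tree_aut p) x : Y y -> K y /\ H (rig x y).
Proof. by move=> /(core_sub sG) [_ /(_ x) []]. Qed.

Let X := [set g | G1 g /\ forall x, Y (sec g x)].
Let fX : finite_index X G. Proof. exact: (@pow_fi p p_prime E (fun=> Y) (fun=> fY)). Qed.
Let sX : is_subgroup X := fi_sg fX.
Let XH : X `<=` H.
Proof.
move=> g [[Gg g0] gY]; apply: (Stab1_rig_prod sH g0) => x.
by case: (Y_in x (gY x)).
Qed.
Let fXH : finite_index X H := fi_sub_in sG fX sH XH HG.
Let XS : X `<=` Stab1. Proof. by move=> g [[]]. Qed.
Let X_rig x (y : tree_aut p) : Y y -> X (rig x y).
Proof.
move=> Yy; have [Ky Hy] := Y_in x Yy; split; first by split; [exact: HG | exact: rig_stab].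
by move=> z; rewrite sec_rig; case: eqP => // _; exact: (sg1 sY).
Qed.

Let C := M `&` X.
Let sC : is_subgroup C. Proof. exact: is_subgroupI. Qed.
Let CS : C `<=` Stab1. Proof. by move=> g [_ /XS]. Qed.
Let C_dense : dense_in C X.
Proof.
move=> L t fL Xt; have [m Mm Lm] := dM (fi_trans sH fL fXH) (XH Xt).
exists m => //; split=> //; rewrite -(mulgVK t m); apply: (sgM sX) => //.
exact: (fi_sub fL).
Qed.

Let X_preim_fi x P : finite_index P Y -> finite_index [set g | X g /\ P (sec g x)] X.
Proof.
move=> fP; apply: (fi_preim sX _ fP) => //; first by move=> g h /XS ? /XS ?; exact: secM0.
by move=> _ [g [_ gY] <-].
Qed.

(** The left side has finite index in Y and is dense in it. *)
Let secC x : secg C x = Y.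
Proof.
have CY : secg C x `<=` Y by move=> _ [c [[_ [_ cY]] _] <-].
have fC : finite_index C M.
  by have := fi_setI sH fXH sM MH; rewrite setIC.
have fCx : finite_index (secg C x) Y.
  apply: (fi_sub_in sG) => //; apply: (fi_trans sG _ (fMx x)).
  exact: secg_fi.
apply/seteqP; split=> // t Yt.
have [c [Mc Xc] [_]] := C_dense (X_preim_fi x fCx) (X_rig x Yt).
rewrite secF0 ?sec_rigE; [|exact: XS|exact: rig_stab].
have Cc : secg C x (sec c x) by apply: mem_secg; [split | exact: XS].
by rewrite (sgMl _ (fi_sg fCx) Cc) (sgVE _ (fi_sg fCx)).
Qed.

(* The elements of C supported away from y have dense, hence full, sections at
   any other coordinate: this is where density excludes diagonal subgroups. *)
Let kernel_full x y : x != y ->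
  (sec^~ x) @` [set c | C c /\ sec c y = 1] = Y.
Proof.
move=> xy; pose Cy := [set c | C c /\ sec c y = 1]; rewrite -/Cy; set F := _ @` Cy.
have sCy : is_subgroup Cy.
  by apply: (preim_subgroup sC (phi := sec^~ y) _ (is_subgroup_set1)) => g h /CS ? /CS ?; exact: secM0.
have CyS : Cy `<=` Stab1 by move=> g [/CS].
have sF : is_subgroup F.
  exact: (image_subgroup sS (secM0 x)).
have FY : F `<=` Y by move=> _ [c [[_ [_ cY]] _] <-].
have FJ f (v : tree_aut p) : F f -> Y v -> F (f ^ v).
  move=> [c [Cc cy] <-]; rewrite -(secC x) => -[c' [Cc' c'0] <-].
  exists (c ^ c'); last by rewrite /= secJ0 //; exact: CS.
  by split; [exact: (sgJ sC) | rewrite secJ0 ?cy ?conj1g //; exact: CS].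
have dF : dense_in F Y.
  move=> P0 t fP0 Yt; pose P := core P0 Y.
  have fP : finite_index P Y by exact: core_fi.
  have sP := fi_sg fP; have nP : is_normal P Y by apply: core_normal => //; exact: fi_sg fP0.
  pose C0 := [set c | C c /\ P (sec c x)].
  have CM z : morph_on C (sec^~ z) by move=> g h /CS ? /CS ?; exact: secM0.
  have fC0 : finite_index C0 C.
    by apply: (fi_preim sC (CM x) fP) => // _ [c [_ [_ cY]] <-].
  have fQ : finite_index ((sec^~ y) @` C0) Y.
    have := fi_image sC (CM y) fC0; congr (finite_index _ _).
    rewrite -(secC y); congr image; apply/seteqP; split=> [c Cc|c []//].
    by split=> //; exact: CS.
  have fL : finite_index [set g | X g /\ ((sec^~ y) @` C0) (sec g y)] X by exact: X_preim_fi.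
  (* Density of C gives c close to [rig x t] at x and with the same section at y as some c' in [C0].
     Then c / c' is trivial at y and, modulo P, still close to t at x. *)
  have [c Cc [[_ Pc] [_ [c' [Cc' Pc'] cc']]]] :=
    C_dense (fi_inter sX (X_preim_fi x fP) fL) (X_rig x Yt).
  have cS := CS Cc; have c'S := CS Cc'.
  rewrite (secF0 y cS (rig_stab x t)) sec_rig eq_sym (negPf xy) invg1 mulg1 in cc'.
  rewrite (secF0 x cS (rig_stab x t)) sec_rigE in Pc.
  exists (sec (c / c') x).
    exists (c / c') => //; split; first exact: (sgF sC).
    by rewrite secF0 // -cc' mulgV.
  apply: (core_sub sY (G := Y)); rewrite -/P secF0 //.
  have -> : sec c x / sec c' x / t = (sec c x / t) * (sec c' x)^-1 ^ t^-1.
    by rewrite /conjg !gnorm.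
  apply: (sgM sP) => //; apply: (normal_J nP); first exact: (sgV sP).
  exact: (sgV sY).
have [n nE] := secn_full p_prime nonconst_families nY fY.
have bF : bar F.
  by apply: (@dense_fi_bar p p_prime E sum0 n Y F Y sF FY sY YG nY _ dF nE).
have fF := normalised_bar_fi bF sF FY fY FJ.
by apply: (dense_in_fi_eq dF FY); exact: (fi_sub_in sG fF sY FY YG).
Qed.

(** Coordinates are cleared one at a time: if c is trivial on l and d is trivial at y, their
    commutator is trivial at both. By [kernel_full] the section of d at x can be any element of
    Y. *)
Let rigid_part x (l : seq 'F_p) : x \notin l -> exists A, [/\ is_normal A G, finite_index A G &
  forall a, A a -> exists c, [/\ M c, Stab1 c, sec c x = a & forall y, y \in l -> sec c y = 1]].
Proof.
elim: l => [_|y l IHl].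
  exists Y; split=> // a; rewrite -(secC x) => -[c [[Mc _] c0] <-].
  by exists c.
rewrite inE negb_or => /andP [xy /IHl [A [nA fA AM]]].
exists (commutator_subgroup A Y); split; first exact: comm_sub_normal.
  exact: (comm_normal_fi p_prime p_odd nonconst_families nA nY fA fY).
pose T := [set c | (M `&` Stab1) c /\ forall z, z \in y :: l -> sec c z = 1].
have sT : is_subgroup T.
  split=> [|g h [[Mg g0] gl] [[Mh h0] hl]|g [[Mg g0] gl]].
  - by split=> [|z _]; [split; [exact: (sg1 sM) | exact: (sg1 sS)] | rewrite sec1].
  - split=> [|z zl]; first by split; [exact: (sgM sM) | exact: (sgM sS)].
    by rewrite (secM0 z) // gl // hl // mulg1.
  - split=> [|z zl]; first by split; [exact: (sgV sM) | exact: (sgV sS)].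
    by rewrite secV0 // gl // invg1.
have sTx : is_subgroup ((sec^~ x) @` T).
  by apply: (image_subgroup sS (secM0 x)) => // g [[]].
move=> a; have sub : commutator_subgroup A Y `<=` (sec^~ x) @` T.
  apply: comm_sub => // u v /AM [c [Mc c0 cx cl]].
  rewrite -{1}(kernel_full xy) => -[d [Cd dy] <-].
  have [Md Xd] := Cd; have d0 := XS Xd.
  exists [~ c, d]; last by rewrite /= secR0 // cx.
  split; first by split; [exact: (sgR sM) | exact: (sgR sS)].
  move=> z; rewrite inE => /predU1P [->|zl]; rewrite secR0 //.
    by rewrite dy commg1.
  by rewrite cl // comm1g.
by move=> /sub [c [[Mc c0] cl] <-]; exists c.
Qed.

Lemma lift_fi : finite_index M G.
Proof.
apply: (fi_of_rig (p_prime := p_prime) sM (subset_trans MH HG)) => x.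
have [|A [_ fA AM]] := @rigid_part x [seq y <- enum 'F_p | y != x].
  by rewrite mem_filter eqxx.
exists A => // a /AM [c [Mc c0 cx cl]]; suff -> : rig x a = c by [].
by apply: rig_eq => // y yx; apply: cl; rewrite mem_filter yx mem_enum.
Qed.

End Lifting.

Lemma dense_in_fi M H : bar M -> is_subgroup M -> M `<=` H -> finite_index H G ->
  dense_in M H -> finite_index M G.
Proof.
move=> bM; elim: bM H => [{}M ->|{}M _ IH] H sM MH fH dM; first exact: fi_refl.
apply: (lift_fi sM MH fH dM) => x; apply: (IH x (secg H x)).
- exact: secg_subgroup.
- exact: secgS.
- exact: secg_fiG.
- by move=> L h; exact: (dense_sec (fi_sg fH) (fi_sub fH) dM).
Qed.

Lemma dense_in_eq M H : is_subgroup M -> M `<=` H -> finite_index H G -> dense_in M H -> M = H.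
Proof.
move=> sM MH fH dM; have sH := fi_sg fH; have HG := fi_sub fH.
have fN := core_fi sG fH; have nN := core_normal sG sH.
have [n nE] := secn_full p_prime nonconst_families nN fN.
have bM : bar M.
  exact: (dense_fi_bar sum0 sM MH sH HG nN (core_sub sG (H := H)) dM nE).
apply: (dense_in_fi_eq dM MH); apply: (fi_sub_in sG) => //.
exact: (dense_in_fi bM sM MH fH dM).
Qed.

End DenseFiniteIndex.

(** * Translation of the hypotheses and transport by conjugation *)

Section Vectors.
Variables (p : nat) (p_prime : prime p) (E : spinal_datum p).
Implicit Types (j : 'I_p) (e : 'rV['F_p]_p.-1).

Lemma nonconst_of_not_constant e : ~ constant_vector e -> nonconst e.
Proof.
move=> ce; apply: contrapT => ne; apply: ce => i k.
have [x ix x0] := pos_ev p_prime i; have [y ky y0] := pos_ev p_prime k.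
rewrite -(ev_pos e ix) -(ev_pos e ky); apply: contrapT => exy; apply: ne.
by exists x, y; split=> //; apply/eqP.
Qed.

Lemma nonsym_of_non_symmetric e : non_symmetric_vector e -> nonsym e.
Proof.
move=> [i ei]; have [x ix x0] := pos_ev p_prime i; exists x; apply/eqP.
(* Position i stands for the residue x = i + 1, so [rev_ord i] stands for p - x. *)
rewrite (ev_pos e ix) (@ev_pos _ e (rev_ord i)) //=; rewrite -ix (Fp_cast p_prime).
have p0 := prime_gt0 p_prime; rewrite modn_small; last by rewrite ltn_subrL.
by rewrite -(subSn (ltn_ord i)) prednK.
Qed.

Lemma families_of_rows (P : 'rV['F_p]_p.-1 -> Prop) :
  (forall j, family_size E j <> 0%N ->
     exists i : 'I_(family_size E j), P (defining_vector i)) ->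
  forall j e, family_span E j e -> e <> 0%R -> exists2 e0, family_span E j e0 & P e0.
Proof.
move=> h j e Ve /(family_nonempty Ve) /h [i Pi].
by exists (defining_vector i) => //; exact: V_row.
Qed.

End Vectors.

Section Conjugates.
Context {gT : groupType}.
Implicit Types (x y : gT) (G H M : set gT).

Lemma conjXg_iter x y n : (x ^ y) ^+ n = (x ^+ n) ^ y.
Proof. by elim: n => [|n IHn]; rewrite ?expg0 ?conj1g // !expgS IHn conjMg. Qed.

Lemma torsion_conj y G : torsion G -> torsion (conj_by y G).
Proof.
move=> tG _ [x Gx <-]; have [n n0 xn] := tG x Gx.
by exists n => //; rewrite conjXg_iter xn conj1g.
Qed.

Lemma just_infinite_conj y G : is_subgroup G -> just_infinite G -> just_infinite (conj_by y G).
Proof.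
move=> sG [infG jG]; split.
  move=> finG; apply: infG; rewrite -(conj_byK y G); exact: finite_image.
move=> N [sN NG nN] N1; rewrite -(conj_byKV y N); apply: fi_conj => //; apply: jG.
  split; first exact: conj_by_subgroup.
    by rewrite -(conj_byK y G); exact: conj_byS.
  move=> x g; rewrite !conj_byE invgK => Nx Gg.
  by rewrite conjJg; apply: nN => //; exists g.
by move=> N1'; apply: N1; rewrite -(conj_byKV y N) N1' /conj_by image_set1 conj1g.
Qed.

Lemma isomorphic_refl G : isomorphic G G.
Proof. by exists id; split=> //; split=> // x Gx; exists x. Qed.

Lemma dense_in_conj_eq y G H : is_subgroup G -> finite_index H (conj_by y G) ->
  (forall H M, is_subgroup M -> M `<=` H -> finite_index H G -> dense_in M H -> M = H) ->
  forall M, is_subgroup M -> M `<=` H -> dense_in M H -> M = H.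
Proof.
move=> sG fH eqG M sM MH dM; have sH := fi_sg fH.
rewrite -(conj_byKV y M) -(conj_byKV y H); congr (conj_by _ _); apply: eqG.
- exact: conj_by_subgroup.
- exact: conj_byS.
- by rewrite -(conj_byK y G); apply: fi_conj => //; exact: conj_by_subgroup.
- exact: dense_in_conj.
Qed.

End Conjugates.

Theorem theorem1p4 (p : nat) (p_prime : prime p) (p_odd : odd p)
    (E : spinal_datum p) (f : tree_aut p) (G : set (tree_aut p))
    (defG : G = conj_by f (spinal_group E)) :
  (((forall j : 'I_p, family_size E j <> 0%N ->
       exists i : 'I_(family_size E j), ~ constant_vector (defining_vector i)) ->
     regular_branch_along f G (gamma3 G)) /\
   (torsion G -> just_infinite G /\ branch G)) /\
  (torsion G ->
     no_proper_dense_subgroup G /\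
     forall (hT : groupType) (H : set hT),
       is_subgroup H -> commensurable G H -> no_proper_dense_subgroup H) /\
  ((forall j : 'I_p, family_size E j <> 0%N ->
      exists i : 'I_(family_size E j),
        non_symmetric_vector (defining_vector i)) ->
   (exists (j k : 'I_p) (i : 'I_(family_size E j)) (l : 'I_(family_size E k)),
      j <> k /\ defining_vector i = defining_vector l) ->
   ~ congruence_subgroup_property G).
Proof.
have sG0 := G_subgroup E; have sG : is_subgroup G by rewrite defG; exact: conj_by_subgroup.
have sums : torsion G -> forall j e, family_span E j e -> (\sum_x ev e x = 0)%R.
  move=> tG j e; apply: (torsion_sum p_prime).
  by rewrite -(conj_byK f (spinal_group E)) -defG; exact: torsion_conj.
split; [split|split].
- move=> /(@families_of_rows _ E (fun e => ~ constant_vector e)) nonconstE; rewrite defG; apply: conj_regular_branch => // j e Ve e0.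
  by have [e1 Ve1 c1] := nonconstE j e Ve e0; exists e1 => //; exact: nonconst_of_not_constant.
- move=> /sums sum0; have nc j e : family_span E j e -> e <> 0%R -> exists2 e0, family_span E j e0 & nonconst e0.
    by move=> Ve e0; exists e => //; apply: (nonconst_of_sum0 p_prime) (sum0 j e Ve) e0.
  rewrite defG; split; last exact: conj_branch.
  by apply: just_infinite_conj => //; exact: G_just_infinite.
- move=> /sums sum0.
  have dense_eq A : finite_index A G -> forall M, is_subgroup M -> M `<=` A -> dense_in M A -> M = A.
    rewrite defG => fA; apply: dense_in_conj_eq fA _ => // H M sM MH fH dM.
    exact: (dense_in_eq p_prime p_odd sum0).
  split; first exact: (no_proper_dense_of_isomorphic sG sG (fi_refl sG) (isomorphic_refl G)
    (dense_eq G (fi_refl sG))).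
  move=> hT H sH [A [B [fA fB AB]]].
  exact: (no_proper_dense_of_isomorphic (fi_sg fA) sH fB AB (dense_eq A fA)).
- move=> /(@families_of_rows _ E (@non_symmetric_vector p)) nonsymE [j [k [i [l [jk il]]]]]; rewrite defG.
  apply: (not_congruence p_prime p_odd (V_row i) _ jk (@row_neq0 _ _ _ i)).
    by rewrite il; exact: V_row.
  move=> j' e Ve e0; have [e1 Ve1 c1] := nonsymE j' e Ve e0.
  by exists e1 => //; exact: nonsym_of_non_symmetric.
Qed.
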